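(* Let $h\ge 0$ and let $\sigma_1,\sigma_2,\ldots$ be i.i.d. symmetric random variables with values in $[-1,1]$. Define $\phi$ by $$e^{\phi(u,v)}=\mathbf{E}\left[e^{u\sigma_1+v\sigma_1^2}\right],\qquad (u,v)\in\mathbb{R}^2,$$ and, for $x\ge 0$, $$q^{\mathrm{lin}}(x)=\mathbf{E}^{(g)}\left[\left(\partial_u\phi\left(h+g\sqrt{x},-x/2\right)\right)^2\right],$$ where $g$ is a standard $\mathcal{N}(0,1)$ Gaussian random variable. Let $\alpha_n(t)$ be the mean free energy of the Sherrington-Kirkpatrick model with spins $\sigma_i$ and external field $h$ (defined in the context). Then there exists a number $t_c>0$ such that for all $0\le t\le t_c$ the equation $q^{\mathrm{lin}}(2qt)=q$ has a unique solution $q=q_c(t)$ in $[0,\infty)$, and $$\lim_{n\to\infty}\alpha_n(t)=\alpha_\infty(t)=\frac{t}{2}q^2+\mathbf{E}^{(g)}\left[\phi\left(h+g\sqrt{2qt},-qt\right)\right]\qquad\text{with } q=q_c(t).$$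
   Context: $\mathbf{E}$ denotes expectation with respect to the spins and $\mathbf{E}^{(g)}$ expectation with respect to the Gaussian disorder, which is independent of the spins. For $n\ge1$ and $\sigma=(\sigma_1,\ldots,\sigma_n)$, the Hamiltonian is $$H_n(\sigma)=\sqrt{\frac{2}{n}}\sum_{1\le i<j\le n}g_{ij}\sigma_i\sigma_j+\frac{1}{\sqrt n}\sum_{i=1}^n g_{ii}\sigma_i^2,$$ where $(g_{ij})_{1\le i\le j\le n}$ are i.i.d. $\mathcal{N}(0,1)$. The overlap of two configurations is $q_{12}(\sigma,\tau)=\frac1n\sum_{i=1}^n\sigma_i\tau_i$. The covariance of $H_n$ under $\mathbf{E}^{(g)}$ is $n\,q_{12}(\sigma,\tau)^2$. For $t\ge0$, the partition function (a random variable depending on the $g_{ij}$) and the mean free energy are $$Z_n(t)=\mathbf{E}\left[\exp\left(\sqrt t\,H_n(\sigma)+h\sum_{i=1}^n\sigma_i-\frac t2\,n\,q_{12}(\sigma,\sigma)^2\right)\right],\qquad \alpha_n(t)=\frac1n\mathbf{E}^{(g)}\left[\log Z_n(t)\right].$$ *)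

(* Defs.v *)
From HB Require Import structures.
From mathcomp Require Import all_boot all_order all_algebra finmap.
From mathcomp Require Import all_classical all_reals all_analysis.

Set Implicit Arguments.
Unset Strict Implicit.
Unset Printing Implicit Defensive.

Import Order.TTheory GRing.Theory Num.Theory.
Import numFieldNormedType.Exports.

Local Open Scope classical_set_scope.
Local Open Scope ring_scope.

(* Mutual independence of the subfamily (X i)_(i in D). *)
Definition mutually_independent d d' (T : measurableType d)
    (T' : measurableType d') (R : realType) (P : probability T R)
    (I : choiceType) (D : set I) (X : I -> {RV P >-> T'}) : Prop :=
  forall (J : {fset I}) (A : I -> set T'),
    [set` J] `<=` D -> (forall i, i \in J -> measurable (A i)) ->
    P (\bigcap_(i in [set` J]) (X i @^-1` A i)) =
      (\prod_(i <- J) P (X i @^-1` A i))%E.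

Definition has_law d d' (T : measurableType d) (T' : measurableType d')
    (R : realType) (P : probability T R) (X : {RV P >-> T'})
    (mu : set T' -> \bar R) : Prop :=
  forall A, measurable A -> distribution P X A = mu A.

Definition iid d d' (T : measurableType d) (T' : measurableType d')
    (R : realType) (P : probability T R) (X : nat -> {RV P >-> T'}) : Prop :=
  mutually_independent setT X /\
  forall i j, has_law (X i) (distribution P (X j)).

Definition symmetric_rv d (T : measurableType d) (R : realType)
    (P : probability T R) (X : {RV P >-> R}) : Prop :=
  forall A, measurable A -> P (X @^-1` A) = P ((fun w => - X w) @^-1` A).

(* The array (g i j)_(i <= j) is i.i.d. standard Gaussian; nothing is required
   (or used) of the entries with j < i. *)
Definition gaussian_disorder d (T : measurableType d) (R : realType)
    (P : probability T R) (g : nat -> nat -> {RV P >-> R}) : Prop :=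
  mutually_independent [set ij : nat * nat | (ij.1 <= ij.2)%N]
    (fun ij => g ij.1 ij.2) /\
  forall i j, (i <= j)%N -> has_law (g i j) (normal_prob 0 1).

Section SherringtonKirkpatrick.
Context {R : realType}.

(* Sites are numbered from 0, so the first spin is [sigma 0]. *)
Definition hamiltonian (g : nat -> nat -> R) (n : nat) (s : 'I_n -> R) : R :=
  Num.sqrt (2 / n%:R) * (\sum_(i < n) \sum_(j < n | (i < j)%N) g i j * s i * s j)
  + (Num.sqrt n%:R)^-1 * \sum_(i < n) g i i * s i ^+ 2.

Definition overlap (n : nat) (s s' : 'I_n -> R) : R :=
  n%:R^-1 * \sum_(i < n) s i * s' i.

Context {d : measure_display} {T : measurableType d} {P : probability T R}.
Variables (sigma : nat -> {RV P >-> R}) (h : R).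

Definition partition_function (g : nat -> nat -> R) (n : nat) (t : R) : R :=
  fine 'E_P[fun w => let s := fun i : 'I_n => sigma i w in
    expR (Num.sqrt t * hamiltonian g s + h * \sum_(i < n) s i
          - t / 2 * n%:R * overlap s s ^+ 2)].

Definition mean_free_energy d' (T' : measurableType d') (Pg : probability T' R)
    (g : nat -> nat -> {RV Pg >-> R}) (n : nat) (t : R) : R :=
  n%:R^-1 *
  fine 'E_Pg[fun w => ln (partition_function (fun i j => g i j w) n t)].

Definition phi (u v : R) : R :=
  ln (fine 'E_P[fun w => expR (u * sigma 0%N w + v * sigma 0%N w ^+ 2)]).

Definition dphi_du (u v : R) : R := derive1 (fun u' => phi u' v) u.

(* Expectation of f(g) for a standard Gaussian variable g. *)
Definition gaussian_mean (f : R -> R) : R := fine 'E_(normal_prob 0 1)[f].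

Definition qlin (x : R) : R :=
  gaussian_mean (fun g => dphi_du (h + g * Num.sqrt x) (- x / 2) ^+ 2).

(* The limiting free energy, for an arbitrary overlap parameter q. *)
Definition replica_symmetric_energy (t q : R) : R :=
  t / 2 * q ^+ 2
  + gaussian_mean (fun g => phi (h + g * Num.sqrt (2 * q * t)) (- (q * t))).

End SherringtonKirkpatrick.

(* Main.v *)
(* Quadratic replica coupling (Guerra-Toninelli) on a discrete time scale. Let
   L(G) = ln E[exp G] for a potential G of the spins. In K steps of size
   r = 1 / sqrt K the disorder is replaced by random signs: an SK step averages L over
   signs in front of the features sqrt(t / n) s_i s_j, a decoupled step does so with
   sqrt(2 q t) s_i, and both subtract their quadratic drift. Exchanging one step for the
   other changes L by (r^2 t n / 2) (q^2 - <(q_12 - q)^2>) up to O(r^3). The Gibbs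
   average of (q_12 - q)^2 is controlled by the two-replica energy with the extra
   coupling lam n (q_12 - q)^2, and letting lam decrease along the path makes that energy
   monotone; hence all the deviations are bounded by their value for the decoupled
   system. There the sites are independent, and the coupled energy is o(n) exactly when q
   is the Gaussian mean of the squared magnetization, that is, at a solution of the
   fixed point equation.
   The SK side does not involve q, so two solutions would force the overlap to
   concentrate at two different values, which gives uniqueness; existence is the
   intermediate value theorem. Finally signs are exchanged for Gaussian couplings by
   comparing moments up to order three, the couplings being first rounded to finitely
   many values so that only the independence of events is needed. *)
From HB Require Import structures.
Require Import Defs.
From mathcomp Require Import all_boot all_order all_algebra finmap.
From mathcomp Require Import all_classical all_reals all_analysis.
From mathcomp Require Import zify ring lra.
From mathcomp Require Import measurable_realfun.
Import Order.TTheory GRing.Theory Num.Theory.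
Import numFieldNormedType.Exports.
Local Open Scope classical_set_scope.
Local Open Scope ring_scope.
Set Implicit Arguments. Unset Strict Implicit. Unset Printing Implicit Defensive.

(** * Exponential estimates and normalized means *)

(** The exchange is made discrete because the continuous argument needs Gaussian integration by
    parts and time derivatives of nested expectations. No probability space carries the signs: a
    step is an operator on functionals of the potential, and all that is asked of it is in [markov]
    and [commuting]. Steps commute because potentials add, so a decoupled step can be traded for an
    SK step at any position, and a single trade is a second-order cumulant expansion under a Gibbs
    mean. The coupling runs from 3t down to 2t: one t is spent along a path of unit length, and at
    coupling 2t the gap bounds twice the current deviation while it contains the accumulated ones
    only once, so the recursion closes. The bound 1/64 on 3t comes from the decoupled side, where a
    second-order term 64 lam^2 z^2 of the tilted site average has to be absorbed by lam z^2; this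
    gives the threshold 1/192. Limits are taken in the order K, n, M, where 1/M is the mesh of the
    grid: the constant in front of r may grow with n, and the grid costs only the logarithm of its
    size. *)

Section ExpBounds.
Context {R : realType}.
Implicit Types (f df : R -> R) (u x C : R).

Lemma expR_normr_ge1 x : 1 <= expR `|x|.
Proof. by rewrite -expR0 ler_expR. Qed.

Lemma le_expR_normr x : expR x <= expR `|x|.
Proof. by rewrite ler_expR ler_norm. Qed.

(** The mean value theorem gains one power of |x|. The factor 1/(k+1) of an exact integration is
    given up, so that the three Taylor bounds below come out in the same form. *)
Lemma taylor_step f df (k : nat) :
  (forall x, is_derive x 1 f (df x)) -> f 0 = 0 ->
  (forall x, `|df x| <= `|x| ^+ k * expR `|x|) ->
  forall x, `|f x| <= `|x| ^+ k.+1 * expR `|x|.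
Proof.
move=> fd f0 dfb x.
have cf (a b : R) : {within `[a, b], continuous f}.
  by apply: derivable_within_continuous => z _; have [] := fd z.
have mono c : `|c| <= `|x| -> `|c| ^+ k * expR `|c| <= `|x| ^+ k * expR `|x|.
  by move=> cx; rewrite ler_pM ?expR_ge0 ?exprn_ge0 ?ler_expR// lerXn2r ?nnegrE.
have [x0|x0] := leP 0 x.
  have [c cI] := MVT_segment x0 (fun z _ => fd z) (cf _ _).
  rewrite f0 !subr0 => ->; rewrite normrM exprSr mulrAC ler_wpM2r//.
  apply: (le_trans (dfb c)); apply: mono.
  by move: cI; rewrite in_itv/= => /andP[? ?]; rewrite !ger0_norm.
have [c cI] := MVT_segment (ltW x0) (fun z _ => fd z) (cf _ _).
rewrite f0 !sub0r => /(congr1 Num.norm); rewrite normrN normrM normrN => ->.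
rewrite exprSr mulrAC ler_wpM2r//.
apply: (le_trans (dfb c)); apply: mono.
move: cI; rewrite in_itv/= => /andP[? ?].
by rewrite !ler0_norm ?lerN2// ltW.
Qed.

Lemma expR_taylor1 x : `|expR x - 1| <= `|x| * expR `|x|.
Proof.
rewrite -[leRHS]/(`|x| ^+ 1 * expR `|x|).
refine (@taylor_step (fun x => expR x - 1) expR 0 _ _ _ x).
- move=> y; have : is_derive y 1 (expR - cst 1) (expR y - 0) by apply: is_deriveB.
  by rewrite subr0.
- by rewrite expR0 subrr.
- by move=> y; rewrite expr0 mul1r ger0_norm ?expR_ge0 ?le_expR_normr.
Qed.

Lemma expR_taylor2 x : `|expR x - 1 - x| <= `|x| ^+ 2 * expR `|x|.
Proof.
refine (@taylor_step (fun x => expR x - 1 - x) (fun x => expR x - 1) 1 _ _ _ x).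
- move=> y.
  have : is_derive y 1 (expR - cst 1 - id) (expR y - 0 - 1) by apply: is_deriveB.
  by rewrite subr0.
- by rewrite expR0 subrr subrr.
- by move=> y; rewrite expr1 expR_taylor1.
Qed.

Lemma expR_taylor3 x : `|expR x - 1 - x - x ^+ 2 / 2| <= `|x| ^+ 3 * expR `|x|.
Proof.
refine (@taylor_step (fun x => expR x - 1 - x - x ^+ 2 / 2)
  (fun x => expR x - 1 - x) 2 _ _ _ x).
- move=> y.
  have d : is_derive y 1 (expR - cst 1 - id - 2^-1 *: ((id : R -> R) ^+ 2))
      (expR y - 0 - 1 - 2^-1 *: (2 * y ^+ 1 *: 1)) by apply: is_deriveB.
  have -> : (fun x => expR x - 1 - x - x ^+ 2 / 2) =
      expR - cst 1 - id - 2^-1 *: ((id : R -> R) ^+ 2).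
    by apply/funext => z; rewrite !fctE/= /GRing.scale/= mulrC.
  by apply: is_derive_eq; rewrite /GRing.scale/= expr1 mulr1; field.
- by rewrite expR0 subrr subrr expr0n/= mul0r subrr.
- by move=> y; rewrite expR_taylor2.
Qed.

Lemma expR1_le4 : expR 1 <= 4 :> R.
Proof.
(* From exp(-1/2) >= 1/2 follows exp(1/2) <= 2, which is then squared. *)
have : 2^-1 <= expR (- 2^-1) :> R by apply: le_trans (expR_ge1Dx _); lra.
rewrite expRN lef_pV2 ?posrE ?expR_gt0// => h.
have -> : 1 = 2^-1 + 2^-1 :> R by lra.
rewrite expRD; have := expR_ge0 (2^-1 : R); nra.
Qed.

Lemma expR_taylor3_small x : `|x| <= 1 ->
  `|expR x - 1 - x - x ^+ 2 / 2| <= 4 * `|x| ^+ 3.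
Proof.
move=> x1; apply: le_trans (expR_taylor3 x) _; rewrite mulrC ler_wpM2r ?exprn_ge0//.
by apply: le_trans expR1_le4; rewrite ler_expR.
Qed.

Lemma ln_near1 x : `|x| <= 2^-1 -> `|ln (1 + x)| <= 2 * `|x|.
Proof.
move=> x1; have x0 : 0 < 1 + x by move: x1; rewrite ler_norml; lra.
have y0 := normr_ge0 x.
rewrite ler_norml; apply/andP; split; last first.
  have : ln (1 + x) <= x by rewrite -ler_expR lnK ?posrE// expR_ge1Dx.
  by have := ler_norm x; lra.
rewrite -ler_expR lnK ?posrE// expRN.
have yx : 1 - `|x| <= 1 + x by have := ler_norm (- x); rewrite normrN; lra.
have p0 : 0 < 1 - `|x| by lra.
apply: le_trans yx; rewrite -[leRHS]invrK lef_pV2 ?posrE ?expR_gt0 ?invr_gt0//.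
apply: le_trans (expR_ge1Dx _); rewrite -div1r ler_pdivrMr//.
nra.
Qed.

End ExpBounds.

Section Mean.
Context {R : realType} {W : Type}.
Implicit Types (N : set (W -> R)) (m : (W -> R) -> R) (f g G X : W -> R).

(** Boundedness together with closure under [expR] keeps all exponential moments and Gibbs ratios
    under control, so the expansions carry no integrability conditions. *)
Record fun_algebra N : Prop := FunAlgebra {
  fun_cst : forall c, N (cst c);
  fun_add : forall f g, N f -> N g -> N (f + g);
  fun_mul : forall f g, N f -> N g -> N (f * g);
  fun_exp : forall f, N f -> N (expR \o f);
  fun_bnd : forall f, N f -> exists M, forall w, `|f w| <= M }.

(** The interface is shared by expectations, Gibbs averages of one and two replicas, discretized
    couplings, random walks and Gaussian averages; over a [fun_algebra] it is enough for the
    cumulant expansion. *)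
Record is_mean N m : Prop := IsMean {
  mean_lin : forall a f g, N f -> N g -> m (a *: f + g) = a * m f + m g;
  mean_le : forall f g, N f -> N g -> (forall w, f w <= g w) -> m f <= m g;
  mean_cst1 : m (cst 1) = 1 }.

Section Algebra.
Context (N : set (W -> R)) (A : fun_algebra N).

Lemma fun_scale c f : N f -> N (c *: f).
Proof. by move=> Nf; exact: (fun_mul A (fun_cst A c) Nf). Qed.

Lemma fun_opp f : N f -> N (- f).
Proof. by rewrite -scaleN1r; exact: fun_scale. Qed.

Lemma fun_sub f g : N f -> N g -> N (f - g).
Proof. by move=> Nf Ng; apply: fun_add => //; exact: fun_opp. Qed.

Lemma fun_sqr f : N f -> N (f ^+ 2).
Proof. by move=> Nf; rewrite expr2; exact: fun_mul. Qed.

Lemma fun_sum I (s : seq I) (F : I -> W -> R) :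
  (forall i, N (F i)) -> N (\sum_(i <- s) F i).
Proof.
move=> NF; elim/big_ind: _ => //; first exact: (fun_cst A 0).
by move=> x y Nx Ny; exact: fun_add.
Qed.

End Algebra.
End Mean.

Ltac nice A := first [assumption | lazymatch goal with
  | |- _ (cst _) => exact (fun_cst A _)
  | |- _ (_ + _)%R => apply (fun_add A); nice A
  | |- _ (_ - _)%R => apply (fun_sub A); nice A
  | |- _ (- _)%R => apply (fun_opp A); nice A
  | |- _ (_ *: _)%R => apply (fun_scale A); nice A
  | |- _ (_ * _)%R => apply (fun_mul A); nice A
  | |- _ (_ ^+ 2)%R => apply (fun_sqr A); nice A
  | |- _ (expR \o _)%R => apply (fun_exp A); nice A
  | |- _ (\sum_(_ <- _) _)%R => apply (fun_sum A); intros ?; nice A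
  | |- _ => try solve [match goal with H : _ |- _ => apply H end]
  end].

Section MeanTheory.
Context {R : realType} {W : Type}.
Implicit Types (f g G X : W -> R).

Section Mean.
Context (N : set (W -> R)) (A : fun_algebra N).
Context (m : (W -> R) -> R) (mm : is_mean N m).

Lemma mean_cst c : m (cst c) = c.
Proof.
(* The constant c is written (c - 1) * 1 + 1, so that one instance of [mean_lin] gives its mean. *)
have := mean_lin mm (c - 1) (fun_cst A 1) (fun_cst A 1).
rewrite (mean_cst1 mm) mulr1 subrK => E; rewrite -[RHS]E; congr m.
by apply/funext => w; rewrite !fctE/= /GRing.scale/= mulr1 subrK.
Qed.

Lemma meanD f g : N f -> N g -> m (f + g) = m f + m g.
Proof. by move=> Nf Ng; rewrite -[f]scale1r (mean_lin mm)// scale1r mul1r. Qed.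

Lemma meanZ c f : N f -> m (c *: f) = c * m f.
Proof.
move=> Nf; rewrite -[c *: f]addr0 (mean_lin mm)//; last exact: (fun_cst A 0).
by rewrite [m 0](mean_cst 0) addr0.
Qed.

Lemma meanN f : N f -> m (- f) = - m f.
Proof. by move=> Nf; rewrite -scaleN1r meanZ// mulN1r. Qed.

Lemma meanB f g : N f -> N g -> m (f - g) = m f - m g.
Proof. by move=> Nf Ng; rewrite meanD ?meanN//; exact: (fun_opp A). Qed.

Lemma mean_sum I (s : seq I) (F : I -> W -> R) : (forall i, N (F i)) ->
  m (\sum_(i <- s) F i) = \sum_(i <- s) m (F i).
Proof.
move=> NF; elim: s => [|i s IH]; first by rewrite !big_nil [m 0](mean_cst 0).
by rewrite !big_cons meanD ?IH//; exact: (fun_sum A).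
Qed.

Lemma mean_ge c f : N f -> (forall w, c <= f w) -> c <= m f.
Proof. by move=> Nf h; rewrite -(mean_cst c) (mean_le mm)//; exact: fun_cst. Qed.

Lemma mean_ub c f : N f -> (forall w, f w <= c) -> m f <= c.
Proof. by move=> Nf h; rewrite -(mean_cst c) (mean_le mm)//; exact: fun_cst. Qed.

Lemma mean_norm_le c f : N f -> (forall w, `|f w| <= c) -> `|m f| <= c.
Proof.
move=> Nf h; rewrite ler_norml mean_ge ?mean_ub// => w; have := h w;
  by rewrite ler_norml => /andP[].
Qed.

Lemma mean_expR_gt0 G : N G -> 0 < m (expR \o G).
Proof.
move=> NG; have [M hM] := fun_bnd A NG.
apply: (@lt_le_trans _ _ (expR (- M))); first exact: expR_gt0.
apply: mean_ge; first exact: fun_exp.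
by move=> w; rewrite /= ler_expR; have := hM w; rewrite ler_norml => /andP[].
Qed.

Lemma mean_expRD c G : N G -> m (expR \o (G + cst c)) = expR c * m (expR \o G).
Proof.
move=> NG; rewrite -meanZ; last exact: fun_exp.
by congr m; apply/funext => w; rewrite /= expRD mulrC.
Qed.

Lemma ln_mean_expR_norm_le G (c : R) : N G -> (forall w, `|G w| <= c) ->
  `|ln (m (expR \o G))| <= c.
Proof.
move=> NG h; have p := mean_expR_gt0 NG.
have NE := fun_exp A NG.
rewrite ler_norml; apply/andP; split; rewrite -ler_expR lnK ?posrE//;
  [apply: mean_ge|apply: mean_ub] => // w;
  by have := h w; rewrite ler_norml /= ler_expR => /andP[].
Qed.

(** This is 1 + x <= exp x, averaged at G minus its mean. *)
Lemma jensen_ln_mean_expR G : N G -> m G <= ln (m (expR \o G)).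
Proof.
move=> NG; have Nc := fun_cst A; have p := mean_expR_gt0 NG.
pose H := G + cst (- m G); have NH : N H by apply: (fun_add A).
have N1H : N (cst 1 + H) by apply: (fun_add A).
have h1 : 1 <= m (expR \o H).
  have <- : m (cst 1 + H) = 1 by rewrite /H !meanD ?mean_cst// subrr addr0.
  apply: (mean_le mm) => //; first exact: fun_exp.
  by move=> w; exact: expR_ge1Dx.
rewrite -ler_expR lnK ?posrE//.
move: h1; rewrite mean_expRD// expRN mulrC ler_pdivlMr ?expR_gt0// mul1r.
exact.
Qed.

Definition cumulant2 f := m f + (m (f ^+ 2) - m f ^+ 2) / 2.

(** The whole expected answer a = mean + v/2, with v the variance, is subtracted from f, not just
    the mean. The second-order Taylor polynomial of exp(f - a) then averages to 1 + v^2/8, so the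
    remaining logarithm is of order eta^3. *)
Lemma ln_mean_expR_small f (eta : R) : N f -> (forall w, `|f w| <= eta) ->
  eta <= 8^-1 -> `|ln (m (expR \o f)) - cumulant2 f| <= 200 * eta ^+ 3.
Proof.
move=> Nf hf e8; rewrite /cumulant2.
set mu := m f; set s := m (f ^+ 2).
have Nf2 := fun_sqr A Nf.
have hmu : `|mu| <= eta by exact: mean_norm_le.
have e0 : 0 <= eta by exact: (le_trans (normr_ge0 _) hmu).
have hf2 w : 0 <= (f ^+ 2) w <= eta ^+ 2.
  rewrite fctE sqr_ge0/= -real_normK ?num_real//.
  by rewrite lerXn2r ?nnegrE.
have hs : 0 <= s <= eta ^+ 2.
  by rewrite mean_ge ?mean_ub// => w; have /andP[] := hf2 w.
have hmu2 : 0 <= mu ^+ 2 <= eta ^+ 2.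
  by rewrite sqr_ge0/= -real_normK ?num_real// lerXn2r ?nnegrE.
pose v := s - mu ^+ 2; pose a := mu + v / 2.
have hv : `|v| <= eta ^+ 2 by rewrite ler_norml /v; lra.
have e2 : eta ^+ 2 <= eta / 8 by rewrite expr2 ler_wpM2l.
have ha : `|a| <= eta * (5 / 4).
  by move: hmu hv; rewrite /a !ler_norml; lra.
pose U := f + cst (- a).
have NU : N U by apply: fun_add => //; exact: fun_cst.
have hU w : `|U w| <= eta * (9 / 4).
  by move: ha (hf w); rewrite /U fctE/= !ler_norml; lra.
have eU : m (expR \o f) = expR a * m (expR \o U).
  rewrite -mean_expRD//; congr m; congr comp.
  by apply/funext => w; rewrite /U !fctE/= subrK.
have mU : m U = - (v / 2).
  by rewrite meanD//; [rewrite mean_cst -/mu /a; ring | exact: fun_cst].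
have mU2 : m (U ^+ 2) = v + v ^+ 2 / 4.
  have -> : U ^+ 2 = f ^+ 2 + (- 2 * a) *: f + cst (a ^+ 2).
    by apply/funext => w; rewrite /U !fctE/= /GRing.scale/=; ring.
  rewrite !meanD; [|nice A|nice A|nice A|nice A].
  rewrite meanZ; [|nice A].
  rewrite mean_cst.
  by rewrite -/s -/mu /a /v; field.
have NU2 := fun_sqr A NU.
clearbody U.
have : `|m (expR \o U - (cst 1 + U + 2^-1 *: U ^+ 2))| <= 4 * (eta * (9 / 4)) ^+ 3.
  apply: mean_norm_le => [|w].
    nice A.
  have hw := hU w.
  have -> : (expR \o U - (cst 1 + U + 2^-1 *: U ^+ 2)) w =
      expR (U w) - 1 - U w - (U w) ^+ 2 / 2.
    by rewrite !fctE/= /GRing.scale/=; ring.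
  apply: le_trans (expR_taylor3_small _) _; first by apply: le_trans hw _; lra.
  by rewrite ler_wpM2l// lerXn2r ?nnegrE ?mulr_ge0.
rewrite meanB; [|nice A|nice A].
rewrite !meanD; [|nice A|nice A|nice A|nice A].
rewrite meanZ; [|nice A].
rewrite mean_cst mU mU2.
set E := m (expR \o U) => hE.
have v2 : v ^+ 2 <= eta ^+ 3.
  rewrite -real_normK ?num_real//; apply: (@le_trans _ _ ((eta ^+ 2) ^+ 2)).
    by rewrite lerXn2r ?nnegrE ?exprn_ge0.
  rewrite -exprM (exprS _ 3) -[leRHS]mul1r ler_wpM2r ?exprn_ge0//; lra.
have e3 : eta ^+ 3 <= 512^-1.
  have -> : 512^-1 = (8^-1 : R) ^+ 3 by field.
  by rewrite lerXn2r ?nnegrE//; lra.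
have e30 : 0 <= eta ^+ 3 by exact: exprn_ge0.
have v20 := sqr_ge0 v.
have hE1 : `|E - 1| <= 50 * eta ^+ 3.
  move: hE; rewrite !ler_norml exprMn.
  have -> : (9 / 4) ^+ 3 = 729 / 64 :> R by field.
  lra.
rewrite eU lnM ?posrE ?expR_gt0//; last exact: mean_expR_gt0.
rewrite expRK -/v -/a -/E addrAC subrr add0r.
have -> : E = 1 + (E - 1) by ring.
apply: le_trans (ln_near1 _) _; first by apply: le_trans hE1 _; lra.
lra.
Qed.

(** For eta > 1/8 every term is at most a multiple of eta or eta^2, hence of eta^3; the constant 200
    covers both regimes. *)
Lemma ln_mean_expR_cumulant f (eta : R) : N f -> (forall w, `|f w| <= eta) ->
  `|ln (m (expR \o f)) - cumulant2 f| <= 200 * eta ^+ 3.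
Proof.
move=> Nf hf; have [e8|e8] := leP eta 8^-1; first exact: ln_mean_expR_small.
have Nf2 := fun_sqr A Nf.
have hmu : `|m f| <= eta by exact: mean_norm_le.
have hl := ln_mean_expR_norm_le Nf hf.
have e0 : 0 <= eta by exact: (le_trans (normr_ge0 _) hmu).
have hf2 w : 0 <= (f ^+ 2) w <= eta ^+ 2.
  by rewrite fctE sqr_ge0/= -real_normK ?num_real// lerXn2r ?nnegrE.
have hs : 0 <= m (f ^+ 2) <= eta ^+ 2.
  by rewrite mean_ge ?mean_ub// => w; have /andP[] := hf2 w.
have hmu2 : 0 <= m f ^+ 2 <= eta ^+ 2.
  by rewrite sqr_ge0/= -real_normK ?num_real// lerXn2r ?nnegrE.
have e1 : eta <= 64 * eta ^+ 3 by rewrite !exprS expr0; nra.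
have e2 : eta ^+ 2 <= 8 * eta ^+ 3 by rewrite !exprS expr0; nra.
have e30 : 0 <= eta ^+ 3 by exact: exprn_ge0.
by move: hmu hl; rewrite /cumulant2 !ler_norml; lra.
Qed.

Definition gibbs G f := m (f * (expR \o G)) / m (expR \o G).

Lemma gibbs_is_mean G : N G -> is_mean N (gibbs G).
Proof.
move=> NG; have NE := fun_exp A NG; have p := mean_expR_gt0 NG.
split=> [a f g Nf Ng|f g Nf Ng fg|].
- rewrite /gibbs mulrA -mulrDl; congr (_ / _).
  rewrite -meanZ; [|nice A].
  rewrite -meanD; [|nice A|nice A].
  by congr m; apply/funext => w; rewrite !fctE/= /GRing.scale/= mulrDl mulrA.
- rewrite /gibbs ler_pM2r ?invr_gt0//; apply: (mean_le mm); try exact: fun_mul.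
  by move=> w; rewrite !fctE/= ler_wpM2r ?expR_ge0.
- rewrite /gibbs (_ : _ * _ = expR \o G) ?divff ?gt_eqF//.
  by apply/funext => w; rewrite !fctE/= mul1r.
Qed.

Definition free_energy G := ln (m (expR \o G)).

(** Adding f to the potential tilts the Gibbs measure, so an increment of the free energy is a
    logarithmic exponential moment under [gibbs m G], and the estimates above apply to it. *)
Lemma free_energyD G f : N G -> N f ->
  free_energy (G + f) - free_energy G = ln (gibbs G (expR \o f)).
Proof.
move=> NG Nf; have NE := fun_exp A NG; have p := mean_expR_gt0 NG.
rewrite /free_energy /gibbs -ln_div ?posrE//.
- by congr (ln (m _ / _)); apply/funext => w; rewrite !fctE/= expRD mulrC.
- by apply: mean_expR_gt0; exact: fun_add.
Qed.

End Mean.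

Section FreeEnergy.
Context (N : set (W -> R)) (A : fun_algebra N).
Context (m : (W -> R) -> R) (mm : is_mean N m).

Lemma free_energy_lip G f (c : R) : N G -> N f -> (forall w, `|f w| <= c) ->
  `|free_energy m (G + f) - free_energy m G| <= c.
Proof.
move=> NG Nf hf; rewrite (free_energyD A mm)//.
exact: (ln_mean_expR_norm_le A (gibbs_is_mean A mm NG)).
Qed.

Lemma free_energy_expansion G f (eta : R) : N G -> N f -> (forall w, `|f w| <= eta) ->
  `|free_energy m (G + f) - free_energy m G - cumulant2 (gibbs m G) f|
    <= 200 * eta ^+ 3.
Proof.
move=> NG Nf hf; rewrite (free_energyD A mm)//.
exact: (ln_mean_expR_cumulant A (gibbs_is_mean A mm NG)).
Qed.

End FreeEnergy.
End MeanTheory.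

(** * Averaging operators on functionals of the potential *)

Section Operators.
Context {R : realType} {W : Type}.
Implicit Types (Phi Psi : (W -> R) -> R) (G X V : W -> R).
Notation operator := (((W -> R) -> R) -> (W -> R) -> R).
Implicit Types Q : operator.

(** The expectation over a random sign in front of X. Only the argument G of the functional
    moves. *)
Definition avg X : operator := fun Phi G => (Phi (G + X) + Phi (G - X)) / 2.

Definition shift V : operator := fun Phi G => Phi (G + V).

Definition avgs I (s : seq I) (F : I -> W -> R) : operator :=
  foldr (fun i Q => avg (F i) \o Q) id s.

(* One step of a Gaussian-like field: a random sign in front of every feature [F i],
   and a deterministic drift [V]. *)
Definition block I (s : seq I) (F : I -> W -> R) V : operator :=
  shift V \o avgs s F.

Definition commuting Q1 Q2 := forall Phi, Q1 (Q2 Phi) = Q2 (Q1 Phi).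

Lemma commuting_avg X X' : commuting (avg X) (avg X').
Proof.
move=> Phi; apply/funext => G; rewrite /avg.
have e Y Y' : G + Y + Y' = G + Y' + Y by exact: addrAC.
by rewrite !(e _ X) !(e _ (- X)); ring.
Qed.

Lemma commuting_avg_shift X V : commuting (avg X) (shift V).
Proof.
move=> Phi; apply/funext => G; rewrite /avg /shift.
by rewrite (addrAC G X V) (addrAC G (- X) V).
Qed.

Lemma commuting_shift V V' : commuting (shift V) (shift V').
Proof. by move=> Phi; apply/funext => G; rewrite /shift addrAC. Qed.

Lemma commuting_sym Q1 Q2 : commuting Q1 Q2 -> commuting Q2 Q1.
Proof. by move=> h Phi; rewrite h. Qed.

Lemma commuting_comp Q Q1 Q2 :
  commuting Q Q1 -> commuting Q Q2 -> commuting Q (Q1 \o Q2).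
Proof. by move=> h1 h2 Phi /=; rewrite h1 h2. Qed.

Lemma commuting_iter Q Q' k : commuting Q Q' -> commuting Q (iter k Q').
Proof. by move=> h Phi; elim: k => [|k IH] //=; rewrite h IH. Qed.

Lemma commuting_foldr I (s : seq I) Q (F : I -> operator) :
  (forall i, commuting Q (F i)) ->
  commuting Q (foldr (fun i Q' => F i \o Q') id s).
Proof. by move=> h; elim: s => [|i s IH] //=; exact: commuting_comp. Qed.

(** Both building blocks act by translating the potential, and translations commute. *)
Lemma commuting_block I J (s : seq I) (s' : seq J) F F' V V' :
  commuting (block s F V) (block s' F' V').
Proof.
have avgsC (X : W -> R) : commuting (avg X) (avgs s' F').
  by apply: commuting_foldr => i; exact: commuting_avg.
have avgsS K (r : seq K) (H : K -> W -> R) U : commuting (shift U) (avgs r H).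
  apply: commuting_foldr => i; apply: commuting_sym.
  exact: commuting_avg_shift.
apply: commuting_comp; apply: commuting_sym; apply: commuting_comp.
- exact: commuting_shift.
- exact: avgsS.
- exact/commuting_sym/avgsS.
- apply: commuting_sym; apply: commuting_sym.
  by apply: commuting_foldr => i; apply: commuting_sym; exact: avgsC.
Qed.

Lemma iter_comp Q1 Q2 k : commuting Q1 Q2 ->
  iter k (Q1 \o Q2) = iter k Q1 \o iter k Q2.
Proof.
move=> h; apply/funext => Phi; elim: k => [|k IH] //=.
by rewrite IH/= (commuting_iter k (commuting_sym h)).
Qed.

Section Markov.
Context (N : set (W -> R)) (A : fun_algebra N).

(** Monotonicity is tested only on potentials in [N], where the single-step estimates hold;
    linearity is an identity at every G. *)
Record markov Q : Prop := Markov {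
  markov_lin : forall a Phi Psi G,
    Q (fun G => a * Phi G + Psi G) G = a * Q Phi G + Q Psi G;
  markov_le : forall Phi Psi, (forall G, N G -> Phi G <= Psi G) ->
    forall G, N G -> Q Phi G <= Q Psi G;
  markov_cst : forall c G, Q (fun=> c) G = c }.

Lemma markov_avg X : N X -> markov (avg X).
Proof.
move=> NX; split=> [a Phi Psi G|Phi Psi h G NG|c G]; rewrite /avg.
- by field.
- by rewrite ler_pM2r ?invr_gt0// lerD ?h//; nice A.
- by field.
Qed.

Lemma markov_shift V : N V -> markov (shift V).
Proof.
by move=> NV; split=> [//|Phi Psi h G NG|//]; apply: h; nice A.
Qed.

Lemma markov_id : markov id.
Proof. by split=> // Phi Psi h G /h. Qed.

Lemma markov_comp Q1 Q2 : markov Q1 -> markov Q2 -> markov (Q1 \o Q2).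
Proof.
move=> [l1 h1 c1] [l2 h2 c2]; split=> [a Phi Psi G|Phi Psi h|c G] /=.
- by rewrite -l1; congr Q1; apply/funext => H; exact: l2.
- by apply: h1; exact: h2.
- by rewrite -[RHS](c1 c G); congr Q1; apply/funext => H; exact: c2.
Qed.

Lemma markov_iter k Q : markov Q -> markov (iter k Q).
Proof.
move=> mQ; elim: k => [|k IH]; first exact: markov_id.
exact: markov_comp.
Qed.

Lemma markov_block I (s : seq I) F V : (forall i, N (F i)) -> N V ->
  markov (block s F V).
Proof.
move=> NF NV; apply: markov_comp; first exact: markov_shift.
elim: s => [|i s IH]; first exact: markov_id.
by apply: markov_comp => //; exact: markov_avg.
Qed.

Lemma markovD Q Phi Psi G : markov Q ->
  Q (fun G => Phi G + Psi G) G = Q Phi G + Q Psi G.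
Proof.
move=> mQ; have := markov_lin mQ 1 Phi Psi G; rewrite mul1r => <-.
by congr Q; apply/funext => H; rewrite mul1r.
Qed.

Lemma markovZ Q a Phi G : markov Q -> Q (fun G => a * Phi G) G = a * Q Phi G.
Proof.
move=> mQ; have := markov_lin mQ a Phi (fun=> 0) G; rewrite (markov_cst mQ) addr0 => <-.
by congr Q; apply/funext => H; rewrite addr0.
Qed.

Lemma markovB Q Phi Psi G : markov Q ->
  Q (fun G => Phi G - Psi G) G = Q Phi G - Q Psi G.
Proof.
move=> mQ; rewrite (markovD Phi (fun H => - Psi H)) //.
rewrite -[in RHS]mulN1r -(markovZ (-1) Psi G mQ); congr (_ + Q _ _).
by apply/funext => H; rewrite mulN1r.
Qed.

Lemma markov_le_cst Q Phi c : markov Q -> (forall G, N G -> Phi G <= c) ->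
  forall G, N G -> Q Phi G <= c.
Proof.
by move=> mQ h G NG; rewrite -[leRHS](markov_cst mQ c G) (markov_le mQ).
Qed.

Lemma markov_ge_cst Q Phi c : markov Q -> (forall G, N G -> c <= Phi G) ->
  forall G, N G -> c <= Q Phi G.
Proof.
by move=> mQ h G NG; rewrite -[leLHS](markov_cst mQ c G) (markov_le mQ).
Qed.

Lemma markov_near Q Phi Psi e : markov Q ->
  (forall G, N G -> `|Phi G - Psi G| <= e) ->
  forall G, N G -> `|Q Phi G - Q Psi G| <= e.
Proof.
move=> mQ h G NG; rewrite -markovB//.
rewrite ler_norml; apply/andP; split;
  [apply: (markov_ge_cst mQ)|apply: (markov_le_cst mQ)] => // H /h;
  by rewrite ler_norml => /andP[].
Qed.

End Markov.

Section BlockExpansion.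
Context (N : set (W -> R)) (A : fun_algebra N).
Context (mu : (W -> R) -> R) (mmu : is_mean N mu).

(** The cross term of V and X is odd in the sign, so the average adds only half the variance of
    X. *)
Lemma cumulant2_parallelogram V X : N V -> N X ->
  (cumulant2 mu (V + X) + cumulant2 mu (V - X)) / 2 =
  cumulant2 mu V + (mu (X ^+ 2) - mu X ^+ 2) / 2.
Proof.
move=> NV NX; rewrite /cumulant2.
have -> : (V + X) ^+ 2 = V ^+ 2 + 2 *: (V * X) + X ^+ 2.
  by apply/funext => w; rewrite !fctE/= /GRing.scale/=; ring.
have -> : (V - X) ^+ 2 = V ^+ 2 + (-2) *: (V * X) + X ^+ 2.
  by apply/funext => w; rewrite !fctE/= /GRing.scale/=; ring.
rewrite !(meanB A mmu); [|nice A|nice A].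
rewrite !(meanD mmu); try (by nice A).
by rewrite !(meanZ A mmu); [field|nice A|nice A].
Qed.

Lemma cumulant2_drift V (k : R) : N V -> (forall w, `|V w| <= k) ->
  `|cumulant2 mu V - mu V| <= k ^+ 2.
Proof.
move=> NV hV; have NV2 := fun_sqr A NV.
have h1 : `|mu V| <= k by exact: (mean_norm_le A mmu).
have k0 : 0 <= k by exact: (le_trans (normr_ge0 _) h1).
have hf2 w : 0 <= (V ^+ 2) w <= k ^+ 2.
  by rewrite fctE sqr_ge0/= -real_normK ?num_real// lerXn2r ?nnegrE.
have h2 : 0 <= mu (V ^+ 2) <= k ^+ 2.
  by rewrite (mean_ge A mmu) ?(mean_ub A mmu)// => w; have /andP[] := hf2 w.
have h3 : 0 <= mu V ^+ 2 <= k ^+ 2.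
  by rewrite sqr_ge0/= -real_normK ?num_real// lerXn2r ?nnegrE.
by rewrite /cumulant2 addrAC subrr add0r ler_norml; lra.
Qed.

(** The expansion is made once, at the leaves of the sign tree and always about the same centre G.
    The signs then act on the exact quadratic [cumulant2], and averaging keeps e, so the error does
    not grow with the number of features. The increment V and its bound c are generalized because
    they accumulate along a branch. *)
Lemma avgs_expansion I (s : seq I) (F : I -> W -> R) (b : R) Phi G (l eta e : R) :
  (forall i, N (F i)) -> (forall i w, `|F i w| <= b) ->
  (forall V, N V -> (forall w, `|V w| <= eta) ->
     `|Phi (G + V) - l - cumulant2 mu V| <= e) ->
  forall V (c : R), N V -> (forall w, `|V w| <= c) -> c + b * (size s)%:R <= eta ->
  `|avgs s F Phi (G + V) - l -
    (cumulant2 mu V + (\sum_(i <- s) (mu (F i ^+ 2) - mu (F i) ^+ 2)) / 2)| <= e.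
Proof.
move=> NF hF hPhi; elim: s => [|i s IH] V c NV hV.
  rewrite mulr0 addr0 => ce; rewrite big_nil mul0r addr0; apply: hPhi => // w.
  exact: le_trans (hV w) ce.
rewrite [size _]/= -natr1 mulrDr mulr1 addrCA addrC => ce.
have NP : N (V + F i) by nice A.
have NM : N (V - F i) by nice A.
have hP w : `|(V + F i) w| <= c + b.
  by rewrite fctE; apply: le_trans (ler_normD _ _) _; rewrite lerD.
have hM w : `|(V - F i) w| <= c + b.
  by rewrite !fctE; apply: le_trans (ler_normB _ _) _; rewrite lerD.
have ce' : c + b + b * (size s)%:R <= eta by move: ce; lra.
have := IH _ _ NM hM ce'; have := IH _ _ NP hP ce'.
have := cumulant2_parallelogram NV (NF i).
have eP : G + V + F i = G + (V + F i) by rewrite addrA.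
have eM : G + V - F i = G + (V - F i) by rewrite addrA.
rewrite big_cons /= {1}/avg eP eM.
set x := avgs s F Phi _; set y := avgs s F Phi _.
by rewrite !ler_norml; lra.
Qed.

End BlockExpansion.

Definition block_cst (b k : R) (n : nat) := 200 * (k + b * n%:R) ^+ 3 + k ^+ 2.

Lemma block_cst_ge0 b k n : 0 <= b -> 0 <= k -> 0 <= block_cst b k n.
Proof.
move=> b0 k0; rewrite /block_cst addr_ge0 ?sqr_ge0//.
by apply: mulr_ge0 => //; apply: exprn_ge0; rewrite addr_ge0 ?mulr_ge0.
Qed.

(** Features scale by r and the drift by r^2, as for Brownian increments: both enter at order r^2,
    and 1/r^2 steps with errors of order r^3 leave a total error of order r. *)
Lemma free_energy_block (N : set (W -> R)) (A : fun_algebra N) m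
    (mm : is_mean N m) I (s : seq I) (F : I -> W -> R) V (b k r : R) G :
  (forall i, N (F i)) -> (forall i w, `|F i w| <= b) -> N V ->
  (forall w, `|V w| <= k) -> 0 <= b -> 0 <= k -> 0 <= r <= 1 -> N G ->
  `|block s (fun i => r *: F i) (r ^+ 2 *: V) (free_energy m) G - free_energy m G
    - r ^+ 2 * (gibbs m G V + (\sum_(i <- s)
        (gibbs m G (F i ^+ 2) - gibbs m G (F i) ^+ 2)) / 2)|
  <= r ^+ 3 * block_cst b k (size s).
Proof.
move=> NF hF NV hV b0 k0 /andP[r0 r1] NG; set mu := gibbs m G.
have mmu : is_mean N mu := gibbs_is_mean A mm NG.
have NrF i : N (r *: F i) by nice A.
have NrV : N (r ^+ 2 *: V) by nice A.
have hrF i w : `|(r *: F i) w| <= r * b.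
  by rewrite fctE normrM ger0_norm// ler_wpM2l.
have hrV w : `|(r ^+ 2 *: V) w| <= r ^+ 2 * k.
  by rewrite fctE normrM ger0_norm ?exprn_ge0// ler_wpM2l ?exprn_ge0.
have r2 : r ^+ 2 <= r by rewrite expr2 ler_piMl.
pose eta := r * (k + b * (size s)%:R).
have etaP : r ^+ 2 * k + (r * b) * (size s)%:R <= eta.
  by rewrite /eta mulrDr mulrA lerD2r ler_wpM2r.
have hPhi V' : N V' -> (forall w, `|V' w| <= eta) ->
   `|free_energy m (G + V') - free_energy m G - cumulant2 mu V'| <= 200 * eta ^+ 3.
  by move=> NV' hV'; exact: (free_energy_expansion A mm).
have := avgs_expansion A mmu NrF hrF hPhi NrV hrV etaP.
have := cumulant2_drift A mmu NrV hrV.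
have -> : mu (r ^+ 2 *: V) = r ^+ 2 * mu V by rewrite (meanZ A mmu).
have -> : \sum_(i <- s) (mu ((r *: F i) ^+ 2) - mu (r *: F i) ^+ 2) =
    r ^+ 2 * \sum_(i <- s) (mu (F i ^+ 2) - mu (F i) ^+ 2).
  rewrite mulr_sumr; apply: eq_bigr => i _; rewrite (meanZ A mmu)//.
  have -> : (r *: F i) ^+ 2 = r ^+ 2 *: F i ^+ 2.
    by apply/funext => w; rewrite !fctE/= /GRing.scale/= exprMn.
  by rewrite (meanZ A mmu) ?mulrBr ?exprMn//; nice A.
have e3 : 200 * eta ^+ 3 + (r ^+ 2 * k) ^+ 2 <= r ^+ 3 * block_cst b k (size s).
  rewrite /block_cst mulrDr /eta exprMn mulrCA lerD2l exprMn -exprM.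
  by rewrite ler_wpM2r ?exprn_ge0// (exprS _ 3) ler_piMl ?exprn_ge0.
rewrite /block /shift /= mulrDr [_ * (_ / 2)]mulrA.
set x := avgs _ _ _ _; rewrite !ler_norml.
lra.
Qed.

End Operators.

(** * Bounded random variables and pairs of replicas *)

Section BoundedMeasurable.
Context {R : realType} {d : measure_display} {T : measurableType d}.

Definition bounded_measurable : set (T -> R) :=
  [set f : T -> R | measurable_fun setT f /\ exists M : R, forall w, `|f w| <= M].

Lemma bounded_measurable_algebra : fun_algebra bounded_measurable.
Proof.
split.
- by move=> c; split; [exact: measurable_cst | exists `|c|].
- move=> f g [mf [M hM]] [mg [M' hM']]; split; first exact: measurable_funD.
  by exists (M + M') => w; rewrite fctE (le_trans (ler_normD _ _))// lerD.
- move=> f g [mf [M hM]] [mg [M' hM']]; split; first exact: measurable_funM.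
  by exists (M * M') => w; rewrite fctE normrM ler_pM.
- move=> f [mf [M hM]]; split; first exact: measurableT_comp.
  exists (expR M) => w; rewrite /= ger0_norm ?expR_ge0// ler_expR.
  exact: le_trans (ler_norm _) (hM w).
- by move=> f [].
Qed.

Context (P : probability T R).

Definition pmean (f : T -> R) : R := fine 'E_P[f].

Lemma pmeanE f : pmean f = \int[P]_w f w.
Proof. by rewrite /pmean unlock. Qed.

Lemma bounded_measurable_integrable f : bounded_measurable f ->
  P.-integrable setT (EFin \o f).
Proof.
move=> [mf [M hM]]; apply: measurable_bounded_integrable => //.
  by rewrite (le_lt_trans (probability_le1 P measurableT))// ltry.
by exists M; split; [exact: num_real | move=> x Mx w _; exact: le_trans (hM w) (ltW Mx)].
Qed.

Lemma pmean_is_mean : is_mean bounded_measurable pmean.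
Proof.
have A := bounded_measurable_algebra.
split=> [a f g Nf Ng|f g Nf Ng fg|].
- have Na : bounded_measurable (a *: f) by nice A.
  rewrite !pmeanE RintegralD//; try exact: bounded_measurable_integrable.
  by rewrite RintegralZl//; exact: bounded_measurable_integrable.
- by rewrite !pmeanE le_Rintegral//; exact: bounded_measurable_integrable.
- by rewrite /pmean expectation_cst.
Qed.

End BoundedMeasurable.

Section PairMean.
Context {R : realType} {d : measure_display} {T : measurableType d}.
Context (P : probability T R).
Implicit Types f : T * T -> R.

(** The product expectation is encoded as an iterated one, which makes factorization over the
    replicas immediate; what has to be checked is that the inner mean is measurable. *)
Definition pmean2 f : R := pmean P (fun w => pmean P (fun w' => f (w, w'))).

Lemma bounded_measurable_pair f w : bounded_measurable f ->
  bounded_measurable (fun w' => f (w, w')).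
Proof.
move=> [mf [M hM]]; split; last by exists M.
exact: measurable_fun_pair2.
Qed.

Lemma bounded_measurable_pmean f : bounded_measurable f ->
  bounded_measurable (fun w => pmean P (fun w' => f (w, w'))).
Proof.
have A := @bounded_measurable_algebra R _ T.
have mm := pmean_is_mean P.
move=> bf; have [mf [M hM]] := bf; split; last first.
  exists M => w; apply: (mean_norm_le A mm) => //.
  exact: bounded_measurable_pair.
(* Adding the bound M makes the integrand nonnegative, as Tonelli's theorem wants it. *)
have -> : (fun w => pmean P (fun w' => f (w, w'))) =
    (fun w => fine (\int[P]_w' ((f (w, w') + M)%:E))%E - M).
  apply/funext => w; rewrite -[fine _]/(\int[P]_w' (f (w, w') + M)).
  rewrite -pmeanE.
  have -> : (fun w' => f (w, w') + M) = (fun w' => f (w, w')) + cst M by [].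
  have bw := bounded_measurable_pair w bf.
  by rewrite (meanD mm)// ?(mean_cst A mm) ?addrK//; nice A.
apply: measurable_funB => //; apply: measurableT_comp => //.
apply: (@measurable_fun_fubini_tonelli_F _ _ _ _ _ P (fun z => (f z + M)%:E)) => //.
  by apply/measurable_EFinP; apply: measurable_funD.
by move=> z; rewrite lee_fin; have := hM z; rewrite ler_norml; lra.
Qed.

Lemma pmean2_is_mean : is_mean bounded_measurable pmean2.
Proof.
have A := @bounded_measurable_algebra R _ T.
have mm := pmean_is_mean P.
split=> [a f g Nf Ng|f g Nf Ng fg|].
- have ? := bounded_measurable_pmean Nf; have ? := bounded_measurable_pmean Ng.
  rewrite /pmean2 -(mean_lin mm)//; congr pmean; apply/funext => w.
  rewrite -[RHS]/(a * pmean P (fun w' => f (w, w')) + pmean P (fun w' => g (w, w'))).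
  by rewrite -(mean_lin mm)//; exact: bounded_measurable_pair.
- apply: (mean_le mm) => [||w]; try exact: bounded_measurable_pmean.
  by apply: (mean_le mm) => [||w']; try exact: bounded_measurable_pair.
- rewrite -[RHS](mean_cst1 mm); congr pmean; apply/funext => w.
  exact: (mean_cst1 mm).
Qed.

Lemma pmean2_prod (f g : T -> R) : bounded_measurable f -> bounded_measurable g ->
  pmean2 (fun z => f z.1 * g z.2) = pmean P f * pmean P g.
Proof.
have A := @bounded_measurable_algebra R _ T.
have mm := pmean_is_mean P.
move=> bf bg; rewrite /pmean2 mulrC -(meanZ A mm)//; congr pmean.
apply/funext => w /=.
have -> : (fun w' => f w * g w') = f w *: g by [].
by rewrite (meanZ A mm)// mulrC.
Qed.

End PairMean.

(** * Discrete interpolation *)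

Section Interpolation.
Context {R : realType} {W : Type} (N : set (W -> R)) (A : fun_algebra N).
(** In the application [Q1] is an SK step, [Q2] a decoupled step, [L] the free energy, [D] the Gibbs
    mean of the squared overlap deviation, [Lam l] the two-replica energy at coupling l, and v the
    number of sites. *)
Context (Q1 Q2 : ((W -> R) -> R) -> (W -> R) -> R).
Context (mk1 : markov N Q1) (mk2 : markov N Q2) (Q12 : commuting Q1 Q2).
Context (L D : (W -> R) -> R) (Lam : R -> (W -> R) -> R).
Context (t v q r e e' : R) (K : nat).
Hypothesis (t_ge0 : 0 <= t) (v_ge0 : 0 <= v) (e_ge0 : 0 <= e) (e'_ge0 : 0 <= e').
Hypothesis rK : K%:R * r ^+ 2 = 1.
Hypothesis D_ge0 : forall G, N G -> 0 <= D G.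
Hypothesis step1 : forall G, N G ->
  `|Q1 L G - Q2 L G - r ^+ 2 * (t * v) / 2 * (q ^+ 2 - D G)| <= e.
Hypothesis step2 : forall l G, N G ->
  Q1 (Lam (l - r ^+ 2 * t)) G <= Q2 (Lam l) G + r ^+ 2 * (t * v) * q ^+ 2 + e.
Hypothesis gap : forall l G, N G -> l * v * D G <= Lam l G - 2 * L G.
Hypothesis gap_lip : forall l G, N G ->
  Lam l G - 2 * L G <= Q2 (fun G => Lam l G - 2 * L G) G + e'.

(* The replica coupling is spent along the path: it decreases by [r ^+ 2 * t] per
   step from [3 * t] and stays above [2 * t], so that the deviations accumulated so far
   can be absorbed by strong induction. *)
Let lam m := 3 * t - m%:R * (r ^+ 2 * t).
(** The path is [stage m (K - m)], for m from 0 to K: m decoupled steps have been traded for SK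
    steps. *)
Let stage m k Phi := iter m Q1 (iter k Q2 Phi).

Let mk_stage m k : markov N (stage m k).
Proof. by apply: markov_comp; exact: markov_iter. Qed.

Let stage_Q2 m k Phi : stage m k (Q2 Phi) = stage m k.+1 Phi.
Proof. by rewrite /stage iterSr. Qed.

Let stage_Q1 m k Phi : stage m k (Q1 Phi) = stage m.+1 k Phi.
Proof.
rewrite /stage iterSr; congr (iter m Q1 _).
exact/esym/(commuting_iter k Q12).
Qed.

Let r2_ge0 : 0 <= r ^+ 2. Proof. exact: sqr_ge0. Qed.

Let mr2_le1 m : (m <= K)%N -> m%:R * r ^+ 2 <= 1.
Proof. by move=> mK; rewrite -[leRHS]rK ler_wpM2r// ler_nat. Qed.

Let lam_ge m : (m <= K)%N -> 2 * t <= lam m.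
Proof.
move=> mK; rewrite /lam mulrA; have := ler_wpM2r t_ge0 (mr2_le1 mK).
lra.
Qed.

(** The trade between stages m and m + 1 leaves K - 1 steps in common, so its deviation is averaged
    over m SK steps and K - m - 1 decoupled ones. *)
Let x G0 m := t * v * stage m (K - m.+1) D G0.

Let stage_ge0 m k G0 : N G0 -> 0 <= stage m k D G0.
Proof. exact: (markov_ge_cst (mk_stage m k)). Qed.

Let x_ge0 G0 m : N G0 -> 0 <= x G0 m.
Proof. by move=> NG; rewrite /x !mulr_ge0// stage_ge0. Qed.

Let subnSK' m : (m < K)%N -> (K - m = (K - m.+1).+1)%N.
Proof. by move=> mK; rewrite subnSK. Qed.

Let psi1_step m G0 : N G0 -> (m < K)%N ->
  `|stage m.+1 (K - m.+1) L G0 - stage m (K - m) L G0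
    - r ^+ 2 / 2 * (t * v * q ^+ 2 - x G0 m)| <= e.
Proof.
move=> NG mK; rewrite (subnSK' mK) -stage_Q2 -stage_Q1.
set k := (K - m.+1)%N; have mk := mk_stage m k.
have <- : stage m k (fun G => r ^+ 2 * (t * v) / 2 * (q ^+ 2 - D G)) G0 =
    r ^+ 2 / 2 * (t * v * q ^+ 2 - x G0 m).
  rewrite (markovZ _ _ _ mk) (markovB (fun=> q ^+ 2) D _ mk) (markov_cst mk).
  by rewrite /x -/k; field.
rewrite -!(markovB _ _ _ mk) ler_norml.
apply/andP; split;
  [apply: (markov_ge_cst mk)|apply: (markov_le_cst mk)] => // G /step1;
  by rewrite ler_norml => /andP[].
Qed.

Let psi1 m G0 : N G0 -> (m <= K)%N ->
  `|stage m (K - m) L G0 - stage 0 K L G0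
    - r ^+ 2 / 2 * (m%:R * (t * v * q ^+ 2) - \sum_(i < m) x G0 i)| <= m%:R * e.
Proof.
move=> NG; elim: m => [_|m IH mK].
  by rewrite subn0 big_ord0 !mul0r subrr subrr mulr0 subrr normr0.
have := psi1_step NG mK; have := IH (ltnW mK).
set y := stage m.+1 _ _ _; set z := stage m _ _ _; set u := stage 0 _ _ _.
rewrite big_ord_recr/= -natr1 !ler_norml.
move=> /andP[h1 h2] /andP[h3 h4]; apply/andP; split; lra.
Qed.

(** Each trade spends r^2 t of the coupling, and in return [step2] bounds the growth by a quantity
    free of deviations. *)
Let psi2 m G0 : N G0 -> (m <= K)%N ->
  stage m (K - m) (Lam (lam m)) G0 <= stage 0 K (Lam (3 * t)) G0
    + m%:R * (r ^+ 2 * (t * v) * q ^+ 2 + e).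
Proof.
move=> NG; elim: m => [_|m IH mK].
  by rewrite subn0 /lam !mul0r subr0 addr0.
have -> : lam m.+1 = lam m - r ^+ 2 * t by rewrite /lam -natr1; ring.
move: (IH (ltnW mK)); rewrite (subnSK' mK) -stage_Q2 -stage_Q1 -natr1.
set k := (K - m.+1)%N; have mk := mk_stage m k.
set c := r ^+ 2 * (t * v) * q ^+ 2 + e => h.
have : stage m k (Q1 (Lam (lam m - r ^+ 2 * t))) G0 <=
    stage m k (fun G => Q2 (Lam (lam m)) G + c) G0.
  by apply: (markov_le mk) => // G NG'; rewrite /c addrA step2.
rewrite (markovD _ (fun=> c) _ mk) (markov_cst mk).
lra.
Qed.

Let B G0 := iter K Q2 (fun G => Lam (3 * t) G - 2 * L G) G0.

Let stageB m k l G0 : stage m k (fun G => Lam l G - 2 * L G) G0 =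
  stage m k (Lam l) G0 - 2 * stage m k L G0.
Proof.
have mk := mk_stage m k.
by rewrite (markovB _ (fun G => 2 * L G) _ mk) (markovZ _ _ _ mk).
Qed.

(** The growth r^2 t v q^2 of the coupled energy per step equals the q^2 part of twice the increment
    of [L]. In the difference these cancel and only the accumulated deviations remain. *)
Let gap_stage m G0 : N G0 -> (m <= K)%N ->
  stage m (K - m) (fun G => Lam (lam m) G - 2 * L G) G0 <=
  B G0 + r ^+ 2 * (\sum_(i < m) x G0 i) + 3 * (K%:R * e).
Proof.
move=> NG mK; rewrite stageB.
have -> : B G0 = stage 0 K (Lam (3 * t)) G0 - 2 * stage 0 K L G0 by rewrite -stageB.
have me : m%:R * e <= K%:R * e by rewrite ler_wpM2r// ler_nat.
have := psi2 NG mK; have := psi1 NG mK; rewrite ler_norml.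
set y := stage m _ _ _; set z := stage m _ _ _; set u := stage 0 _ _ _.
set S := \sum_(i < m) _; move=> /andP[h1 _] h2.
move: me h1 h2; set k := m%:R; lra.
Qed.

Let beta G0 := B G0 + 3 * (K%:R * e) + e'.

Let B_ge0 G0 : N G0 -> 0 <= B G0.
Proof.
move=> NG; apply: (markov_ge_cst (markov_iter K mk2)) => // G NG'.
by apply: le_trans (gap _ NG'); apply: mulr_ge0 (D_ge0 NG'); rewrite !mulr_ge0.
Qed.

Let beta_ge0 G0 : N G0 -> 0 <= beta G0.
Proof. by move=> NG; rewrite /beta !addr_ge0 ?B_ge0 ?mulr_ge0. Qed.

Let sum_le m G0 : N G0 -> (m <= K)%N -> (forall i, (i < m)%N -> x G0 i <= beta G0) ->
  r ^+ 2 * (\sum_(i < m) x G0 i) <= beta G0.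
Proof.
move=> NG mK h; apply: (@le_trans _ _ (r ^+ 2 * (m%:R * beta G0))).
  rewrite ler_wpM2l//; apply: (@le_trans _ _ (\sum_(i < m) beta G0)).
    by apply: ler_sum => i _; exact: h.
  by rewrite sumr_const card_ord mulr_natl.
by rewrite mulrA (mulrC (r ^+ 2)) ler_piMl ?beta_ge0// mr2_le1.
Qed.

Let gapD m k G0 : N G0 -> (m <= K)%N ->
  2 * (t * v * stage m k D G0) <=
  stage m k (fun G => Lam (lam m) G - 2 * L G) G0.
Proof.
move=> NG mK; have mk := mk_stage m k.
apply: (@le_trans _ _ (stage m k (fun G => lam m * v * D G) G0)).
  rewrite (markovZ _ _ _ mk) mulrA ler_wpM2r ?stage_ge0//.
  by rewrite mulrA ler_wpM2r// lam_ge.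
by apply: (markov_le mk) => // G; exact: gap.
Qed.

(** If the earlier deviations are at most [beta], their sum times r^2 is at most [beta] because m
    r^2 <= 1, so the gap is at most 2 [beta] once e' is included. As the coupling is still at least
    2t, the gap dominates twice the current deviation. The term e' pays for the one decoupled step
    by which the two stages differ. *)
Let x_le G0 m : N G0 -> (m < K)%N -> x G0 m <= beta G0.
Proof.
move=> NG; elim/ltn_ind: m => m IH mK.
have h := sum_le NG (ltnW mK) (fun i im => IH i im (ltn_trans im mK)).
have h1 := gapD (K - m.+1) NG (ltnW mK).
have h2 := gap_stage NG (ltnW mK).
have mk := mk_stage m (K - m.+1).
have h3 : stage m (K - m.+1) (fun G => Lam (lam m) G - 2 * L G) G0 <=
    stage m (K - m) (fun G => Lam (lam m) G - 2 * L G) G0 + e'.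
  rewrite (subnSK' mK) -stage_Q2.
  rewrite -[X in _ + X](markov_cst mk e' G0) -(markovD _ _ _ mk).
  by apply: (markov_le mk) => // G; exact: gap_lip.
move: h; rewrite -/(x _ _) in h1 *; rewrite /beta; lra.
Qed.

(** The second bound compares the two free energies. The third one, at the pure SK end of the path,
    is what uniqueness of the fixed point uses. *)
Lemma interpolation_bound G0 : N G0 ->
  let b := iter K Q2 (fun G => Lam (3 * t) G - 2 * L G) G0 + 3 * (K%:R * e) + e' in
  [/\ 0 <= b,
      `|iter K Q1 L G0 - iter K Q2 L G0 - t * v * q ^+ 2 / 2| <= b &
      t * v * iter K Q1 D G0 <= b].
Proof.
move=> NG; rewrite -/(B G0) -/(beta G0); have b0 := beta_ge0 NG.
have hs := sum_le NG (leqnn K) (fun i => x_le NG).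
have s0 : 0 <= r ^+ 2 * (\sum_(i < K) x G0 i).
  by rewrite mulr_ge0// sumr_ge0// => i _; exact: x_ge0.
split=> //.
- have := psi1 NG (leqnn K); rewrite subnn.
  rewrite -[stage K 0 L G0]/(iter K Q1 L G0) -[stage 0 K L G0]/(iter K Q2 L G0).
  set S := \sum_(i < K) _ in hs s0 *; have B0 := B_ge0 NG.
  have K0 : 0 <= K%:R * e by rewrite mulr_ge0.
  have -> : r ^+ 2 / 2 * (K%:R * (t * v * q ^+ 2) - S) =
      (K%:R * r ^+ 2) * (t * v * q ^+ 2) / 2 - r ^+ 2 * S / 2 by ring.
  rewrite rK mul1r.
  move: hs; rewrite /beta !ler_norml.
  move: (r ^+ 2 * S) s0 B0 K0 e'_ge0 => s s0.
  by move: (B G0) (K%:R * e) (t * v * q ^+ 2) e' => b ke w e1; lra.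
- have := gap_stage NG (leqnn K); have := gapD 0 NG (leqnn K).
  rewrite subnn -[stage K 0 D G0]/(iter K Q1 D G0).
  move: hs e'_ge0; rewrite /beta.
  set S := r ^+ 2 * _; set z := stage K 0 _ G0; set y := iter K Q1 D G0.
  by move: S z y (B G0) (K%:R * e) e' => S z y b ke e1; lra.
Qed.

End Interpolation.

(** * Two replicas *)

Section Replicas.
Context {R : realType} {d : measure_display} {T : measurableType d}.
Context (P : probability T R).
Notation N := (@bounded_measurable R d T).
Notation N2 := (@bounded_measurable R _ (T * T)%type).
Let A : fun_algebra N := bounded_measurable_algebra.
Let A2 : fun_algebra N2 := bounded_measurable_algebra.
Let mm := pmean_is_mean P.
Let mm2 := pmean2_is_mean P.

Definition lift (G : T -> R) : T * T -> R := fun z => G z.1 + G z.2.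

Lemma bounded_measurable_fst G : N G -> N2 (fun z => G z.1).
Proof.
move=> [mG [M hM]]; split; last by exists M.
exact: (measurableT_comp mG measurable_fst).
Qed.

Lemma bounded_measurable_snd G : N G -> N2 (fun z => G z.2).
Proof.
move=> [mG [M hM]]; split; last by exists M.
exact: (measurableT_comp mG measurable_snd).
Qed.

Lemma bounded_measurable_lift G : N G -> N2 (lift G).
Proof.
move=> NG; have h1 := bounded_measurable_fst NG; have h2 := bounded_measurable_snd NG.
by rewrite (_ : lift G = (fun z => G z.1) + (fun z => G z.2))//; nice A2.
Qed.

Lemma liftD G H : lift (G + H) = lift G + lift H.
Proof. by apply/funext => z; rewrite /lift !fctE; ring. Qed.

Lemma liftB G H : lift (G - H) = lift G - lift H.
Proof. by apply/funext => z; rewrite /lift !fctE; ring. Qed.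

Lemma liftZ c G : lift (c *: G) = c *: lift G.
Proof. by apply/funext => z; rewrite /lift !fctE/= /GRing.scale/=; ring. Qed.

Lemma lift_sum I (s : seq I) F :
  lift (\sum_(i <- s) F i) = \sum_(i <- s) lift (F i).
Proof.
elim: s => [|i s IH]; last by rewrite !big_cons liftD IH.
by rewrite !big_nil; apply/funext => z; exact: addr0.
Qed.

(** Both replicas see the same disorder, so a sign in front of F acts on the two-replica potential
    as the same sign in front of [lift F]. *)
Lemma avgs_lift I (s : seq I) (F : I -> T -> R) Phi U G :
  avgs s F (fun G => Phi (lift G + U)) G = avgs s (lift \o F) Phi (lift G + U).
Proof.
elim: s G => [//|i s IH] G.
rewrite /= -[LHS]/((avgs s F (fun G => Phi (lift G + U)) (G + F i) +
  avgs s F (fun G => Phi (lift G + U)) (G - F i)) / 2) !IH liftD liftB.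
rewrite -[RHS]/((avgs s (lift \o F) Phi (lift G + U + lift (F i)) +
  avgs s (lift \o F) Phi (lift G + U - lift (F i))) / 2).
by rewrite (addrAC _ (lift (F i)) U) (addrAC _ (- lift (F i)) U).
Qed.

(** The Ito correction. In the one-replica expansion it cancels the Gibbs means of the squared
    features, and only minus half the squares of the Gibbs means survives. *)
Definition drift I (s : seq I) (F : I -> T -> R) : T -> R :=
  - (2^-1 *: \sum_(i <- s) F i ^+ 2).

Definition cov I (s : seq I) (F : I -> T -> R) : T * T -> R :=
  fun z => \sum_(i <- s) F i z.1 * F i z.2.

Lemma covE I (s : seq I) (F : I -> T -> R) :
  cov s F = \sum_(i <- s) ((fun z => F i z.1) * (fun z => F i z.2)).
Proof.
apply/funext => z; rewrite /cov.
elim: s => [|i s IH]; first by rewrite !big_nil.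
by rewrite !big_cons IH !fctE.
Qed.

Lemma bounded_measurable_cov I (s : seq I) F : (forall i, N (F i)) -> N2 (cov s F).
Proof.
move=> NF; rewrite covE; apply: (fun_sum A2) => i.
apply: (fun_mul A2); [exact: bounded_measurable_fst|exact: bounded_measurable_snd].
Qed.

Lemma bounded_measurable_drift I (s : seq I) F : (forall i, N (F i)) -> N (drift s F).
Proof. by move=> NF; rewrite /drift; nice A. Qed.

Lemma gibbs_lift G f g : N G -> N f -> N g ->
  gibbs (pmean2 P) (lift G) (fun z => f z.1 * g z.2) =
  gibbs (pmean P) G f * gibbs (pmean P) G g.
Proof.
move=> NG Nf Ng; rewrite /gibbs.
have NE := fun_exp A NG; have p := mean_expR_gt0 A mm NG.
have -> : (fun z : T * T => f z.1 * g z.2) * (expR \o lift G) =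
    fun z => (f * (expR \o G)) z.1 * (g * (expR \o G)) z.2.
  by apply/funext => z; rewrite !fctE/= /lift expRD; ring.
have -> : expR \o lift G = fun z => (expR \o G) z.1 * (expR \o G) z.2.
  by apply/funext => z; rewrite !fctE/= /lift expRD.
rewrite !pmean2_prod//; try by nice A.
by rewrite mulrACA invfM.
Qed.

Section Block.
Context (I : Type) (s : seq I) (F : I -> T -> R) (b : R).
Hypotheses (NF : forall i, N (F i)) (hF : forall i w, `|F i w| <= b) (b0 : 0 <= b).

Notation scaled_block r := (block s (fun i => r *: F i) (r ^+ 2 *: drift s F)).

Lemma markov_scaled_block r : markov N (scaled_block r).
Proof.
have NV := bounded_measurable_drift s NF.
by apply: (markov_block A) => [i|]; nice A.
Qed.

Lemma scaled_block_replica1 : exists C, 0 <= C /\ forall (r : R) G, 0 <= r <= 1 -> N G ->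
  `|scaled_block r (free_energy (pmean P)) G - free_energy (pmean P) G
    + r ^+ 2 / 2 * \sum_(i <- s) gibbs (pmean P) G (F i) ^+ 2| <= r ^+ 3 * C.
Proof.
have NV := bounded_measurable_drift s NF.
have [k hk] := fun_bnd A NV; pose k' := `|k|.
have hk' w : `|drift s F w| <= k' by apply: le_trans (hk w) (ler_norm _).
exists (block_cst b k' (size s)); split.
  exact: (block_cst_ge0 _ b0 (normr_ge0 _)).
move=> r G r01 NG; set mu := gibbs _ _.
have mmu : is_mean N mu := gibbs_is_mean A mm NG.
have := free_energy_block A mm s NF hF NV hk' b0 (normr_ge0 _) r01 NG.
have -> : gibbs (pmean P) G (drift s F) = - (\sum_(i <- s) mu (F i ^+ 2)) / 2.
  rewrite -/mu /drift (meanN A mmu); last by nice A.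
  rewrite (meanZ A mmu); last by nice A.
  rewrite (mean_sum A mmu); last by move=> i; nice A.
  by rewrite mulNr; congr (- _); exact: mulrC.
rewrite -/mu sumrB; apply: le_trans.
rewrite le_eqVlt; apply/orP; left; apply/eqP; congr Num.norm.
set x := \sum_(i <- s) _; set y := \sum_(i <- s) _; by field.
Qed.

(** The square of a lifted feature has the cross term 2 F(z.1) F(z.2). The drift cancels the
    diagonal part, and the cross terms survive as the covariance [cov]. U' is the change of coupling
    during the step. The constant depends on neither G nor U, so it serves all steps and all values
    of the coupling. *)
Lemma scaled_block_replica2 U' : N2 U' ->
  exists C, 0 <= C /\ forall (r : R) G U, 0 <= r <= 1 -> N G -> N2 U ->
  `|scaled_block r (fun G => free_energy (pmean2 P) (lift G + (U + r ^+ 2 *: U'))) G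
    - free_energy (pmean2 P) (lift G + U)
    - r ^+ 2 * (gibbs (pmean2 P) (lift G + U) (U' + cov s F) -
       (\sum_(i <- s) gibbs (pmean2 P) (lift G + U) (lift (F i)) ^+ 2) / 2)|
  <= r ^+ 3 * C.
Proof.
move=> NU'.
have Nd := bounded_measurable_drift s NF.
have NV : N2 (lift (drift s F) + U').
  by apply: (fun_add A2) => //; exact: bounded_measurable_lift.
have [k hk] := fun_bnd A2 NV; pose k' := `|k|.
have hk' w : `|(lift (drift s F) + U') w| <= k' by apply: le_trans (hk w) (ler_norm _).
exists (block_cst (2 * b) k' (size s)); split.
  by apply: (block_cst_ge0 _ _ (normr_ge0 _)); rewrite mulr_ge0.
move=> r G U r01 NG NU.
have NGU : N2 (lift G + U).
  by apply: (fun_add A2) => //; exact: bounded_measurable_lift.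
set mu := gibbs _ _.
have mmu : is_mean N2 mu := gibbs_is_mean A2 mm2 NGU.
have NlF i : N2 (lift (F i)) by exact: bounded_measurable_lift.
have hlF i w : `|lift (F i) w| <= 2 * b.
  rewrite mulr_natl mulr2n (le_trans (ler_normD _ _))// lerD//; exact: hF.
have b20 : 0 <= 2 * b by rewrite mulr_ge0.
have := free_energy_block A2 mm2 s NlF hlF NV hk' b20 (normr_ge0 _) r01 NGU.
have -> : block s (fun i => r *: lift (F i)) (r ^+ 2 *: (lift (drift s F) + U'))
    (free_energy (pmean2 P)) (lift G + U) =
    scaled_block r (fun G => free_energy (pmean2 P) (lift G + (U + r ^+ 2 *: U'))) G.
  rewrite /block /shift /= avgs_lift liftD liftZ.
  have -> : (fun i => r *: lift (F i)) = lift \o (fun i => r *: F i).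
    by apply/funext => i; rewrite /= liftZ.
  by congr avgs; rewrite scalerDr addrACA addrA.
rewrite -/mu; apply: le_trans.
rewrite le_eqVlt; apply/orP; left; apply/eqP; congr Num.norm; congr (_ - _ * _).
have Ncov := bounded_measurable_cov s NF.
have e : lift (drift s F) = - 2^-1 *: (\sum_(i <- s) lift (F i) ^+ 2) + cov s F.
  rewrite /drift -scaleNr liftZ lift_sum.
  have -> : \sum_(i <- s) lift (F i) ^+ 2 =
      \sum_(i <- s) lift (F i ^+ 2) + 2 *: cov s F.
    rewrite covE scaler_sumr -big_split; apply: eq_bigr => i _ /=.
    by apply/funext => z; rewrite /lift !fctE/= /GRing.scale/=; ring.
  apply/funext => z; rewrite !fctE/= /GRing.scale/=; by field.
rewrite e !(meanD mmu); try (by nice A2).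
rewrite (meanZ A2 mmu); last by nice A2.
rewrite (mean_sum A2 mmu); last by move=> i; nice A2.
rewrite sumrB.
set x := \sum_(i <- s) _; set y := \sum_(i <- s) _; by field.
Qed.

Lemma sum_gibbs_sqr_le (W : Type) (M : set (W -> R)) (B : fun_algebra M) mu
    (mmu : is_mean M mu) (H : I -> W -> R) (c : R) :
  (forall i, M (H i)) -> (forall i w, `|H i w| <= c) ->
  0 <= \sum_(i <- s) mu (H i) ^+ 2 <= (size s)%:R * c ^+ 2.
Proof.
move=> MH hH; have h i : 0 <= mu (H i) ^+ 2 <= c ^+ 2.
  have h1 : `|mu (H i)| <= c by exact: (mean_norm_le B mmu).
  rewrite sqr_ge0/= -real_normK ?num_real// lerXn2r ?nnegrE//.
  exact: le_trans h1.
elim: s => [|i u /andP[IH1 IH2]]; first by rewrite big_nil mul0r lexx.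
have /andP[h1 h2] := h i.
by rewrite big_cons addr_ge0//= -natr1 mulrDl mul1r addrC lerD.
Qed.

(** A crude bound of order r is enough for [gap_lip], whose error enters the recursion once and is
    not summed over the K steps. *)
Lemma scaled_block_replica1_lip : exists C, 0 <= C /\ forall (r : R) G,
  0 <= r <= 1 -> N G ->
  `|scaled_block r (free_energy (pmean P)) G - free_energy (pmean P) G| <= r * C.
Proof.
have [C [C0 hC]] := scaled_block_replica1.
exists (C + (size s)%:R * b ^+ 2); split.
  by rewrite addr_ge0// mulr_ge0// exprn_ge0.
move=> r G r01 NG; have := hC r G r01 NG.
have := sum_gibbs_sqr_le A (gibbs_is_mean A mm NG) NF hF.
set S := \sum_(i <- s) _; set c := (size s)%:R * _ => /andP[S0 Sc].
have /andP[r0 r1] := r01.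
have r2 : 0 <= r ^+ 2 <= r by rewrite sqr_ge0/= expr2 ler_piMl.
have r3 : r ^+ 3 * C <= r * C.
  by rewrite ler_wpM2r// exprS ler_piMr//; exact: exprn_ile1.
have : 0 <= r ^+ 2 * S <= r * c.
  have /andP[h1 h2] := r2.
  by rewrite mulr_ge0//= ler_pM.
set x := _ - _; rewrite mulrDr.
have -> : r ^+ 2 / 2 * S = r ^+ 2 * S / 2 by ring.
by move: r3; rewrite !ler_norml; lra.
Qed.

Lemma scaled_block_replica2_lip : exists C, 0 <= C /\ forall (r : R) G U,
  0 <= r <= 1 -> N G -> N2 U ->
  `|scaled_block r (fun G => free_energy (pmean2 P) (lift G + U)) G
    - free_energy (pmean2 P) (lift G + U)| <= r * C.
Proof.
have N20 : N2 0 by exact: (fun_cst A2 0).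
have [C [C0 hC]] := scaled_block_replica2 N20.
have b20 : 0 <= 2 * b by rewrite mulr_ge0.
have Ncov := bounded_measurable_cov s NF.
have [k hk] := fun_bnd A2 Ncov; pose k' := `|k|.
have hk' w : `|cov s F w| <= k' by apply: le_trans (hk w) (ler_norm _).
exists (C + k' + (size s)%:R * (2 * b) ^+ 2); split.
  by rewrite !addr_ge0 ?normr_ge0// mulr_ge0// exprn_ge0.
move=> r G U r01 NG NU; have := hC r G U r01 NG NU.
rewrite scaler0 addr0 add0r.
have NGU : N2 (lift G + U).
  by apply: (fun_add A2) => //; exact: bounded_measurable_lift.
have mmu := gibbs_is_mean A2 mm2 NGU.
have NlF i : N2 (lift (F i)) by exact: bounded_measurable_lift.
have hlF i w : `|lift (F i) w| <= 2 * b.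
  rewrite mulr_natl mulr2n (le_trans (ler_normD _ _))// lerD//; exact: hF.
have := sum_gibbs_sqr_le A2 mmu NlF hlF.
have := mean_norm_le A2 mmu Ncov hk'.
set m := gibbs _ _ (cov s F).
set S := \sum_(i <- s) _; set c := (size s)%:R * _ => hm /andP[S0 Sc].
have /andP[r0 r1] := r01.
have r2 : 0 <= r ^+ 2 <= r by rewrite sqr_ge0/= expr2 ler_piMl.
have /andP[h1 h2] := r2.
have r3 : r ^+ 3 * C <= r * C.
  by rewrite ler_wpM2r// exprS ler_piMr//; exact: exprn_ile1.
have : 0 <= r ^+ 2 * S <= r * c by rewrite mulr_ge0//= ler_pM.
have : `|r ^+ 2 * m| <= r * k' by rewrite normrM ger0_norm// ler_pM.
rewrite !mulrDr.
have -> : r ^+ 2 * (- (S / 2)) = - (r ^+ 2 * S / 2) by ring.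
set x := _ - free_energy _ _.
by move: r3; rewrite !ler_norml; lra.
Qed.

End Block.
End Replicas.

Section Pairs.
Context {R : realType}.
Implicit Types a : nat -> nat -> R.

Definition pairs n := [seq p <- allpairs pair (iota 0 n) (iota 0 n) | (p.1 <= p.2)%N].

(** The weight makes the variances of the features match the coefficients sqrt(2/n) off the diagonal
    and 1/sqrt n on it. *)
Definition pair_mult (p : nat * nat) : R := if p.1 == p.2 then 1 else 2.

(** Symmetrizing the sum over i <= j counts every off-diagonal term with its weight 2 and the
    diagonal twice, so both sides agree after doubling. *)
Lemma sum_pairs n a : (forall i j, a i j = a j i) ->
  \sum_(p <- pairs n) pair_mult p * a p.1 p.2 =
  \sum_(i <- iota 0 n) \sum_(j <- iota 0 n) a i j.
Proof.
move=> asym; rewrite big_filter big_mkcond big_allpairs /=.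
set b := fun i j => if (i <= j)%N then pair_mult (i, j) * a i j else 0.
rewrite -[LHS]/(\sum_(i <- iota 0 n) \sum_(j <- iota 0 n) b i j).
have h : \sum_(i <- iota 0 n) \sum_(j <- iota 0 n) (b i j + b j i) =
    2 * \sum_(i <- iota 0 n) \sum_(j <- iota 0 n) a i j.
  rewrite mulr_sumr; apply: eq_bigr => i _; rewrite mulr_sumr.
  apply: eq_bigr => j _; rewrite /b /pair_mult/= (asym j i).
  by case: ltngtP => [ij|ji|->]; rewrite ?eqxx ?addr0 ?add0r//; ring.
have : \sum_(i <- iota 0 n) \sum_(j <- iota 0 n) (b i j + b j i) =
    2 * \sum_(i <- iota 0 n) \sum_(j <- iota 0 n) b i j.
  under eq_bigr do rewrite big_split.
  by rewrite big_split/= [X in _ + X]exchange_big/=; ring.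
by rewrite h => /mulfI ->//; rewrite pnatr_eq0.
Qed.

End Pairs.

(** * The SK field, the decoupled field and their exchange *)

Section SKInterpolation.
Context {R : realType} {d : measure_display} {T : measurableType d}.
Context (P : probability T R) (s : nat -> T -> R) (n : nat) (t q : R).
Notation N := (@bounded_measurable R d T).
Notation N2 := (@bounded_measurable R _ (T * T)%type).
Let A : fun_algebra N := bounded_measurable_algebra.
Let A2 : fun_algebra N2 := bounded_measurable_algebra.
Let mm := pmean_is_mean P.
Let mm2 := pmean2_is_mean P.
Hypotheses (Ns : forall i, N (s i)) (hs : forall i w, `|s i w| <= 1).
Hypotheses (n0 : (0 < n)%N) (t0 : 0 <= t) (q0 : 0 <= q).

Let nR : 0 < n%:R :> R. Proof. by rewrite ltr0n. Qed.
Let nN : n%:R != 0 :> R. Proof. by rewrite gt_eqF. Qed.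

Definition sk_feature (p : nat * nat) : T -> R :=
  Num.sqrt (t * pair_mult p / n%:R) *: (s p.1 * s p.2).

Definition rs_feature (i : nat) : T -> R := Num.sqrt (2 * q * t) *: s i.

Definition pair_overlap (z : T * T) : R :=
  n%:R^-1 * \sum_(i <- iota 0 n) s i z.1 * s i z.2.

Definition overlap_dev : T * T -> R := fun z => (pair_overlap z - q) ^+ 2.

Let pm0 p : 0 <= pair_mult p :> R. Proof. by rewrite /pair_mult; case: ifP. Qed.

Let sk_coef p : Num.sqrt (t * pair_mult p / n%:R) ^+ 2 = t * pair_mult p / n%:R.
Proof. by rewrite sqr_sqrtr// !mulr_ge0// invr_ge0 ltW. Qed.

Let rs_coef : Num.sqrt (2 * q * t) ^+ 2 = 2 * q * t.
Proof. by rewrite sqr_sqrtr// !mulr_ge0. Qed.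

Lemma cov_sk z : cov (pairs n) sk_feature z = t * n%:R * pair_overlap z ^+ 2.
Proof.
rewrite /cov /sk_feature.
transitivity (t / n%:R * \sum_(p <- pairs n) pair_mult p *
    (s p.1 z.1 * s p.1 z.2 * (s p.2 z.1 * s p.2 z.2))).
  rewrite mulr_sumr; apply: eq_bigr => p _.
  rewrite !fctE/= /GRing.scale/=.
  transitivity (Num.sqrt (t * pair_mult p / n%:R) ^+ 2 *
    (s p.1 z.1 * s p.1 z.2 * (s p.2 z.1 * s p.2 z.2))); first by ring.
  by rewrite sk_coef; ring.
rewrite (sum_pairs n (a := fun i j => s i z.1 * s i z.2 * (s j z.1 * s j z.2))); last first.
  by move=> i j; rewrite mulrC.
rewrite /pair_overlap exprMn expr2 [X in _ = _ * (_ * X)]expr2 mulr_suml.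
under eq_bigr do rewrite -mulr_sumr.
by field.
Qed.

Lemma cov_rs z : cov (iota 0 n) rs_feature z = 2 * q * t * n%:R * pair_overlap z.
Proof.
rewrite /cov /rs_feature /pair_overlap mulrA mulfK// mulr_sumr.
apply: eq_bigr => i _; rewrite !fctE/= /GRing.scale/=.
transitivity (Num.sqrt (2 * q * t) ^+ 2 * (s i z.1 * s i z.2)); first by ring.
by rewrite rs_coef.
Qed.

(** Completing the square. The variance 2 q t of the decoupled field is chosen so that its
    covariance is, up to a constant, the tangent of t n x^2 at x = q. *)
Lemma overlap_dev_cov : (t * n%:R) *: overlap_dev =
  cov (pairs n) sk_feature - cov (iota 0 n) rs_feature + cst (t * n%:R * q ^+ 2).
Proof.
apply/funext => z; rewrite !fctE/= /GRing.scale/= cov_sk cov_rs /overlap_dev.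
by ring.
Qed.

Lemma bounded_measurable_sk p : N (sk_feature p).
Proof. by have := Ns => ?; rewrite /sk_feature; nice A. Qed.

Lemma bounded_measurable_rs i : N (rs_feature i).
Proof. by have := Ns => ?; rewrite /rs_feature; nice A. Qed.

Lemma sk_feature_norm_le p w : `|sk_feature p w| <= Num.sqrt (t * 2 / n%:R).
Proof.
rewrite /sk_feature !fctE/= /GRing.scale/= normrM ger0_norm ?sqrtr_ge0//.
rewrite -[leRHS]mulr1; apply: ler_pM; rewrite ?sqrtr_ge0//.
  rewrite ler_wsqrtr// ler_pM2r ?invr_gt0// ler_wpM2l//.
  by rewrite /pair_mult; case: ifP => // _; rewrite ler1n.
by rewrite normrM mulr_ile1.
Qed.

Lemma rs_feature_norm_le i w : `|rs_feature i w| <= Num.sqrt (2 * q * t).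
Proof.
rewrite /rs_feature !fctE/= /GRing.scale/= normrM ger0_norm ?sqrtr_ge0//.
by rewrite ler_piMr ?sqrtr_ge0.
Qed.

Lemma bounded_measurable_overlap_dev : N2 overlap_dev.
Proof.
have Np : N2 pair_overlap.
  have -> : pair_overlap = n%:R^-1 *: cov (iota 0 n) s by [].
  by apply: (fun_scale A2); exact: bounded_measurable_cov.
have -> : overlap_dev = (pair_overlap - cst q) ^+ 2 by [].
by nice A2.
Qed.

(** Pointwise (a + b)^2 <= 2 (a^2 + b^2), combined with nonnegativity of the variance of
    [lift V]. *)
Lemma mean_lift_sqr mu V : is_mean N2 mu -> N V ->
  mu (lift V) ^+ 2 / 2 <= mu (lift (V ^+ 2)).
Proof.
move=> mmu NV; have NV2 := fun_sqr A NV.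
have := bounded_measurable_lift NV; have := bounded_measurable_lift NV2.
have e z : 0 <= 2 * lift (V ^+ 2) z - lift V z ^+ 2.
  rewrite /lift !fctE.
  have -> : 2 * (V z.1 ^+ 2 + V z.2 ^+ 2) - (V z.1 + V z.2) ^+ 2 =
    (V z.1 - V z.2) ^+ 2 by ring.
  exact: sqr_ge0.
move: (lift V) (lift (V ^+ 2)) e => f g e Ng Nf.
set x := mu f.
have h0 : 0 <= mu ((f - cst x) ^+ 2).
  by apply: (mean_ge A2 mmu) => [|z]; [nice A2|exact: sqr_ge0].
have h1 : mu (f ^+ 2) <= 2 * mu g.
  rewrite -(meanZ A2 mmu)//; apply: (mean_le mmu); [nice A2|nice A2|].
  by move=> z; have := e z; rewrite !fctE/= /GRing.scale/=; lra.
move: h0.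
have -> : (f - cst x) ^+ 2 = f ^+ 2 + (- 2 * x) *: f + cst (x ^+ 2).
  by apply/funext => z; rewrite !fctE/= /GRing.scale/=; ring.
rewrite !(meanD mmu); try by nice A2.
rewrite (meanZ A2 mmu)// (mean_cst A2 mmu) -/x.
lra.
Qed.

(* This positivity makes the replica-coupled energy monotone along the path. *)
Lemma replica_positivity mu : is_mean N2 mu ->
  0 <= \sum_(p <- pairs n) mu (lift (sk_feature p)) ^+ 2
    - \sum_(i <- iota 0 n) mu (lift (rs_feature i)) ^+ 2 + 4 * (t * n%:R * q ^+ 2).
Proof.
move=> mmu.
have Nss i j : N (s i * s j) by have := Ns => ?; nice A.
pose M i j := mu (lift (s i * s j)); pose m i := mu (lift (s i)).
have -> : \sum_(p <- pairs n) mu (lift (sk_feature p)) ^+ 2 =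
    t / n%:R * \sum_(i <- iota 0 n) \sum_(j <- iota 0 n) M i j ^+ 2.
  rewrite -(sum_pairs n (a := fun i j => M i j ^+ 2)); last first.
    by move=> i j; rewrite /M mulrC.
  rewrite mulr_sumr; apply: eq_bigr => p _.
  rewrite /sk_feature liftZ (meanZ A2 mmu); last exact: bounded_measurable_lift.
  by rewrite exprMn sk_coef -/(M _ _); ring.
have -> : \sum_(i <- iota 0 n) mu (lift (rs_feature i)) ^+ 2 =
    2 * q * t * \sum_(i <- iota 0 n) m i ^+ 2.
  rewrite mulr_sumr; apply: eq_bigr => i _.
  rewrite /rs_feature liftZ (meanZ A2 mmu); last exact: bounded_measurable_lift.
  by rewrite exprMn rs_coef.
set S := \sum_(i <- _) \sum_(j <- _) _; set x := \sum_(i <- _) m i ^+ 2.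
(* Testing against the magnetization profile itself: [lift V] has mean x, while [lift] of V^2 has
   mean Q, which is the pairing of the matrix M with m i * m j. *)
pose V := \sum_(i <- iota 0 n) m i *: s i.
have NV : N V by have := Ns => ?; apply: (fun_sum A) => i; nice A.
have NV2 : N (V ^+ 2) by nice A.
have NlV := bounded_measurable_lift NV; have NlV2 := bounded_measurable_lift NV2.
have Ns2 i : N2 (lift (s i)) by exact: bounded_measurable_lift.
have Nss2 i j : N2 (lift (s i * s j)) by exact: bounded_measurable_lift.
have muV : mu (lift V) = x.
  rewrite /V lift_sum (mean_sum A2 mmu) => [|i]; last first.
    by rewrite liftZ; exact: (fun_scale A2).
  by apply: eq_bigr => i _; rewrite liftZ (meanZ A2 mmu)// -/(m i) expr2.
pose Q := \sum_(i <- iota 0 n) \sum_(j <- iota 0 n) m i * m j * M i j.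
have muV2 : mu (lift (V ^+ 2)) = Q.
  have -> : V ^+ 2 = \sum_(i <- iota 0 n) \sum_(j <- iota 0 n) (m i * m j) *: (s i * s j).
    rewrite expr2 /V mulr_suml; apply: eq_bigr => i _.
    rewrite mulr_sumr; apply: eq_bigr => j _.
    by apply/funext => w; rewrite !fctE/= /GRing.scale/=; ring.
  rewrite lift_sum (mean_sum A2 mmu) => [|i]; last first.
    by rewrite lift_sum; apply: (fun_sum A2) => j; rewrite liftZ; exact: (fun_scale A2).
  apply: eq_bigr => i _; rewrite lift_sum (mean_sum A2 mmu) => [|j]; last first.
    by rewrite liftZ; exact: (fun_scale A2).
  by apply: eq_bigr => j _; rewrite liftZ (meanZ A2 mmu).
have QV : x ^+ 2 / 2 <= Q.
  by rewrite -muV -muV2; exact: mean_lift_sqr.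
(* Expanding the sum of squares of M i j - m i * m j / 2; together with Q >= x^2/2 it gives S >=
   x^2/4. *)
have SQ : Q - x ^+ 2 / 4 <= S.
  rewrite -subr_ge0.
  suff -> : S - (Q - x ^+ 2 / 4) = \sum_(i <- iota 0 n) \sum_(j <- iota 0 n)
      (M i j - m i * m j / 2) ^+ 2.
    by apply: sumr_ge0 => i _; apply: sumr_ge0 => j _; exact: sqr_ge0.
  have -> : x ^+ 2 / 4 = \sum_(i <- iota 0 n) \sum_(j <- iota 0 n) (m i * m j / 2) ^+ 2.
    rewrite expr2 {1}/x !mulr_suml; apply: eq_bigr => i _.
    rewrite /x mulr_sumr mulr_suml; apply: eq_bigr => j _; by field.
  rewrite opprB addrCA /S /Q -!sumrB -big_split; apply: eq_bigr => i _ /=.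
  rewrite -!sumrB -big_split; apply: eq_bigr => j _ /=; by field.
have S4 : x ^+ 2 / 4 <= S by lra.
(* The term 4 t n q^2 is exactly what completes the square in x, which vanishes at x = 4 n q. *)
apply: (@le_trans _ _ (t / n%:R * (x ^+ 2 / 4) - 2 * q * t * x + 4 * (t * n%:R * q ^+ 2))).
  have -> : t / n%:R * (x ^+ 2 / 4) - 2 * q * t * x + 4 * (t * n%:R * q ^+ 2) =
      t / n%:R * ((x - 4 * n%:R * q) / 2) ^+ 2 by field.
  by rewrite mulr_ge0 ?sqr_ge0// divr_ge0// ltW.
by rewrite lerD2r lerD2r ler_wpM2l// divr_ge0// ltW.
Qed.

Definition sk_block (r : R) :=
  block (pairs n) (fun p => r *: sk_feature p) (r ^+ 2 *: drift (pairs n) sk_feature).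

Definition rs_block (r : R) :=
  block (iota 0 n) (fun i => r *: rs_feature i) (r ^+ 2 *: drift (iota 0 n) rs_feature).

Definition gibbs_dev G := gibbs (pmean2 P) (lift G) overlap_dev.

Definition coupled_energy l G :=
  free_energy (pmean2 P) (lift G + (l * n%:R) *: overlap_dev).

Let L := free_energy (pmean P).

Lemma gibbs_cov I (u : seq I) F G : (forall i, N (F i)) -> N G ->
  gibbs (pmean2 P) (lift G) (cov u F) = \sum_(i <- u) gibbs (pmean P) G (F i) ^+ 2.
Proof.
move=> NF NG; have mmu := gibbs_is_mean A2 mm2 (bounded_measurable_lift NG).
rewrite covE (mean_sum A2 mmu) => [|i].
  by apply: eq_bigr => i _; rewrite expr2; exact: gibbs_lift.
by apply: (fun_mul A2); [exact: bounded_measurable_fst|exact: bounded_measurable_snd].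
Qed.

Lemma gibbs_devE G : N G -> t * n%:R * gibbs_dev G =
  \sum_(p <- pairs n) gibbs (pmean P) G (sk_feature p) ^+ 2
  - \sum_(i <- iota 0 n) gibbs (pmean P) G (rs_feature i) ^+ 2 + t * n%:R * q ^+ 2.
Proof.
move=> NG; have mmu := gibbs_is_mean A2 mm2 (bounded_measurable_lift NG).
have c1 := bounded_measurable_cov (pairs n) bounded_measurable_sk.
have c2 := bounded_measurable_cov (iota 0 n) bounded_measurable_rs.
rewrite -!gibbs_cov; [|exact: bounded_measurable_rs|by []|exact: bounded_measurable_sk|by []].
rewrite /gibbs_dev -(meanZ A2 mmu); last exact: bounded_measurable_overlap_dev.
rewrite overlap_dev_cov (meanD mmu); [|by nice A2|by nice A2].
by rewrite (meanB A2 mmu)// (mean_cst A2 mmu).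
Qed.

(** Twice [L] is the two-replica energy at zero coupling, so this is Jensen's inequality for the
    Gibbs mean of two replicas. *)
Lemma coupled_energy_gap l G : N G -> l * n%:R * gibbs_dev G <= coupled_energy l G - 2 * L G.
Proof.
move=> NG; have NlG := bounded_measurable_lift NG.
have mmu := gibbs_is_mean A2 mm2 NlG; have Nd := bounded_measurable_overlap_dev.
have -> : 2 * L G = free_energy (pmean2 P) (lift G).
  rewrite /L /free_energy.
  have -> : expR \o lift G = fun z => (expR \o G) z.1 * (expR \o G) z.2.
    by apply/funext => z; rewrite /= /lift expRD.
  have NE := fun_exp A NG.
  rewrite (pmean2_prod P NE NE).
  by rewrite lnM ?posrE ?(mean_expR_gt0 A mm)//; ring.
rewrite /coupled_energy (free_energyD A2 mm2)//; last by nice A2.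
rewrite /gibbs_dev -(meanZ A2 mmu)//.
by apply: (jensen_ln_mean_expR A2 mmu); nice A2.
Qed.

(** The constant C comes from the block expansions alone: it may depend on n, t and q, but not on K
    or G. The K errors of order r^3 add up to order r because K r^2 = 1. *)
Lemma sk_interpolation : exists C, 0 <= C /\ forall K G, (0 < K)%N -> N G ->
  let r := (Num.sqrt K%:R)^-1 in
  let b := iter K (rs_block r) (fun G => coupled_energy (3 * t) G - 2 * L G) G
           + r * C in
  [/\ 0 <= b,
      `|iter K (sk_block r) L G - iter K (rs_block r) L G - t * n%:R * q ^+ 2 / 2| <= b &
      t * n%:R * iter K (sk_block r) gibbs_dev G <= b].
Proof.
have Nd := bounded_measurable_overlap_dev.
have bg := sqrtr_ge0 (t * 2 / n%:R); have bj := sqrtr_ge0 (2 * q * t).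
(* The loss of coupling per unit time. Added to the SK covariance it leaves the decoupled covariance
   minus a constant, by [overlap_dev_cov]. *)
have NU' : N2 (- (t * n%:R) *: overlap_dev) by nice A2.
have [C1 [C10 h1]] := scaled_block_replica1 P (pairs n) bounded_measurable_sk
  sk_feature_norm_le bg.
have [C2 [C20 h2]] := scaled_block_replica1 P (iota 0 n) bounded_measurable_rs
  rs_feature_norm_le bj.
have [C3 [C30 h3]] := scaled_block_replica2 P (pairs n) bounded_measurable_sk
  sk_feature_norm_le bg NU'.
have [C4 [C40 h4]] := scaled_block_replica2 P (iota 0 n) bounded_measurable_rs
  rs_feature_norm_le bj (fun_cst A2 0).
have [C5 [C50 h5]] := scaled_block_replica1_lip P (iota 0 n) bounded_measurable_rs
  rs_feature_norm_le bj.
have [C6 [C60 h6]] := scaled_block_replica2_lip P (iota 0 n) bounded_measurable_rs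
  rs_feature_norm_le bj.
exists (3 * (C1 + C2 + C3 + C4) + (C6 + 2 * C5)); split.
  by rewrite !(addr_ge0, mulr_ge0).
move=> K G K0 NG r.
have sK : 0 < Num.sqrt K%:R :> R by rewrite sqrtr_gt0 ltr0n.
have r0 : 0 <= r by rewrite invr_ge0 ltW.
have rK : K%:R * r ^+ 2 = 1.
  by rewrite /r exprVn sqr_sqrtr// divff// pnatr_eq0 -lt0n.
have r01 : 0 <= r <= 1.
  by rewrite r0/= invf_le1// -[leLHS]sqrtr1 ler_wsqrtr// ler1n.
pose e := r ^+ 3 * (C1 + C2 + C3 + C4); pose e' := r * (C6 + 2 * C5).
have e0 : 0 <= e by rewrite mulr_ge0 ?exprn_ge0// !addr_ge0.
have e'0 : 0 <= e' by rewrite mulr_ge0// addr_ge0// mulr_ge0.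
have mk1 : markov N (sk_block r) by apply: markov_scaled_block bounded_measurable_sk _.
have mk2 : markov N (rs_block r) by apply: markov_scaled_block bounded_measurable_rs _.
have Q12 : commuting (sk_block r) (rs_block r) by exact: commuting_block.
have D0 H : N H -> 0 <= gibbs_dev H.
  move=> NH; apply: (mean_ge A2 (gibbs_is_mean A2 mm2 (bounded_measurable_lift NH))) => // z.
  exact: sqr_ge0.
have st1 H : N H -> `|sk_block r L H - rs_block r L H
    - r ^+ 2 * (t * n%:R) / 2 * (q ^+ 2 - gibbs_dev H)| <= e.
  move=> NH; have := h1 r H r01 NH; have := h2 r H r01 NH; have := gibbs_devE NH.
  rewrite -/(sk_block r) -/(rs_block r) -/L /e.
  set x := \sum_(p <- _) _; set y := \sum_(p <- _) _; move=> eD.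
  have -> : r ^+ 2 * (t * n%:R) / 2 * (q ^+ 2 - gibbs_dev H) =
      - (r ^+ 2 / 2 * x) + r ^+ 2 / 2 * y.
    transitivity (r ^+ 2 / 2 * (t * n%:R * q ^+ 2 - t * n%:R * gibbs_dev H)).
      by ring.
    by rewrite eD; ring.
  have := mulr_ge0 (exprn_ge0 3 r0) C30; have := mulr_ge0 (exprn_ge0 3 r0) C40.
  by rewrite !ler_norml; lra.
have st2 l H : N H -> sk_block r (coupled_energy (l - r ^+ 2 * t)) H <=
    rs_block r (coupled_energy l) H + r ^+ 2 * (t * n%:R) * q ^+ 2 + e.
  move=> NH; have NU : N2 ((l * n%:R) *: overlap_dev) by nice A2.
  have := h3 r H _ r01 NH NU; have := h4 r H _ r01 NH NU.
  have -> : (fun G => free_energy (pmean2 P) (lift G +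
      ((l * n%:R) *: overlap_dev + r ^+ 2 *: cst 0))) = coupled_energy l.
    apply/funext => G'; rewrite /coupled_energy; congr (free_energy _ (_ + _)).
    by apply/funext => z; rewrite !fctE/= /GRing.scale/= mulr0 addr0.
  have -> : (fun G => free_energy (pmean2 P) (lift G +
      ((l * n%:R) *: overlap_dev + r ^+ 2 *: (- (t * n%:R) *: overlap_dev)))) =
      coupled_energy (l - r ^+ 2 * t).
    apply/funext => G'; rewrite /coupled_energy; congr (free_energy _ (_ + _)).
    by apply/funext => z; rewrite !fctE/= /GRing.scale/=; ring.
  have NHU : N2 (lift H + (l * n%:R) *: overlap_dev).
    by apply: (fun_add A2) => //; exact: bounded_measurable_lift.
  rewrite -/(sk_block r) -/(rs_block r).
  have mmu := gibbs_is_mean A2 mm2 NHU.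
  have c1 := bounded_measurable_cov (pairs n) bounded_measurable_sk.
  have c2 := bounded_measurable_cov (iota 0 n) bounded_measurable_rs.
  (* The spent coupling contributes - t n q^2 and half of the positivity at most 2 t n q^2. The sum
     t n q^2 is the growth that [step2] allows. *)
  have := replica_positivity mmu.
  move: mmu; set mu := gibbs _ _ => mmu.
  have -> : mu (- (t * n%:R) *: overlap_dev + cov (pairs n) sk_feature) =
      mu (cov (iota 0 n) rs_feature) - t * n%:R * q ^+ 2.
    rewrite scaleNr overlap_dev_cov.
    have -> : - (cov (pairs n) sk_feature - cov (iota 0 n) rs_feature +
         cst (t * n%:R * q ^+ 2)) + cov (pairs n) sk_feature =
        cov (iota 0 n) rs_feature - cst (t * n%:R * q ^+ 2).
      by apply/funext => z; rewrite !fctE/=; ring.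
    by rewrite (meanB A2 mmu) ?(mean_cst A2 mmu)//; nice A2.
  rewrite add0r.
  set x := \sum_(p <- pairs n) _; set y := \sum_(p <- iota 0 n) _.
  set m := mu _; set a := sk_block _ _ _; set b := rs_block _ _ _; set c := free_energy _ _.
  rewrite /e => pos.
  have := mulr_ge0 (exprn_ge0 3 r0) C10; have := mulr_ge0 (exprn_ge0 3 r0) C20.
  have := mulr_ge0 (sqr_ge0 r) pos.
  move: pos => _; set r2 := r ^+ 2; set r3 := r ^+ 3.
  rewrite !ler_norml.
  move=> h1' h2' h3' /andP[h4' _] /andP[_ h5'].
  by lra.
have gl l H : N H -> coupled_energy l H - 2 * L H <=
    rs_block r (fun G => coupled_energy l G - 2 * L G) H + e'.
  move=> NH; have NU : N2 ((l * n%:R) *: overlap_dev) by nice A2.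
  rewrite (markovB _ (fun G => 2 * L G) _ mk2) (markovZ _ _ _ mk2).
  have g1 : `|rs_block r L H - L H| <= r * C5 by exact: h5.
  have g2 : `|rs_block r (coupled_energy l) H - coupled_energy l H| <= r * C6.
    exact: (h6 r H _ r01 NH NU).
  rewrite /e' mulrDr mulrCA; move: g1 g2; rewrite !ler_norml.
  move: (rs_block r L H) (L H) (rs_block r (coupled_energy l) H) => a b c.
  move: (coupled_energy l H) (r * C5) (r * C6) => x y z.
  lra.
have [] := interpolation_bound mk1 mk2 Q12 t0 (ltW nR) e0 e'0 rK D0 st1 st2
  (fun l H => @coupled_energy_gap l H) gl NG.
have -> : K%:R * e = r * (C1 + C2 + C3 + C4).
  transitivity (K%:R * r ^+ 2 * (r * (C1 + C2 + C3 + C4))); first by rewrite /e; ring.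
  by rewrite rK mul1r.
move=> b0 b1 b2 b.
have bE : b = iter K (rs_block r) (fun G => coupled_energy (3 * t) G - 2 * L G) G +
   3 * (r * (C1 + C2 + C3 + C4)) + e' by rewrite /b /e'; ring.
by rewrite bE.
Qed.

End SKInterpolation.

(** * Independence through discretization *)

Section Discretization.
Context {R : realType}.
Implicit Types (M : nat) (v c : R).

Lemma eq_of_invn_bound (a b c : R) :
  (forall M, (0 < M)%N -> `|a - b| <= c / M%:R) -> a = b.
Proof.
move=> h; apply/eqP; rewrite -subr_eq0 -normr_le0 leNgt; apply/negP => ab.
have c0 : 0 < c by apply: lt_le_trans ab _; have := h 1%N isT; rewrite divr1.
have c1 : 0 <= c / `|a - b| by rewrite divr_ge0// ltW.
have [M [M0 cM]] : exists M, (0 < M)%N /\ c / `|a - b| < M%:R.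
  exists (Num.bound (c / `|a - b|)); have h1 := archi_boundP c1.
  by split=> //; rewrite -(ltr0n R) (le_lt_trans c1).
have := h M M0; rewrite leNgt => /negP; apply.
by rewrite ltr_pdivrMr ?ltr0n// mulrC -ltr_pdivrMr.
Qed.

Definition disc M v : R :=
  if `|v| < M%:R then (Num.floor (M%:R * v))%:~R / M%:R else 0.

(** 0 is listed for the truncated values, and [undup] makes every value occur once, as the partition
    in [disc_decomp] requires. *)
Definition disc_range M : seq R :=
  undup (0 :: [seq (j%:R - (M * M)%:R) / M%:R | j <- iota 0 (M * M + M * M)]).

Lemma disc_in_range M v : disc M v \in disc_range M.
Proof.
rewrite /disc_range mem_undup inE /disc; case: ifPn => vM; last by rewrite eqxx.
apply/orP; right; apply/mapP.
have M0 : 0 < M%:R :> R by apply: le_lt_trans vM.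
move: vM; rewrite ltr_norml => /andP[v1 v2].
set k := Num.floor _.
have eMM : (M * M)%:Z%:~R = M%:R * M%:R :> R by rewrite -natrM.
have k1 : (- (M * M)%:Z <= k)%R.
  by rewrite floor_ge_int rmorphN/= eMM -mulrN ler_pM2l// ltW.
have k2 : (k < (M * M)%:Z)%R.
  rewrite -(ltr_int R); apply: le_lt_trans (floor_le _) _.
  by rewrite eMM ltr_pM2l.
have kM : (0 <= k + (M * M)%:Z)%R by lia.
exists (absz (k + (M * M)%:Z)).
  by rewrite mem_iota/= add0n -ltz_nat gez0_abs// PoszD; lia.
congr (_ / _); rewrite natr_absz ger0_norm// intrD.
by rewrite -[(M * M)%:R]/((M * M)%:Z%:~R) addrK.
Qed.

(** Inside the window the error is at most 1/M; outside it equals |v|, and |v| >= M gives |v| <=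
    v^2/M. *)
Lemma disc_near M v : (0 < M)%N -> `|v - disc M v| <= (1 + v ^+ 2) / M%:R.
Proof.
move=> M0; have MR : 0 < M%:R :> R by rewrite ltr0n.
rewrite ler_pdivlMr// /disc; case: ifPn => vM.
  have := floor_le (M%:R * v); have := floorD1_gt (M%:R * v).
  rewrite intrD; set k := _%:~R => h1 h2.
  rewrite -[X in _ * X <= _](gtr0_norm MR) -normrM mulrBl divfK ?gt_eqF//.
  rewrite ger0_norm; last by rewrite mulrC subr_ge0.
  by have := sqr_ge0 v; rewrite mulrC; lra.
rewrite subr0 -leNgt in vM *.
apply: (@le_trans _ _ (`|v| * `|v|)); first by rewrite ler_wpM2l.
by rewrite -expr2 real_normK ?num_real// lerDr.
Qed.

Lemma measurable_disc M : measurable_fun setT (disc M).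
Proof.
apply: measurable_fun_ifT => //.
  exact: measurable_fun_ltr.
apply: nondecreasing_measurable => // x y xy.
by rewrite ler_wpM2r ?invr_ge0// ler_int le_floor// ler_wpM2l.
Qed.

End Discretization.

Section Convolution.
Context {R : realType} {W : Type}.
Implicit Types (Av : (R -> R) -> R) (X G : W -> R) (Phi : (W -> R) -> R).

(** The counterpart of [avg], with an arbitrary one-dimensional mean of the coefficient of X in
    place of a sign. *)
Definition conv Av X : ((W -> R) -> R) -> (W -> R) -> R :=
  fun Phi G => Av (fun y => Phi (G + y *: X)).

Definition convs I (s : seq I) (Av : I -> (R -> R) -> R) (F : I -> W -> R) :
    ((W -> R) -> R) -> (W -> R) -> R :=
  foldr (fun i Q => conv (Av i) (F i) \o Q) id s.

End Convolution.

Section Independence.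
Context {R : realType} {d : measure_display} {T : measurableType d}.
Context (P : probability T R) (I : choiceType) (X : I -> {RV P >-> R}) (D : set I).
Hypothesis indep : mutually_independent D X.
Notation N := (@bounded_measurable R d T).
Let A : fun_algebra N := bounded_measurable_algebra.
Let mm := pmean_is_mean P.

Definition rv_indic (B : set R) i : T -> R := fun w => \1_B (X i w).

Lemma rv_indicE B i : rv_indic B i = \1_(X i @^-1` B).
Proof. by apply/funext => w; rewrite /rv_indic !indicE. Qed.

Lemma bounded_measurable_indic (B : set T) : measurable B -> N (\1_B).
Proof.
move=> mB; split; first exact: measurable_indic.
by exists 1 => w; rewrite indicE; case: (_ \in _); rewrite ?normr1 ?normr0.
Qed.

Lemma bounded_measurable_rv_indic B i : measurable B -> N (rv_indic B i).
Proof.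
move=> mB; rewrite rv_indicE; apply: bounded_measurable_indic.
exact: measurable_funPTI.
Qed.

Lemma pmean_indic (B : set T) : measurable B -> pmean P (\1_B) = fine (P B).
Proof. by move=> mB; rewrite /pmean expectation_indic. Qed.

Lemma bounded_measurable_prod J (s : seq J) (F : J -> T -> R) :
  (forall i, N (F i)) -> N (\prod_(i <- s) F i).
Proof.
move=> NF; elim: s => [|i s IH]; first by rewrite big_nil; exact: (fun_cst A 1).
by rewrite big_cons; exact: (fun_mul A).
Qed.

Lemma pmean_prod_indic (s : seq I) (B : I -> set R) : uniq s ->
  (forall i, i \in s -> D i) -> (forall i, measurable (B i)) ->
  pmean P (\prod_(i <- s) rv_indic (B i) i) = \prod_(i <- s) pmean P (rv_indic (B i) i).
Proof.
move=> us sD mB.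
have mpre i : measurable (X i @^-1` B i) by exact: measurable_funPTI.
have -> : \prod_(i <- s) rv_indic (B i) i =
    \1_(\bigcap_(i in [set` s]) (X i @^-1` B i)).
  apply/funext => w; rewrite indicE.
  elim: s {us sD} => [|i s IH].
    rewrite big_nil; have -> : w \in \bigcap_(i in [set` [::]]) (X i @^-1` B i) = true.
      by apply/mem_set => j.
    by [].
  rewrite big_cons !fctE IH /rv_indic indicE.
  have -> : (w \in \bigcap_(j in [set` (i :: s)]) (X j @^-1` B j)) =
      (X i w \in B i) && (w \in \bigcap_(j in [set` s]) (X j @^-1` B j)).
    apply/idP/andP => [/set_mem h|[/set_mem h1 /set_mem h2]].
      split; apply/mem_set; first by apply: h; rewrite /= mem_head.
      by move=> j js; apply: h; rewrite /= inE js orbT.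
    by apply/mem_set => j /=; rewrite inE => /orP[/eqP ->//|]; exact: h2.
  by rewrite -natrM mulnb.
pose J := [fset x in s]%fset.
have Js : [set` J] = [set` s].
  by apply/seteqP; split=> x /=; rewrite !inE.
rewrite pmean_indic; last first.
  rewrite -Js; apply: fin_bigcap_measurable => [|i _]; last exact: mpre.
  exact: finite_fset.
rewrite -Js indep; last 2 first.
- by rewrite Js => x /= xs; exact: sD.
- by move=> i _; exact: mB.
have pJ : perm_eq J s.
  by apply: uniq_perm => // x; rewrite !inE.
rewrite (perm_big _ pJ)/=.
elim: s {us sD J Js pJ} => [|i s IH]; first by rewrite !big_nil.
rewrite !big_cons fineM ?fin_num_measure//; last first.
  by apply: prode_fin_num => j _; exact: fin_num_measure.
by rewrite IH rv_indicE pmean_indic.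
Qed.

Definition disc_cell M c : set R := [set v | disc M v = c].

Lemma measurable_disc_cell M c : measurable (disc_cell M c).
Proof.
rewrite (_ : disc_cell M c = disc M @^-1` [set c])//.
by rewrite -[X in measurable X]setTI; exact: measurable_disc.
Qed.

Lemma disc_decomp M (v : R) (f : R -> R) :
  f (disc M v) = \sum_(c <- disc_range M) \1_(disc_cell M c) v * f c.
Proof.
have u : uniq (disc_range M : seq R) by exact: undup_uniq.
rewrite (bigD1_seq _ (disc_in_range M v) u)/= big1_seq ?addr0 => [|c /andP[cv _]].
  by rewrite indicE mem_set ?mul1r.
rewrite indicE memNset ?mul0r// => h; move: cv; rewrite -h eqxx.
by [].
Qed.

Lemma disc_rvE M i (H : R -> T -> R) :
  (fun w => H (disc M (X i w)) w) =
  \sum_(c <- disc_range M) rv_indic (disc_cell M c) i * H c.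
Proof.
apply/funext => w; rewrite fct_sumE.
exact: (disc_decomp M (X i w) (fun c => H c w)).
Qed.

Lemma bounded_measurable_disc_rv M i (f : R -> R) : N (fun w => f (disc M (X i w))).
Proof.
rewrite (disc_rvE M i (fun c _ => f c)); apply: (fun_sum A) => c.
apply: (fun_mul A); last exact: (fun_cst A).
by apply: bounded_measurable_rv_indic; exact: measurable_disc_cell.
Qed.

Lemma pmean_disc_rv M i (f : R -> R) : pmean P (fun w => f (disc M (X i w))) =
  \sum_(c <- disc_range M) pmean P (rv_indic (disc_cell M c) i) * f c.
Proof.
have Ni c := bounded_measurable_rv_indic i (measurable_disc_cell M c).
rewrite (disc_rvE M i (fun c _ => f c)) (mean_sum A mm) => [|c]; last first.
  by apply: (fun_mul A) => //; exact: (fun_cst A).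
apply: eq_bigr => c _; rewrite [RHS]mulrC -(meanZ A mm)//; congr pmean.
by apply/funext => w; rewrite !fctE/= /GRing.scale/= mulrC.
Qed.

Definition disc_mean M i : (R -> R) -> R := fun f => pmean P (fun w => f (disc M (X i w))).

Lemma disc_mean_is_mean M i : is_mean setT (disc_mean M i).
Proof.
split=> [a f g _ _|f g _ _ fg|].
- by rewrite -[RHS](mean_lin mm)//; exact: bounded_measurable_disc_rv.
- by apply: (mean_le mm) => [||w]; try exact: bounded_measurable_disc_rv.
- exact: (mean_cst1 mm).
Qed.

(** Conditioning on one variable at a time: fixing the cell of [X a] replaces a value by an
    indicator, so a moves from the list s to the list s2. When s is exhausted only the independence
    of events is left. The finite range also makes f measurable for an arbitrary functional Phi. *)
Lemma pmean_functional W (F : I -> W -> R) Phi M (s s2 : seq I) (B : I -> set R) G :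
  uniq (s ++ s2) -> (forall i, i \in s ++ s2 -> D i) -> (forall i, measurable (B i)) ->
  let f := fun w => Phi (G + \sum_(i <- s) disc M (X i w) *: F i) in
  N f /\
  pmean P (f * \prod_(i <- s2) rv_indic (B i) i) =
  convs s (disc_mean M) F Phi G * \prod_(i <- s2) pmean P (rv_indic (B i) i).
Proof.
elim: s s2 B G => [|a s IH] s2 B G us sD mB f.
  have fE : f = cst (Phi G).
    by apply/funext => w; rewrite /f big_nil addr0.
  rewrite fE; split; first exact: (fun_cst A).
  by rewrite -pmean_prod_indic// -(meanZ A mm)//; apply: bounded_measurable_prod => i;
    exact: bounded_measurable_rv_indic.
have Ni c := bounded_measurable_rv_indic a (measurable_disc_cell M c).
pose H c := fun w => Phi (G + c *: F a + \sum_(i <- s) disc M (X i w) *: F i).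
pose B' c i := if i == a then disc_cell M c else B i.
have mB' c i : measurable (B' c i).
  by rewrite /B'; case: ifP => _ //; exact: measurable_disc_cell.
have us' : uniq (s ++ a :: s2).
  by rewrite -cat_rcons -cats1 -catA uniq_catCA.
have sD' i : i \in s ++ a :: s2 -> D i.
  by move=> h; apply: sD; move: h; rewrite /= !(inE, mem_cat) orbCA.
have as2 : a \notin s2.
  by move: us; rewrite /= mem_cat negb_or => /andP[/andP[]].
have h c : N (H c) /\ pmean P (H c * (rv_indic (disc_cell M c) a *
    \prod_(i <- s2) rv_indic (B i) i)) = convs s (disc_mean M) F Phi (G + c *: F a) *
    (pmean P (rv_indic (disc_cell M c) a) * \prod_(i <- s2) pmean P (rv_indic (B i) i)).
  have [NH] := IH (a :: s2) (B' c) (G + c *: F a) us' sD' (mB' c).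
  rewrite -/(H c) !big_cons {1 3}/B' eqxx => e; split=> //.
  have e1 : \prod_(j <- s2) rv_indic (B' c j) j = \prod_(j <- s2) rv_indic (B j) j.
    apply: eq_big_seq => j js; rewrite /B'; case: eqP => // ja.
    by move: as2; rewrite -ja js.
  have e2 : \prod_(j <- s2) pmean P (rv_indic (B' c j) j) =
      \prod_(j <- s2) pmean P (rv_indic (B j) j).
    apply: eq_big_seq => j js; rewrite /B'; case: eqP => // ja.
    by move: as2; rewrite -ja js.
  by rewrite -e1 -e2.
have fE : f = \sum_(c <- disc_range M) rv_indic (disc_cell M c) a * H c.
  rewrite -(disc_rvE M a H); apply/funext => w.
  by rewrite /f /H big_cons addrA.
have NH c : N (H c) by have [] := h c.
split.
  by rewrite fE; apply: (fun_sum A) => c; apply: (fun_mul A).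
have Np : N (\prod_(i <- s2) rv_indic (B i) i).
  by apply: bounded_measurable_prod => i; exact: bounded_measurable_rv_indic.
rewrite fE mulr_suml (mean_sum A mm) => [|c]; last first.
  by apply: (fun_mul A) => //; apply: (fun_mul A).
have -> : convs (a :: s) (disc_mean M) F Phi G = _ :=
  pmean_disc_rv M a (fun y => convs s (disc_mean M) F Phi (G + y *: F a)).
rewrite mulr_suml; apply: eq_bigr => c _.
have [_ e] := h c.
have -> : rv_indic (disc_cell M c) a * H c * \prod_(i <- s2) rv_indic (B i) i =
  H c * (rv_indic (disc_cell M c) a * \prod_(i <- s2) rv_indic (B i) i).
  by apply/funext => w; rewrite !fctE/= mulrCA mulrA.
by rewrite e mulrCA mulrA.
Qed.

Lemma pmean_functional_convs W (F : I -> W -> R) Phi M (s : seq I) G :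
  uniq s -> (forall i, i \in s -> D i) ->
  let f := fun w => Phi (G + \sum_(i <- s) disc M (X i w) *: F i) in
  N f /\ pmean P f = convs s (disc_mean M) F Phi G.
Proof.
move=> us sD /=.
have := @pmean_functional W F Phi M s [::] (fun=> setT) G.
rewrite cats0 => /(_ us sD (fun=> measurableT))[Nf].
by rewrite !big_nil !mulr1.
Qed.

(** The identity passes from indicators to simple functions by linearity and to f by rounding its
    values, with an error of order 1/M. *)
Lemma pmean_factor i (f : R -> R) (G : T -> R) (c C : R) :
  measurable_fun setT f -> (forall w, `|f (X i w)| <= C) -> N G ->
  (forall B, measurable B -> pmean P (rv_indic B i * G) = pmean P (rv_indic B i) * c) ->
  pmean P ((fun w => f (X i w)) * G) = pmean P (fun w => f (X i w)) * c.
Proof.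
move=> mf fC NG h; have [K hK] := fun_bnd A NG.
have Nf : N (fun w => f (X i w)).
  by split; [exact: measurableT_comp | exists C].
apply: (@eq_of_invn_bound _ _ _ ((1 + C ^+ 2) * (K + `|c|))) => M M0.
pose g := fun w => disc M (f (X i w)).
have cellm v : measurable (f @^-1` disc_cell M v).
  by rewrite -[X in measurable X]setTI; apply: mf => //; exact: measurable_disc_cell.
have Ni v := bounded_measurable_rv_indic i (cellm v).
have gE : g = \sum_(v <- disc_range M) v *: rv_indic (f @^-1` disc_cell M v) i.
  apply/funext => w; rewrite fct_sumE /g (disc_decomp M _ id).
  by apply: eq_bigr => v _; rewrite mulrC.
have Ng : N g by rewrite gE; apply: (fun_sum A) => v; apply: (fun_scale A).
have gh : pmean P (g * G) = pmean P g * c.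
  rewrite gE mulr_suml !(mean_sum A mm); last 2 first.
  - by move=> v; apply: (fun_scale A).
  - by move=> v; apply: (fun_mul A) => //; apply: (fun_scale A).
  rewrite mulr_suml; apply: eq_bigr => v _.
  have -> : v *: rv_indic (f @^-1` disc_cell M v) i * G =
      v *: (rv_indic (f @^-1` disc_cell M v) i * G).
    by apply/funext => w; rewrite !fctE/= /GRing.scale/= mulrA.
  by rewrite (meanZ A mm _ (fun_mul A (Ni v) NG)) (meanZ A mm _ (Ni v)) h// mulrA.
have fg w : `|f (X i w) - g w| <= (1 + C ^+ 2) / M%:R.
  apply: le_trans (disc_near _ M0) _; rewrite ler_wpM2r ?invr_ge0//.
  rewrite lerD2l -real_normK ?num_real// lerXn2r ?nnegrE//.
  exact: (le_trans (normr_ge0 _) (fC w)).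
have e1 : `|pmean P ((fun w => f (X i w)) * G) - pmean P (g * G)| <=
    (1 + C ^+ 2) / M%:R * K.
  rewrite -(meanB A mm); [|exact: (fun_mul A)|exact: (fun_mul A)].
  apply: (mean_norm_le A mm) => [|w]; first by nice A; exact: (fun_mul A).
  rewrite -mulrBl normrM; apply: ler_pM => //; exact: fg.
have e2 : `|pmean P (fun w => f (X i w)) * c - pmean P g * c| <=
    (1 + C ^+ 2) / M%:R * `|c|.
  rewrite -mulrBl normrM ler_wpM2r// -(meanB A mm)//.
  by apply: (mean_norm_le A mm) => [|w]; [nice A | exact: fg].
move: e1 e2; rewrite gh mulrAC [_ / M%:R * `|c|]mulrAC mulrDr mulrDl !ler_norml; lra.
Qed.

(** The same scheme as in [pmean_functional]: factors are turned one by one into indicators, here by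
    [pmean_factor]. *)
Lemma pmean_prod (f : I -> R -> R) (C : I -> R) (s : seq I) : uniq s ->
  (forall i, i \in s -> D i) -> (forall i, measurable_fun setT (f i)) ->
  (forall i w, `|f i (X i w)| <= C i) ->
  pmean P (\prod_(i <- s) (fun w => f i (X i w))) =
  \prod_(i <- s) pmean P (fun w => f i (X i w)).
Proof.
move=> us sD mf fC.
have Nf i : N (fun w => f i (X i w)).
  by split; [exact: measurableT_comp | exists (C i)].
suff : forall s2 B, uniq (s ++ s2) -> (forall i, i \in s ++ s2 -> D i) ->
    (forall i, measurable (B i)) ->
    pmean P (\prod_(i <- s) (fun w => f i (X i w)) * \prod_(i <- s2) rv_indic (B i) i) =
    \prod_(i <- s) pmean P (fun w => f i (X i w)) *
    \prod_(i <- s2) pmean P (rv_indic (B i) i).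
  move=> /(_ [::] (fun=> setT)); rewrite cats0 !big_nil !mulr1.
  by apply => // i; exact: measurableT.
elim: s {us sD} => [|a s IH] s2 B us sD mB.
  by rewrite !big_nil !mul1r pmean_prod_indic.
have us' : uniq (s ++ a :: s2) by rewrite -cat_rcons -cats1 -catA uniq_catCA.
have sD' i : i \in s ++ a :: s2 -> D i.
  by move=> h; apply: sD; move: h; rewrite /= !(inE, mem_cat) orbCA.
have as2 : a \notin s2.
  by move: us; rewrite /= mem_cat negb_or => /andP[/andP[]].
have Np : N (\prod_(i <- s2) rv_indic (B i) i).
  by apply: bounded_measurable_prod => i; exact: bounded_measurable_rv_indic.
have NF : N (\prod_(i <- s) (fun w => f i (X i w))) by exact: bounded_measurable_prod.
rewrite !big_cons -!mulrA; apply: (pmean_factor (C := C a)) => //.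
  exact: (fun_mul A).
move=> B0 mB0; pose B' i := if i == a then B0 else B i.
have mB' i : measurable (B' i) by rewrite /B'; case: ifP.
have := IH (a :: s2) B' us' sD' mB'; rewrite !big_cons {1 3}/B' eqxx.
have -> : \prod_(j <- s2) rv_indic (B' j) j = \prod_(j <- s2) rv_indic (B j) j.
  apply: eq_big_seq => j js; rewrite /B'; case: eqP => // ja.
  by move: as2; rewrite -ja js.
have -> : \prod_(j <- s2) pmean P (rv_indic (B' j) j) =
    \prod_(j <- s2) pmean P (rv_indic (B j) j).
  apply: eq_big_seq => j js; rewrite /B'; case: eqP => // ja.
  by move: as2; rewrite -ja js.
by rewrite mulrCA => ->; rewrite mulrCA.
Qed.

End Independence.

(** * Gaussian means and the central limit theorem *)

Section NormalIntegral.
Context {R : realType}.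
Notation mu := (@lebesgue_measure R).
Local Open Scope ereal_scope.

(** The Radon-Nikodym derivative and the density have the same integrals over all measurable sets,
    hence agree almost everywhere. *)
Lemma ge0_integral_normal_prob (m s : R) (f : R -> \bar R) :
  measurable_fun setT f -> (forall x, 0 <= f x) ->
  \int[normal_prob m s]_x f x = \int[mu]_x (f x * (normal_pdf m s x)%:E).
Proof.
move=> mf f0.
have dom := @normal_prob_dominates R m s.
rewrite -(Radon_Nikodym_SigmaFinite.change_of_variables dom)//.
have gi := Radon_Nikodym_SigmaFinite.f_integrable dom.
have mpdf : measurable_fun setT (EFin \o normal_pdf m s).
  by apply/measurable_EFinP; exact: measurable_normal_pdf.
apply: ae_eq_integral => //.
- by apply: emeasurable_funM => //; exact: (measurable_int mu).
- exact: emeasurable_funM.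
- apply: ae_eqe_mul2l; apply: integral_ae_eq => //.
  by move=> A _ mA; rewrite -(Radon_Nikodym_SigmaFinite.f_integral dom).
Qed.

(** Completing the square turns exp(a x) times the standard density into exp(a^2/2) times the
    density centred at a. *)
Lemma normal_mgf (a : R) :
  \int[normal_prob 0 1]_x (expR (a * x))%:E = (expR (a ^+ 2 / 2))%:E.
Proof.
rewrite ge0_integral_normal_prob; last 2 first.
- apply/measurable_EFinP; exact: measurableT_comp.
- by move=> x; rewrite lee_fin expR_ge0.
transitivity (\int[mu]_x ((expR (a ^+ 2 / 2))%:E * (normal_pdf a 1 x)%:E)).
  apply: eq_integral => x _; rewrite -!EFinM; congr EFin.
  rewrite !normal_pdfE ?oner_neq0// mulrCA [RHS]mulrCA; congr (_ * _)%R.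
  rewrite /normal_fun -!expRD; congr expR; by field.
rewrite ge0_integralZl; [|by []|by apply/measurable_EFinP; exact: measurable_normal_pdf
  |by move=> x _; rewrite lee_fin normal_pdf_ge0|by rewrite lee_fin expR_ge0].
by rewrite integral_normal_pdf mule1.
Qed.

Lemma normal_affine (m b : R) (f : R -> R) : (0 < b)%R -> continuous f ->
  (forall x, 0 <= f x)%R ->
  \int[normal_prob 0 1]_y (f (m + b * y)%R)%:E = \int[normal_prob m b]_u (f u)%:E.
Proof.
move=> b0 cf f0.
have bN : b != 0%R by rewrite gt_eqF.
have caff : continuous (fun y : R => m + b * y)%R.
  by move=> y; apply: continuousD; [exact: cst_continuous|exact: mulrl_continuous].
have cfb : continuous (fun y => f (m + b * y)%R).
  by move=> y; apply: continuous_comp; [exact: caff|exact: cf].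
rewrite !ge0_integral_normal_prob; last 4 first.
- by apply/measurable_EFinP; exact: continuous_measurable_fun.
- by move=> x; rewrite lee_fin.
- by apply/measurable_EFinP; exact: continuous_measurable_fun.
- by move=> x; rewrite lee_fin.
pose G y := (f (m + b * y) * normal_pdf 0 1 y)%R.
pose F (u : R^o) : R^o := ((u - m) / b)%R.
have F'E : F^`()%classic = cst b^-1%R.
  apply/funext => x; rewrite /F derive1E deriveM// deriveD// derive_cst scaler0.
  by rewrite add0r derive_id derive_cst addr0 scaler1.
transitivity (\int[mu]_x (G x)%:E); first by apply: eq_integral => x _; rewrite EFinM.
rewrite (increasing_ge0_integration_by_substitutionT (F := F)).
- apply: eq_integral => u _; rewrite F'E !fctE/= -EFinM; congr EFin.
  rewrite /G /F [(b * _)%R]mulrC divfK// addrC subrK -mulrA; congr (_ * _)%R.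
  rewrite !normal_pdfE ?oner_neq0// /normal_peak /normal_fun.
  rewrite mulrAC -[RHS]mulrC -[LHS]mulrC; congr (expR _ * _)%R.
    by rewrite subr0 exprMn exprVn; field.
  rewrite -invfM; congr (_^-1)%R.
  rewrite expr1n mul1r -[in RHS]mulrnAr.
  by rewrite sqrtrM ?sqr_ge0// sqrtr_sqr gtr0_norm// mulrC.
- by move=> x y xy; rewrite /F ltr_pM2r ?invr_gt0// ltrD2r.
- by rewrite F'E => ?; exact: cvg_cst.
- by rewrite F'E; exact: is_cvg_cst.
- by rewrite F'E; exact: is_cvg_cst.
- by [].
- apply/gt0_cvgMlNy; last exact: cvg_addrr_Ny.
  by rewrite invr_gt0.
- apply/gt0_cvgMly; last exact: cvg_addrr.
  by rewrite invr_gt0.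
- move=> x; apply: continuousM; first exact: cfb.
  by apply: continuous_normal_pdf; rewrite oner_neq0.
- by move=> x; rewrite /G mulr_ge0// normal_pdf_ge0.
Qed.

(** The joint density p of x and u = a x + b y is symmetric in its arguments, since a^2 + b^2 = 1.
    After Tonelli the roles are swapped, and integrating x out leaves the standard density of u. *)
Lemma normal_convolution (a b : R) (f : R -> R) : (0 < b)%R -> (a ^+ 2 + b ^+ 2 = 1)%R ->
  continuous f -> (forall x, 0 <= f x)%R ->
  \int[normal_prob 0 1]_x \int[normal_prob 0 1]_y (f (a * x + b * y)%R)%:E =
  \int[normal_prob 0 1]_u (f u)%:E.
Proof.
move=> b0 ab cf f0; have bN : b != 0%R by rewrite gt_eqF.
have mf : measurable_fun setT (fun x => (f x)%:E).
  by apply/measurable_EFinP; exact: continuous_measurable_fun.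
pose p (x u : R) : R := (normal_pdf 0 1 x * normal_pdf (a * x) b u)%R.
have psym x u : (p x u = p u x)%R.
  rewrite /p !normal_pdfE ?oner_neq0// mulrACA [RHS]mulrACA; congr (_ * _)%R.
  rewrite /normal_fun -!expRD; congr expR.
  have b2 : (b ^+ 2 = 1 - a ^+ 2)%R by rewrite -ab addrAC subrr add0r.
  have b2N : (1 - a ^+ 2 != 0)%R by rewrite -b2 expf_neq0.
  by rewrite b2; field.
have mp : measurable_fun setT (fun z : R * R => p z.1 z.2).
  apply: measurable_funM.
    apply: measurableT_comp => //; exact: measurable_normal_pdf.
  rewrite (_ : (fun z => _) = fun z : R * R =>
     (normal_peak b * expR (- (z.2 - a * z.1) ^+ 2 / (b ^+ 2 *+ 2)))%R); last first.
    by apply/funext => z; rewrite normal_pdfE.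
  apply: measurable_funM => //; apply: measurableT_comp => //.
  apply: measurable_funM => //; apply: measurableT_comp => //.
  apply: measurable_funX; apply: measurable_funB => //; exact: measurable_funM.
have p0 x u : (0 <= p x u)%R by rewrite mulr_ge0// normal_pdf_ge0.
pose h (z : R * R) : \bar R := (f z.2)%:E * (p z.1 z.2)%:E.
have mh : measurable_fun setT h.
  apply: emeasurable_funM; last exact/measurable_EFinP.
  exact: (measurableT_comp mf measurable_snd).
have h0 z : 0 <= h z by rewrite mule_ge0// lee_fin.
transitivity (\int[mu]_x \int[mu]_u h (x, u)).
  rewrite ge0_integral_normal_prob; last 2 first.
  - have mi := @measurable_fun_fubini_tonelli_F _ _ (measurableTypeR R) (measurableTypeR R) R
      (normal_prob 0 1)
      (fun z => (f (a * z.1 + b * z.2)%R)%:E).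
    apply: mi => [|z]; last by rewrite lee_fin.
    apply: (measurableT_comp mf); apply: measurable_funD; exact: measurable_funM.
  - by move=> x; apply: integral_ge0 => y _; rewrite lee_fin.
  apply: eq_integral => x _; rewrite normal_affine// ge0_integral_normal_prob//.
  rewrite -ge0_integralZr//; last 3 first.
  - apply: emeasurable_funM => //; apply/measurable_EFinP; exact: measurable_normal_pdf.
  - by move=> u _; rewrite mule_ge0// lee_fin// normal_pdf_ge0.
  - by rewrite lee_fin normal_pdf_ge0.
  by apply: eq_integral => u _; rewrite /h /p EFinM -muleA [(_%:E * (normal_pdf 0 1 x)%:E)%E]muleC.
transitivity (\int[mu]_u \int[mu]_x h (x, u)).
  exact: (@fubini_tonelli _ _ (measurableTypeR R) (measurableTypeR R) R mu mu h mh h0).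
rewrite [RHS]ge0_integral_normal_prob//.
apply: eq_integral => u _.
under eq_integral do rewrite /h/= psym /p EFinM muleA.
rewrite ge0_integralZl; [by rewrite integral_normal_pdf mule1|by []|
  by apply/measurable_EFinP; exact: measurable_normal_pdf|
  by move=> x _; rewrite lee_fin normal_pdf_ge0|
  by rewrite mule_ge0// lee_fin// normal_pdf_ge0].
Qed.

End NormalIntegral.

Section GaussianMean.
Context {R : realType}.
Implicit Types (f g : R -> R) (a c x y : R).
Let gamma := @normal_prob R 0 1.
Notation gm := (@gaussian_mean R).

(** This is 2 cosh(2 x), a majorant of exp(2 |x|) whose Gaussian integral is known from
    [normal_mgf]. *)
Definition cosh2 x : R := expR (2 * x) + expR (- 2 * x).

Lemma expR_norm_cosh2 x : expR (2 * `|x|) <= cosh2 x.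
Proof.
rewrite /cosh2; have [x0|x0] := leP 0 x.
  by rewrite ger0_norm// lerDl expR_ge0.
by rewrite ltr0_norm// mulrN -mulNr lerDr expR_ge0.
Qed.

Lemma cosh2_ge1 x : 1 <= cosh2 x.
Proof.
apply: le_trans (expR_norm_cosh2 x); rewrite -expR0 ler_expR.
by rewrite mulr_ge0.
Qed.

Lemma normr_expr_le k x : `|x| ^+ k <= k`!%:R * expR `|x|.
Proof.
case: k => [|k]; first by rewrite expr0 fact0 mul1r expR_normr_ge1.
have := expR_ge1Dxn k (normr_ge0 x).
rewrite -ler_pdivrMl ?ltr0n ?fact_gt0// mulrC => h.
by apply: le_trans h; rewrite lerDr.
Qed.

Lemma normr_expr_cosh2 k x : `|x| ^+ k <= k`!%:R * cosh2 x.
Proof.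
apply: le_trans (normr_expr_le k x) _; rewrite ler_wpM2l//.
apply: le_trans (expR_norm_cosh2 x); rewrite ler_expR.
by rewrite ler_peMl// ler1n.
Qed.

Lemma normr_expr_expR_cosh2 k x : `|x| ^+ k * expR `|x| <= k`!%:R * cosh2 x.
Proof.
apply: (@le_trans _ _ (k`!%:R * expR `|x| * expR `|x|)).
  by rewrite ler_wpM2r ?expR_ge0// normr_expr_le.
rewrite -mulrA -expRD ler_wpM2l//.
by apply: le_trans (expR_norm_cosh2 x); rewrite ler_expR mulr_natl.
Qed.

Definition subexponential : set (R -> R) :=
  [set f : R -> R | measurable_fun setT f /\ exists C : R, forall x, `|f x| <= C * cosh2 x].

Lemma integrable_expRM a : gamma.-integrable setT (fun x => (expR (a * x))%:E).
Proof.
apply/integrableP; split.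
  by apply/measurable_EFinP; exact: measurableT_comp.
under eq_integral do rewrite gee0_abs ?lee_fin ?expR_ge0//.
by rewrite normal_mgf ltry.
Qed.

Lemma integrable_cosh2 : gamma.-integrable setT (EFin \o cosh2).
Proof.
have := integrableD measurableT (integrable_expRM 2) (integrable_expRM (- 2)).
by apply: eq_integrable => // x _.
Qed.

Lemma subexponential_integrable f : subexponential f ->
  gamma.-integrable setT (EFin \o f).
Proof.
move=> [mf [C hC]].
have ic : gamma.-integrable setT (fun x => (C%:E * (cosh2 x)%:E)%E).
  exact: (integrableZl measurableT C integrable_cosh2).
apply: le_integrable ic => //; first exact/measurable_EFinP.
move=> x _; rewrite lee_fin /=; apply: le_trans (hC x) (ler_norm _).
Qed.

Lemma gaussian_meanE f : gm f = \int[gamma]_x f x.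
Proof. by rewrite /gaussian_mean unlock. Qed.

Lemma subexponentialD f g : subexponential f -> subexponential g -> subexponential (f + g).
Proof.
move=> [mf [C hC]] [mg [C' hC']]; split; first exact: measurable_funD.
exists (C + C') => x; rewrite mulrDl; apply: le_trans (ler_normD _ _) _.
exact: lerD.
Qed.

Lemma subexponentialZ c f : subexponential f -> subexponential (c *: f).
Proof.
move=> [mf [C hC]]; split; first exact: measurable_funM.
exists (`|c| * C) => x; rewrite fctE/= normrM -mulrA; exact: ler_wpM2l.
Qed.

Lemma subexponential_cst c : subexponential (cst c).
Proof.
split; first exact: measurable_cst.
by exists `|c| => x; rewrite ler_peMr// cosh2_ge1.
Qed.

Lemma subexponentialX k : subexponential (fun x => x ^+ k).
Proof.
split; first exact: measurable_funX.
by exists k`!%:R => x; rewrite normrX normr_expr_cosh2.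
Qed.

Lemma subexponential_normX k : subexponential (fun x => `|x| ^+ k).
Proof.
split; first by apply: measurable_funX; exact: normr_measurable.
by exists k`!%:R => x; rewrite ger0_norm ?exprn_ge0// normr_expr_cosh2.
Qed.

Lemma gaussian_mean_is_mean : is_mean subexponential gm.
Proof.
split=> [a f g Nf Ng|f g Nf Ng fg|].
- rewrite !gaussian_meanE RintegralD//; try exact: subexponential_integrable.
    by rewrite RintegralZl//; exact: subexponential_integrable.
  by apply: subexponential_integrable; exact: subexponentialZ.
- by rewrite !gaussian_meanE le_Rintegral//; exact: subexponential_integrable.
- by rewrite /gaussian_mean expectation_cst.
Qed.

Let gmm := gaussian_mean_is_mean.

Lemma gaussian_meanD f g : subexponential f -> subexponential g ->
  gm (f + g) = gm f + gm g.
Proof. exact: meanD. Qed.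

Lemma gaussian_mean_cst c : gm (cst c) = c.
Proof. by rewrite /gaussian_mean expectation_cst. Qed.

Lemma gaussian_meanZ c f : subexponential f -> gm (c *: f) = c * gm f.
Proof.
move=> Nf; have := mean_lin gmm c Nf (subexponential_cst 0).
by rewrite gaussian_mean_cst !addr0.
Qed.

Lemma gaussian_meanB f g : subexponential f -> subexponential g ->
  gm (f - g) = gm f - gm g.
Proof.
move=> Nf Ng; rewrite -[- g]scaleN1r gaussian_meanD ?gaussian_meanZ ?mulN1r//.
exact: subexponentialZ.
Qed.

Lemma gaussian_mean_near f g h : subexponential f -> subexponential g ->
  subexponential h -> (forall x, `|f x - g x| <= h x) -> `|gm f - gm g| <= gm h.
Proof.
move=> Nf Ng Nh fgh; rewrite -gaussian_meanB//.
have Nfg : subexponential (f - g).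
  by rewrite -[- g]scaleN1r; apply: subexponentialD => //; exact: subexponentialZ.
rewrite ler_norml; apply/andP; split.
  rewrite -mulN1r -gaussian_meanZ//; apply: (mean_le gmm) => //.
    exact: subexponentialZ.
  by move=> x; rewrite !fctE/= /GRing.scale/=; have := fgh x; rewrite ler_norml mulN1r => /andP[].
by apply: (mean_le gmm) => // x; have := fgh x; rewrite ler_norml => /andP[].
Qed.

Lemma subexponential_le f g : measurable_fun setT f -> subexponential g ->
  (forall x, `|f x| <= g x) -> subexponential f.
Proof.
move=> mf [_ [C hC]] fg; split=> //; exists C => x.
exact: le_trans (fg x) (le_trans (ler_norm _) (hC x)).
Qed.

Lemma subexponential_cosh2 : subexponential cosh2.
Proof.
split; last by exists 1 => x; rewrite mul1r ger0_norm// (le_trans ler01 (cosh2_ge1 x)).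
by apply: measurable_funD; exact: measurableT_comp.
Qed.

Lemma subexponential_expRM a : `|a| <= 1 -> subexponential (fun x => expR (a * x)).
Proof.
move=> a1; apply: (subexponential_le _ subexponential_cosh2) => [|x].
  exact: measurableT_comp.
rewrite ger0_norm ?expR_ge0//; apply: le_trans (expR_norm_cosh2 x).
rewrite ler_expR; apply: le_trans (ler_norm _) _; rewrite normrM.
by rewrite ler_wpM2r// (le_trans a1)// ler1n.
Qed.

(** Both moments are read off from the generating function: expanding exp(a x) and exp(a^2/2) to
    second order gives a m1 + a^2 (m2 - 1)/2 = O(a^3), and a = 1/M with M large isolates first m1
    and then m2. *)
Lemma gaussian_moments : gm id = 0 /\ gm (fun x => x ^+ 2) = 1.
Proof.
set m1 := gm id; set m2 := gm _.
pose k := gm (6 *: cosh2).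
have N1 : subexponential id by exact: (subexponentialX 1).
have N2 := subexponentialX 2.
have key a : 0 <= a <= 1 -> `|a * m1 + a ^+ 2 * (m2 - 1) / 2| <= (k + 1) * a ^+ 3.
  move=> /andP[a0 a1].
  have Ne : subexponential (fun x => expR (a * x)).
    by apply: subexponential_expRM; rewrite ger0_norm.
  pose p := cst 1 + a *: (id : R -> R) + (a ^+ 2 / 2) *: (fun x => x ^+ 2).
  have Np : subexponential p.
    apply: subexponentialD; last exact: subexponentialZ.
    by apply: subexponentialD; [exact: subexponential_cst|exact: subexponentialZ].
  have Nk : subexponential (a ^+ 3 *: (6 *: cosh2)).
    by do 2 apply: subexponentialZ; exact: subexponential_cosh2.
  have : `|gm (fun x => expR (a * x)) - gm p| <= a ^+ 3 * k.
    rewrite -gaussian_meanZ; last by apply: subexponentialZ; exact: subexponential_cosh2.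
    apply: gaussian_mean_near => // x.
    rewrite /p !fctE/= /GRing.scale/=.
    have -> : expR (a * x) - (1 + a * x + a ^+ 2 / 2 * x ^+ 2) =
       expR (a * x) - 1 - a * x - (a * x) ^+ 2 / 2 by rewrite exprMn; ring.
    apply: le_trans (expR_taylor3 _) _.
    rewrite normrM ger0_norm// exprMn -mulrA ler_wpM2l ?exprn_ge0//.
    apply: le_trans (normr_expr_expR_cosh2 3 x).
    by rewrite ler_wpM2l ?exprn_ge0// ler_expR ler_piMl.
  have -> : gm (fun x => expR (a * x)) = expR (a ^+ 2 / 2).
    by rewrite gaussian_meanE /Rintegral normal_mgf.
  have -> : gm p = 1 + a * m1 + a ^+ 2 / 2 * m2.
    rewrite /p gaussian_meanD; [|by apply: subexponentialD;
      [exact: subexponential_cst|exact: subexponentialZ]|exact: subexponentialZ].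
    rewrite gaussian_meanD; [|exact: subexponential_cst|exact: subexponentialZ].
    by rewrite gaussian_mean_cst !gaussian_meanZ.
  have a3 : a ^+ 4 <= a ^+ 3 by rewrite (exprS a 3) ler_piMl ?exprn_ge0.
  have : `|expR (a ^+ 2 / 2) - 1 - a ^+ 2 / 2| <= a ^+ 4.
    apply: le_trans (expR_taylor2 _) _.
    have a2 : 0 <= a ^+ 2 <= 1 by rewrite sqr_ge0 exprn_ile1.
    have -> : `|a ^+ 2 / 2| = a ^+ 2 / 2 by rewrite ger0_norm// divr_ge0//; case/andP: a2.
    have e4 : expR (a ^+ 2 / 2) <= 4.
      by apply: le_trans expR1_le4; rewrite ler_expR; lra.
    have -> : a ^+ 4 = (a ^+ 2 / 2) ^+ 2 * 4 by field.
    by rewrite ler_wpM2l// sqr_ge0.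
  have e1 : a ^+ 3 * k = k * a ^+ 3 by rewrite mulrC.
  move: a3; rewrite !ler_norml mulrDl mul1r e1.
  have -> : a ^+ 2 / 2 * m2 = a ^+ 2 * m2 / 2 by ring.
  have -> : a ^+ 2 * (m2 - 1) / 2 = a ^+ 2 * m2 / 2 - a ^+ 2 / 2 by ring.
  lra.
have k0 : 0 <= k.
  rewrite -[0]gaussian_mean_cst; apply: (mean_le gmm).
  - exact: subexponential_cst.
  - by apply: subexponentialZ; exact: subexponential_cosh2.
  - by move=> x; rewrite fctE/= mulr_ge0// (le_trans ler01 (cosh2_ge1 x)).
have inv01 M : (0 < M)%N -> 0 <= (M%:R^-1 : R) <= 1.
  by move=> M0; rewrite invr_ge0 ler0n/= invf_le1 ?ler1n ?ltr0n.
have m10 : m1 = 0.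
  apply: (@eq_of_invn_bound _ _ _ (`|m2 - 1| + k + 1)) => M M0.
  have /andP[a0 a1] := inv01 M M0; have := key _ (inv01 M M0).
  rewrite subr0; set a : R := M%:R^-1 in a0 a1 *.
  have ap : 0 < a by rewrite /a invr_gt0 ltr0n.
  have -> : a * m1 + a ^+ 2 * (m2 - 1) / 2 = a * (m1 + a * (m2 - 1) / 2) by ring.
  rewrite normrM gtr0_norm// (exprS a 2) mulrCA ler_pM2l// => h.
  have -> : m1 = (m1 + a * (m2 - 1) / 2) - a * (m2 - 1) / 2 by rewrite addrK.
  apply: le_trans (ler_normB _ _) _.
  have h2 : `|a * (m2 - 1) / 2| <= a * `|m2 - 1|.
    rewrite !normrM (gtr0_norm ap) ler_piMr ?mulr_ge0//.
    by rewrite ger0_norm ?invr_ge0// invf_le1// ler1n.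
  have h3 : (k + 1) * a ^+ 2 <= (k + 1) * a.
    by rewrite ler_wpM2l ?addr_ge0// expr2 ler_piMl.
  have -> : (`|m2 - 1| + k + 1) / M%:R = a * `|m2 - 1| + (k + 1) * a by rewrite /a; ring.
  rewrite addrC; apply: lerD => //; exact: le_trans h h3.
split=> //; apply: (@eq_of_invn_bound _ _ _ (2 * (k + 1))) => M M0.
have /andP[a0 a1] := inv01 M M0; have := key _ (inv01 M M0).
set a : R := M%:R^-1 in a0 a1 *; rewrite m10 mulr0 add0r.
have ap : 0 < a by rewrite /a invr_gt0 ltr0n.
have a2 : 0 < a ^+ 2 by rewrite exprn_gt0.
have -> : a ^+ 2 * (m2 - 1) / 2 = a ^+ 2 * ((m2 - 1) / 2) by ring.
have -> : (k + 1) * a ^+ 3 = a ^+ 2 * ((k + 1) * a) by ring.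
rewrite normrM (gtr0_norm a2) ler_pM2l// -/a !ler_norml; lra.
Qed.

End GaussianMean.

(** * Random walks and the heat semigroup *)

Section CentralLimit.
Context {R : realType}.
Notation gm := (@gaussian_mean R).
Let gmm := @gaussian_mean_is_mean R.

Definition walk_step (r : R) (f : R -> R) : R -> R := fun x => (f (x + r) + f (x - r)) / 2.

Definition heat (s : R) (f : R -> R) : R -> R := fun x => gm (fun g => f (x + s * g)).

Lemma walk_step_near r f g e : (forall x, `|f x - g x| <= e) ->
  forall x, `|walk_step r f x - walk_step r g x| <= e.
Proof.
move=> h x; have := h (x + r); have := h (x - r).
by rewrite /walk_step !ler_norml; lra.
Qed.

Lemma lipschitz_continuous (f : R -> R) (C : R) :
  (forall x y, `|f x - f y| <= C * `|x - y|) -> continuous f.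
Proof.
move=> h x; have C0 : 0 <= C.
  have := h 1 0; rewrite subr0 normr1 mulr1; exact: le_trans.
apply/cvgrPdist_le => e e0; near=> y.
apply: le_trans (h x y) _; have xy : `|x - y| <= e / (C + 1).
  near: y; apply: cvgr_dist_le; first exact: cvg_id.
  by rewrite divr_gt0// ltr_wpDl.
apply: (@le_trans _ _ ((C + 1) * (e / (C + 1)))).
  by apply: ler_pM => //; rewrite lerDl.
by rewrite mulrCA divff ?mulr1// gt_eqF// ltr_wpDl.
Unshelve. all: by end_near. Qed.

Section Lipschitz.
Context (f : R -> R) (C1 : R).
Hypothesis lip : forall x y, `|f x - f y| <= C1 * `|x - y|.

Let C1_ge0 : 0 <= C1.
Proof. have := lip 1 0; rewrite subr0 normr1 mulr1; exact: le_trans. Qed.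

Lemma subexponential_lipschitz x s : subexponential (fun g => f (x + s * g)).
Proof.
pose h := cst `|f x| + (C1 * `|s|) *: (fun g : R => `|g| ^+ 1).
have Nh : subexponential h.
  apply: subexponentialD; first exact: subexponential_cst.
  by apply: subexponentialZ; exact: subexponential_normX.
apply: (subexponential_le _ Nh) => [|g].
  apply: measurableT_comp.
    by apply: continuous_measurable_fun; exact: (lipschitz_continuous lip).
  by apply: measurable_funD => //; exact: measurable_funM.
rewrite /h !fctE/= /GRing.scale/= expr1.
have -> : f (x + s * g) = f x + (f (x + s * g) - f x).
  by rewrite [RHS]addrC subrK.
apply: le_trans (ler_normD _ _) _; rewrite lerD2l.
by apply: le_trans (lip _ _) _; rewrite [x + _]addrC addrK normrM mulrA.
Qed.

Lemma heat_lipschitz s x y : `|heat s f x - heat s f y| <= C1 * `|x - y|.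
Proof.
rewrite -(gaussian_mean_cst (C1 * `|x - y|)).
apply: gaussian_mean_near; [exact: subexponential_lipschitz|
  exact: subexponential_lipschitz|exact: subexponential_cst|].
move=> g; apply: le_trans (lip _ _) _.
by rewrite opprD addrACA subrr addr0.
Qed.

Lemma heat0 x : heat 0 f x = f x.
Proof.
rewrite -[RHS]gaussian_mean_cst; congr gm.
by apply/funext => g; rewrite mul0r addr0.
Qed.

Lemma walk_step_heat r s x : walk_step r (heat s f) x = heat s (walk_step r f) x.
Proof.
have N1 := subexponential_lipschitz.
rewrite /walk_step /heat -gaussian_meanD// mulrC -gaussian_meanZ; last exact: subexponentialD.
congr gm; apply/funext => g; rewrite !fctE/= /GRing.scale/= mulrC.
by rewrite (addrAC x) (addrAC x (- r)).
Qed.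

Hypothesis f_ge0 : forall x, 0 <= f x.

(** Rescaling by c reduces to [normal_convolution], where nonnegativity of f serves Tonelli's
    theorem. *)
Lemma heat_semigroup a b c x : 0 < b -> 0 < c -> a ^+ 2 + b ^+ 2 = c ^+ 2 ->
  heat a (heat b f) x = heat c f x.
Proof.
move=> b0 c0 abc; have cN : c != 0 by rewrite gt_eqF.
pose F z := f (x + c * z).
have cF : continuous F.
  apply: (@lipschitz_continuous _ (C1 * `|c|)) => y z.
  apply: le_trans (lip _ _) _.
  by rewrite opprD addrACA subrr add0r -mulrBr normrM mulrA.
have bc : 0 < b / c by rewrite divr_gt0.
have abc1 : (a / c) ^+ 2 + (b / c) ^+ 2 = 1.
  by rewrite !exprMn -mulrDl abc -exprMn divff// expr1n.
have := normal_convolution bc abc1 cF (fun z => f_ge0 _).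
move=> /(congr1 fine) h; rewrite /heat [RHS]gaussian_meanE /Rintegral -h.
rewrite gaussian_meanE /Rintegral; congr fine; apply: eq_integral => g _.
rewrite gaussian_meanE /Rintegral fineK.
  apply: eq_integral => y _; rewrite /F; congr (f _)%:E.
  by field.
apply: integrable_fin_num => //.
exact/subexponential_integrable/subexponential_lipschitz.
Qed.

Context (a b : R -> R) (C : R).
Hypothesis C_ge0 : 0 <= C.
Hypothesis taylor : forall x y, `|f (x + y) - f x - a x * y - b x * y ^+ 2| <= C * `|y| ^+ 3.

Definition abs_moment3 : R := gm (fun g => `|g| ^+ 3).

Lemma abs_moment3_ge0 : 0 <= abs_moment3.
Proof.
rewrite -[0]gaussian_mean_cst; apply: (mean_le gmm).
- exact: subexponential_cst.
- exact: subexponential_normX.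
- by move=> x; rewrite exprn_ge0.
Qed.

(** A sign and a standard Gaussian share their first two moments, so the second-order Taylor
    polynomial has the same average for both; [abs_moment3] and 1 are the third absolute moments of
    the two remainders. *)
Lemma heat_walk_step s x : 0 <= s ->
  `|heat s f x - walk_step s f x| <= C * (abs_moment3 + 1) * s ^+ 3.
Proof.
move=> s0; pose p := cst (f x) + (a x * s) *: (id : R -> R) + (b x * s ^+ 2) *: (fun y => y ^+ 2).
have N1 : subexponential (id : R -> R) by exact: (@subexponentialX R 1).
have N2 := @subexponentialX R 2.
have Np0 : subexponential (cst (f x) + (a x * s) *: (id : R -> R)).
  by apply: subexponentialD; [exact: subexponential_cst|exact: subexponentialZ].
have Np : subexponential p by apply: subexponentialD => //; exact: subexponentialZ.
have pE : gm p = f x + b x * s ^+ 2.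
  have [e1 e2] := @gaussian_moments R.
  rewrite /p gaussian_meanD//; last exact: subexponentialZ.
  rewrite gaussian_meanD//; [|exact: subexponential_cst|exact: subexponentialZ].
  by rewrite !gaussian_meanZ// gaussian_mean_cst e1 e2 mulr0 addr0 mulr1.
have h1 : `|heat s f x - gm p| <= C * s ^+ 3 * abs_moment3.
  rewrite -gaussian_meanZ; last exact: subexponential_normX.
  apply: gaussian_mean_near => //; first exact: subexponential_lipschitz.
    by apply: subexponentialZ; exact: subexponential_normX.
  move=> g; rewrite /p !fctE/= /GRing.scale/=.
  have := taylor x (s * g); rewrite normrM (ger0_norm s0) !exprMn -!mulrA.
  by rewrite !opprD !addrA.
have := taylor x s; have := taylor x (- s).
rewrite normrN (ger0_norm s0); move: h1; rewrite pE /walk_step sqrrN.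
rewrite [C * s ^+ 3 * _]mulrAC mulrDr mulr1 mulrDl !ler_norml.
lra.
Qed.

(** Lindeberg's exchange: the last step is replaced by a Gaussian one after it has been commuted
    through the heat operator, and the semigroup property merges the widths. *)
Lemma walk_heat r k x : 0 <= r ->
  `|iter k (walk_step r) f x - heat (Num.sqrt k%:R * r) f x|
    <= k%:R * (C * (abs_moment3 + 1) * r ^+ 3).
Proof.
rewrite le0r => /predU1P[->|r0].
  rewrite mulr0 heat0.
  have -> : iter k (walk_step 0) f x = f x.
    elim: k x => [//|k IH] x; rewrite iterS /walk_step !IH addr0 subr0; by field.
  rewrite subrr normr0 !mulr_ge0// ?addr_ge0 ?abs_moment3_ge0// ?exprn_ge0//.
elim: k x => [|k IH] x; first by rewrite sqrtr0 !mul0r heat0 subrr normr0.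
set K := C * (abs_moment3 + 1) * r ^+ 3 in IH *.
set s := Num.sqrt k%:R * r in IH *.
have h1 := walk_step_near r IH x.
have h2 : `|walk_step r (heat s f) x - heat s (heat r f) x| <= K.
  rewrite walk_step_heat -[leRHS]gaussian_mean_cst; apply: gaussian_mean_near.
  - have Nf := subexponential_lipschitz.
    have := subexponentialZ 2^-1 (subexponentialD (Nf (x + r) s) (Nf (x - r) s)).
    congr subexponential; apply/funext => g; rewrite !fctE/= /GRing.scale/= /walk_step.
    by rewrite mulrC (addrAC x) (addrAC x (- r)).
  - have Nf := subexponential_lipschitz.
    pose h := cst `|heat r f x| + (C1 * `|s|) *: (fun g : R => `|g| ^+ 1).
    have Nh : subexponential h.
      apply: subexponentialD; first exact: subexponential_cst.
      by apply: subexponentialZ; exact: subexponential_normX.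
    apply: (subexponential_le _ Nh) => [|g].
      apply: (@measurableT_comp _ _ _ _ _ _ (heat r f)).
        by apply: continuous_measurable_fun; exact: (lipschitz_continuous (heat_lipschitz r)).
      by apply: measurable_funD => //; exact: measurable_funM.
    rewrite /h !fctE/= /GRing.scale/= expr1.
    have -> : heat r f (x + s * g) = heat r f x + (heat r f (x + s * g) - heat r f x).
      by rewrite [RHS]addrC subrK.
    apply: le_trans (ler_normD _ _) _; rewrite lerD2l.
    by apply: le_trans (heat_lipschitz _ _ _) _; rewrite [x + _]addrC addrK normrM mulrA.
  - exact: subexponential_cst.
  - by move=> g; rewrite distrC; exact: heat_walk_step (ltW r0).
have e : heat s (heat r f) x = heat (Num.sqrt k.+1%:R * r) f x.
  apply: heat_semigroup => //; first by rewrite mulr_gt0// sqrtr_gt0 ltr0n.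
  by rewrite !exprMn !sqr_sqrtr// -natr1 mulrDl mul1r.
rewrite iterS -e -natr1 mulrDl mul1r.
move: h1 h2; rewrite !ler_norml; lra.
Qed.

End Lipschitz.
End CentralLimit.

(** * One spin in a field *)

Section SingleSite.
Context {R : realType} {d : measure_display} {T : measurableType d}.
Context (P : probability T R) (s0 : T -> R).
Notation N := (@bounded_measurable R d T).
Let A : fun_algebra N := bounded_measurable_algebra.
Let mm := pmean_is_mean P.
Hypotheses (Ns0 : N s0) (hs0 : forall w, `|s0 w| <= 1).

Definition site_potential (u v : R) : T -> R := u *: s0 + v *: s0 ^+ 2.

Definition site_energy (u v : R) : R := free_energy (pmean P) (site_potential u v).

Definition magnetization (u v : R) : R := gibbs (pmean P) (site_potential u v) s0.

Lemma bounded_measurable_site u v : N (site_potential u v).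
Proof. by rewrite /site_potential; nice A. Qed.

Let hs0X k w : `|(s0 ^+ k) w| <= 1.
Proof. by rewrite fctE normrX exprn_ile1. Qed.

Lemma site_potentialD u y v : site_potential (u + y) v = site_potential u v + y *: s0.
Proof. by rewrite /site_potential scalerDl addrAC. Qed.

Lemma site_energy_taylor x y v : `|site_energy (x + y) v - site_energy x v
   - magnetization x v * y
   - (gibbs (pmean P) (site_potential x v) (s0 ^+ 2) - magnetization x v ^+ 2) / 2 * y ^+ 2|
  <= 200 * `|y| ^+ 3.
Proof.
have NG := bounded_measurable_site x v.
have mmu := gibbs_is_mean A mm NG.
have Ny : N (y *: s0) by nice A.
have hy w : `|(y *: s0) w| <= `|y| by rewrite fctE normrM ler_piMr.
have := free_energy_expansion A mm NG Ny hy.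
rewrite -site_potentialD /cumulant2 (meanZ A mmu)//.
have -> : (y *: s0) ^+ 2 = y ^+ 2 *: s0 ^+ 2.
  by apply/funext => w; rewrite !fctE/= /GRing.scale/= exprMn.
rewrite (meanZ A mmu); last by nice A.
rewrite -/(magnetization x v) -/(site_energy _ _) -/(site_energy _ _).
apply: le_trans; rewrite le_eqVlt; apply/orP; left; apply/eqP; congr Num.norm.
by field.
Qed.

Lemma site_energy_lipschitz u u' v v' :
  `|site_energy u v - site_energy u' v'| <= `|u - u'| + `|v - v'|.
Proof.
have NG := bounded_measurable_site u' v'.
have Nf : N ((u - u') *: s0 + (v - v') *: s0 ^+ 2) by nice A.
have := free_energy_lip A mm NG Nf (c := `|u - u'| + `|v - v'|).
have -> : site_potential u' v' + ((u - u') *: s0 + (v - v') *: s0 ^+ 2) = site_potential u v.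
  by apply/funext => w; rewrite /site_potential !fctE/= /GRing.scale/=; ring.
apply => w; rewrite fctE; apply: le_trans (ler_normD _ _) _.
by apply: lerD; rewrite fctE normrM ler_piMr//; exact: (hs0X 2 w).
Qed.

(** Jensen's inequality, with the linear term killed by the mean zero. It makes the energy
    nonnegative after adding |v|, as [walk_heat] wants. *)
Lemma site_energy_ge : pmean P s0 = 0 -> forall u v, - `|v| <= site_energy u v.
Proof.
move=> m0 u v; have NG := bounded_measurable_site u v.
apply: le_trans (jensen_ln_mean_expR A mm NG).
rewrite /site_potential (meanD mm); [|by nice A|by nice A].
rewrite !(meanZ A mm)//; last by nice A.
rewrite m0 mulr0 add0r; apply: (@le_trans _ _ (- `|v * pmean P (s0 ^+ 2)|)).
  rewrite lerN2 normrM ler_piMr//.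
  by apply: (mean_norm_le A mm) => [|w]; [nice A|exact: (hs0X 2 w)].
by rewrite lerNl -normrN ler_norm.
Qed.

Lemma magnetization_norm_le u v : `|magnetization u v| <= 1.
Proof.
apply: (mean_norm_le A (gibbs_is_mean A mm (bounded_measurable_site u v))) => //.
Qed.

(** The derivative is read off from the Taylor bound, so nothing is differentiated under the
    expectation. *)
Lemma derive1_site_energy u v : derive1 (fun u' => site_energy u' v) u = magnetization u v.
Proof.
set m := magnetization u v.
pose b := (gibbs (pmean P) (site_potential u v) (s0 ^+ 2) - m ^+ 2) / 2.
rewrite /derive1; apply/cvg_lim => //.
apply/cvgrPdist_le => e e0; near=> y.
have yN : y != 0 by near: y; exact: nbhs_dnbhs_neq.
have y1 : `|y| <= 1.
  by near: y; apply: dnbhs0_le.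
have ye : `|y| <= e / (`|b| + 200).
  by near: y; apply: dnbhs0_le; rewrite divr_gt0// ltr_wpDl.
have yp : 0 < `|y| by rewrite normr_gt0.
rewrite -(ler_pM2l yp) -normrM /GRing.scale/=.
have -> : y * (m - y^-1 * (site_energy (y + u) v - site_energy u v)) =
   - ((site_energy (u + y) v - site_energy u v - m * y - b * y ^+ 2) + b * y ^+ 2).
  by rewrite (addrC y u); field.
rewrite normrN; apply: le_trans (ler_normD _ _) _.
have h1 := site_energy_taylor u y v.
have h2 : `|y| ^+ 3 <= `|y| ^+ 2 by rewrite (exprS _ 2) ler_piMl ?exprn_ge0.
have h3 : `|y| * (`|b| + 200) <= e by rewrite -ler_pdivlMr// ltr_wpDl.
apply: (@le_trans _ _ (200 * `|y| ^+ 2 + `|b| * `|y| ^+ 2)).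
  by rewrite normrM normrX lerD2r; apply: le_trans h1 _; rewrite ler_wpM2l.
rewrite -mulrDl addrC mulrC expr2 -mulrA ler_pM2l//.
Unshelve. all: by end_near. Qed.

End SingleSite.

Section SingleSiteTaylor.
Context {R : realType} {d : measure_display} {T : measurableType d}.
Context (P : probability T R) (s0 : T -> R).
Notation N := (@bounded_measurable R d T).
Let A : fun_algebra N := bounded_measurable_algebra.
Let mm := pmean_is_mean P.
Hypotheses (Ns0 : N s0) (hs0 : forall w, `|s0 w| <= 1).

Let hs0X k w : `|(s0 ^+ k) w| <= 1.
Proof. by rewrite fctE normrX exprn_ile1. Qed.

Notation site_potential := (site_potential s0).
Notation magnetization := (magnetization P s0).

Lemma gibbsD G W f : N G -> N W -> N f ->
  gibbs (pmean P) (G + W) f =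
  gibbs (pmean P) G (f * (expR \o W)) / gibbs (pmean P) G (expR \o W).
Proof.
move=> NG NW Nf; have p := mean_expR_gt0 A mm NG.
have NGW : N (G + W) by nice A.
rewrite /gibbs invf_div mulrA divfK ?gt_eqF//.
by congr (pmean P _ / pmean P _); apply/funext => w; rewrite !fctE/= expRD;
  ring.
Qed.

(** For eta <= 1 the numerator and the denominator each move by at most 4 eta and the denominator is
    at least 1/4, whence 32; for eta > 1 both averages are at most 1 in absolute value. *)
Lemma gibbs_lipschitz G W (eta : R) : N G -> N W -> 0 <= eta ->
  (forall w, `|W w| <= eta) ->
  `|gibbs (pmean P) (G + W) s0 - gibbs (pmean P) G s0| <= 32 * eta.
Proof.
move=> NG NW eta0 hW; set mu := gibbs (pmean P) G.
have mmu : is_mean N mu := gibbs_is_mean A mm NG.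
have NGW : N (G + W) by nice A.
have mmu' := gibbs_is_mean A mm NGW.
have h1 : `|gibbs (pmean P) (G + W) s0| <= 1 by exact: (mean_norm_le A mmu').
have h2 : `|mu s0| <= 1 by exact: (mean_norm_le A mmu).
have [e1|e1] := leP eta 1; last by move: h1 h2; rewrite !ler_norml; lra.
rewrite gibbsD// -/mu; set Z := mu (expR \o W).
have NE := fun_exp A NW; have NEs := fun_mul A Ns0 NE.
have hE w : `|expR (W w) - 1| <= 4 * eta.
  apply: le_trans (expR_taylor1 _) _; rewrite mulrC; apply: ler_pM => //.
  by apply: le_trans expR1_le4; rewrite ler_expR (le_trans (hW w)).
have Z4 : 4^-1 <= Z.
  apply: (mean_ge A mmu) => // w /=.
  have : expR (- 1) <= expR (W w).
    by rewrite ler_expR; have := hW w; rewrite ler_norml; lra.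
  apply: le_trans; rewrite expRN lef_pV2 ?posrE ?expR_gt0//; exact: expR1_le4.
have Z0 : 0 < Z by apply: lt_le_trans Z4.
have d1 : `|mu (s0 * (expR \o W)) - mu s0| <= 4 * eta.
  rewrite -(meanB A mmu)//; apply: (mean_norm_le A mmu) => [|w]; first by nice A.
  rewrite !fctE/= -[X in _ - X]mulr1 -mulrBr normrM.
  by rewrite -[leRHS]mul1r; apply: ler_pM.
have d2 : `|Z - 1| <= 4 * eta.
  rewrite -[X in _ - X](mean_cst A mmu) -(meanB A mmu)//; last exact: (fun_cst A).
  by apply: (mean_norm_le A mmu) => [|w]; [nice A|exact: hE].
have d3 : `|mu s0 * (Z - 1)| <= 4 * eta.
  by rewrite normrM -[leRHS]mul1r; apply: ler_pM.
have -> : mu (s0 * (expR \o W)) / Z - mu s0 =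
    (mu (s0 * (expR \o W)) - mu s0 - mu s0 * (Z - 1)) / Z.
  by field; rewrite gt_eqF.
rewrite normrM normrV ?unitfE ?gt_eqF// (gtr0_norm Z0) ler_pdivrMr//.
have : `|mu (s0 * (expR \o W)) - mu s0 - mu s0 * (Z - 1)| <= 8 * eta.
  by apply: le_trans (ler_normB _ _) _; lra.
have : 8 * eta <= 32 * eta * Z by nra.
lra.
Qed.

Lemma magnetization_lipschitz u u' v v' :
  `|magnetization u v - magnetization u' v'| <= 32 * (`|u - u'| + `|v - v'|).
Proof.
have NG := bounded_measurable_site Ns0 u' v'.
have Nf : N ((u - u') *: s0 + (v - v') *: s0 ^+ 2) by nice A.
have := gibbs_lipschitz (eta := `|u - u'| + `|v - v'|) NG Nf.
have -> : site_potential u' v' + ((u - u') *: s0 + (v - v') *: s0 ^+ 2) = site_potential u v.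
  by apply/funext => w; rewrite /site_potential !fctE/= /GRing.scale/=; ring.
apply=> [|w]; first by rewrite addr_ge0.
rewrite fctE; apply: le_trans (ler_normD _ _) _.
by apply: lerD; rewrite fctE normrM ler_piMr//; exact: (hs0X 2 w).
Qed.

Lemma magnetization_sqr_lipschitz u u' v v' :
  `|magnetization u v ^+ 2 - magnetization u' v' ^+ 2| <= 64 * (`|u - u'| + `|v - v'|).
Proof.
rewrite subr_sqr normrM.
have h1 := (magnetization_norm_le P Ns0 hs0) u v; have h2 := (magnetization_norm_le P Ns0 hs0) u' v'.
have -> : 64 * (`|u - u'| + `|v - v'|) = 32 * (`|u - u'| + `|v - v'|) * 2 by ring.
apply: ler_pM => //; first exact: magnetization_lipschitz.
by apply: le_trans (ler_normD _ _) _; lra.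
Qed.

Section Taylor.
Context (x v : R).
Let mu := gibbs (pmean P) (site_potential x v).
Let mmu : is_mean N mu := gibbs_is_mean A mm (bounded_measurable_site Ns0 x v).
Let s1 := mu s0.
Let s2 := mu (s0 ^+ 2).
Let s3 := mu (s0 ^+ 3).
(** The variance of the spin and half its third cumulant, that is, the first two Taylor coefficients
    of the magnetization in the field. *)
Let m1 := s2 - s1 ^+ 2.
Let m2 := s3 / 2 - s1 * m1 - s1 * s2 / 2.

Let Ns3 : N (s0 ^+ 3).
Proof. by rewrite (_ : s0 ^+ 3 = s0 * s0 ^+ 2)//; nice A. Qed.

Let hsk : [/\ `|s1| <= 1, `|s2| <= 1 & `|s3| <= 1].
Proof.
split; first exact: (mean_norm_le A mmu).
  by apply: (mean_norm_le A mmu) => [|w]; [nice A|exact: (hs0X 2 w)].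
by apply: (mean_norm_le A mmu) => // w; exact: (hs0X 3 w).
Qed.

Let m1_le : `|m1| <= 2.
Proof.
have [h1 h2 _] := hsk; rewrite /m1; apply: le_trans (ler_normB _ _) _.
have : `|s1 ^+ 2| <= 1 by rewrite normrX exprn_ile1.
lra.
Qed.

Let m2_le : `|m2| <= 3.
Proof.
have [h1 h2 h3] := hsk; rewrite /m2.
have a1 : `|s3 / 2| <= 2^-1 by rewrite normrM normfV (@ger0_norm _ 2)// ler_piMl.
have a2 : `|s1 * m1| <= 2 by rewrite normrM -[leRHS]mul1r; apply: ler_pM.
have a3 : `|s1 * s2 / 2| <= 2^-1.
  rewrite normrM normfV (@ger0_norm _ 2)// ler_piMl//.
  by rewrite normrM mulr_ile1.
apply: le_trans (ler_normB _ _) _.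
have := ler_normB (s3 / 2) (s1 * m1); lra.
Qed.

Let expand y f : `|y| <= 1 -> N f -> (forall w, `|f w| <= 1) ->
  `|mu (f * (expR \o (y *: s0))) - (mu f + y * mu (f * s0) + y ^+ 2 / 2 * mu (f * s0 ^+ 2))|
    <= 4 * `|y| ^+ 3.
Proof.
move=> y1 Nf hf.
have e0 : f + y *: (f * s0) + (y ^+ 2 / 2) *: (f * s0 ^+ 2) =
   f * (cst 1 + y *: s0 + (y ^+ 2 / 2) *: s0 ^+ 2).
  by apply/funext => w; rewrite !fctE/= /GRing.scale/=; ring.
have -> : mu f + y * mu (f * s0) + y ^+ 2 / 2 * mu (f * s0 ^+ 2) =
    mu (f * (cst 1 + y *: s0 + (y ^+ 2 / 2) *: s0 ^+ 2)).
  rewrite -e0 !(meanD mmu); try by nice A.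
  by rewrite !(meanZ A mmu)//; nice A.
rewrite -(meanB A mmu); [|by nice A|by nice A].
apply: (mean_norm_le A mmu) => [|w]; first by nice A.
rewrite -mulrBr fctE normrM; apply: le_trans (ler_piMl _ (hf w)) _ => //.
rewrite !fctE/= /GRing.scale/=.
have -> : expR (y * s0 w) - (1 + y * s0 w + y ^+ 2 / 2 * s0 w ^+ 2) =
   expR (y * s0 w) - 1 - y * s0 w - (y * s0 w) ^+ 2 / 2 by rewrite exprMn; ring.
have ys : `|y * s0 w| <= `|y| by rewrite normrM ler_piMr.
apply: le_trans (expR_taylor3_small (le_trans ys y1)) _.
by rewrite ler_wpM2l// lerXn2r ?nnegrE.
Qed.

Let magnetization_taylor_small y : `|y| <= 1 ->
  `|magnetization (x + y) v - (s1 + m1 * y + m2 * y ^+ 2)| <= 150 * `|y| ^+ 3.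
Proof.
move=> y1; have Ny : N (y *: s0) by nice A.
rewrite /magnetization site_potentialD gibbsD// -/mu; last exact: (bounded_measurable_site Ns0).
have N1 : N (cst 1) by exact: (fun_cst A).
have eN := expand y1 Ns0 hs0.
have c1 w : `|(cst 1 : T -> R) w| <= 1 by rewrite normr1.
have := expand y1 N1 c1.
have e1 : cst 1 * (expR \o (y *: s0)) = expR \o (y *: s0).
  by apply/funext => w; rewrite !fctE mul1r.
have e2 : cst 1 * s0 = s0 by apply/funext => w; rewrite !fctE mul1r.
have e3 : cst 1 * s0 ^+ 2 = s0 ^+ 2 by apply/funext => w; rewrite !fctE mul1r.
rewrite e1 e2 e3 (mean_cst A mmu); move: eN.

have -> : mu (s0 * s0) = s2 by [].
have -> : mu (s0 * s0 ^+ 2) = s3 by [].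
have Z4 : 4^-1 <= mu (expR \o (y *: s0)).
  apply: (mean_ge A mmu) => [|w /=]; first by nice A.
  have : expR (- 1) <= expR ((y *: s0) w).
    rewrite ler_expR; have : `|(y *: s0) w| <= 1.
      by rewrite fctE normrM mulr_ile1.
    by rewrite ler_norml; lra.
  apply: le_trans; rewrite expRN lef_pV2 ?posrE ?expR_gt0//; exact: expR1_le4.
rewrite -/s1 -/s2; set Nn := mu (s0 * _); set Z := mu _ in Z4 *.
set p := s1 + m1 * y + m2 * y ^+ 2 => hN hZ.
have Z0 : 0 < Z by apply: lt_le_trans Z4.
have [h1 h2 h3] := hsk; have k1 := m1_le; have k2 := m2_le.
have -> : Nn / Z - p = (Nn - Z * p) / Z by field; rewrite gt_eqF.
rewrite normrM normfV (gtr0_norm Z0) ler_pdivrMr//.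
(* The coefficients [m1] and [m2] are those of the formal quotient of the two expansions, so the
   polynomial parts cancel up to y^3. *)
have -> : Nn - Z * p =
    (Nn - (s1 + y * s2 + y ^+ 2 / 2 * s3)) - (Z - (1 + y * s1 + y ^+ 2 / 2 * s2)) * p
    - y ^+ 3 * (s1 * m2 + s2 * m1 / 2 + y * (s2 * m2 / 2)).
  by rewrite /p /m2 /m1; field.
set n1 := Nn - _ in hN *; set z1 := Z - _ in hZ *.
have y0 := normr_ge0 y; have y30 : 0 <= `|y| ^+ 3 by exact: exprn_ge0.
have p6 : `|p| <= 6.
  have b1 : `|m1 * y| <= 2 by rewrite normrM -[leRHS]mulr1; apply: ler_pM.
  have b2 : `|m2 * y ^+ 2| <= 3.
    by rewrite normrM -[leRHS]mulr1; apply: ler_pM => //; rewrite normrX exprn_ile1.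
  apply: le_trans (ler_normD _ _) _; have := ler_normD s1 (m1 * y); lra.
have q1 : `|z1 * p| <= 24 * `|y| ^+ 3.
  rewrite normrM; have -> : 24 * `|y| ^+ 3 = 4 * `|y| ^+ 3 * 6 by ring.
  by apply: ler_pM.
have q2 : `|s1 * m2 + s2 * m1 / 2 + y * (s2 * m2 / 2)| <= 6.
  have b1 : `|s1 * m2| <= 3 by rewrite normrM -[leRHS]mul1r; apply: ler_pM.
  have b2 : `|s2 * m1| <= 2 by rewrite normrM -[leRHS]mul1r; apply: ler_pM.
  have b3 : `|s2 * m2| <= 3 by rewrite normrM -[leRHS]mul1r; apply: ler_pM.
  have b4 : `|y * (s2 * m2 / 2)| <= 3 / 2.
    rewrite -[leRHS]mul1r normrM; apply: ler_pM => //.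
    by rewrite normrM normfV (@ger0_norm _ 2)// ler_pM2r.
  have b5 : `|s2 * m1 / 2| <= 1.
    by rewrite normrM normfV (@ger0_norm _ 2)// ler_pdivrMr// mul1r.
  apply: le_trans (ler_normD _ _) _; have := ler_normD (s1 * m2) (s2 * m1 / 2); lra.
have q3 : `|y ^+ 3 * (s1 * m2 + s2 * m1 / 2 + y * (s2 * m2 / 2))| <= 6 * `|y| ^+ 3.
  by rewrite normrM normrX mulrC ler_wpM2r.
apply: (@le_trans _ _ (34 * `|y| ^+ 3)).
  apply: le_trans (ler_normB _ _) _; have := ler_normB n1 (z1 * p); lra.
nra.
Qed.

(** For |y| <= 1 squaring the expansion costs 1050 + 21 times |y|^3; for |y| > 1 all coefficients
    are bounded and the powers of |y| are at most |y|^3. *)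
Lemma magnetization_sqr_taylor y :
  `|magnetization (x + y) v ^+ 2 - magnetization x v ^+ 2 - 2 * s1 * m1 * y
    - (m1 ^+ 2 + 2 * s1 * m2) * y ^+ 2| <= 1100 * `|y| ^+ 3.
Proof.
rewrite -/s1 -[magnetization x v]/s1.
have [h1 h2 h3] := hsk; have k1 := m1_le; have k2 := m2_le.
set M := magnetization _ _; have hM : `|M| <= 1 by exact: (magnetization_norm_le P Ns0 hs0).
have y0 := normr_ge0 y; have y30 : 0 <= `|y| ^+ 3 by exact: exprn_ge0.
have c1 : `|s1 * m1| <= 2 by rewrite normrM -[leRHS]mul1r; apply: ler_pM.
have c2 : `|s1 * m2| <= 3 by rewrite normrM -[leRHS]mul1r; apply: ler_pM.
have c3 : `|m1 ^+ 2| <= 4.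
  by rewrite normrX; have -> : 4 = 2 ^+ 2 :> R; [ring|rewrite lerXn2r ?nnegrE].
have [y1|y1] := leP `|y| 1.
  have hT := magnetization_taylor_small y1; rewrite -/M in hT.
  set p := s1 + m1 * y + m2 * y ^+ 2 in hT.
  have p6 : `|p| <= 6.
    have b1 : `|m1 * y| <= 2 by rewrite normrM -[leRHS]mulr1; apply: ler_pM.
    have b2 : `|m2 * y ^+ 2| <= 3.
      by rewrite normrM -[leRHS]mulr1; apply: ler_pM => //; rewrite normrX exprn_ile1.
    apply: le_trans (ler_normD _ _) _; have := ler_normD s1 (m1 * y); lra.
  have -> : M ^+ 2 - s1 ^+ 2 - 2 * s1 * m1 * y - (m1 ^+ 2 + 2 * s1 * m2) * y ^+ 2 =
      (M - p) * (M + p) + y ^+ 3 * (2 * m1 * m2 + y * m2 ^+ 2) by rewrite /p; ring.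
  have d1 : `|(M - p) * (M + p)| <= 1050 * `|y| ^+ 3.
    rewrite normrM; have -> : 1050 * `|y| ^+ 3 = 150 * `|y| ^+ 3 * 7 by ring.
    by apply: ler_pM => //; apply: le_trans (ler_normD _ _) _; lra.
  have d2 : `|2 * m1 * m2 + y * m2 ^+ 2| <= 21.
    have f1 : `|2 * m1 * m2| <= 12.
      rewrite -mulrA !normrM (@ger0_norm _ 2)//.
      have : `|m1| * `|m2| <= 2 * 3 by apply: ler_pM.
      lra.
    have f2 : `|y * m2 ^+ 2| <= 9.
      rewrite normrM normrX -[leRHS]mul1r; apply: ler_pM => //.
      by have -> : 9 = 3 ^+ 2 :> R; [ring|rewrite lerXn2r ?nnegrE].
    by apply: le_trans (ler_normD _ _) _; lra.
  have d3 : `|y ^+ 3 * (2 * m1 * m2 + y * m2 ^+ 2)| <= 21 * `|y| ^+ 3.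
    by rewrite normrM normrX mulrC ler_wpM2r.
  by apply: le_trans (ler_normD _ _) _; lra.
have y2 : `|y| ^+ 2 <= `|y| ^+ 3 by rewrite (exprS _ 2) ler_peMl ?exprn_ge0// ltW.
have y3 : `|y| <= `|y| ^+ 2 by rewrite expr2 ler_peMl// ltW.
have M2 : `|M ^+ 2| <= 1 by rewrite normrX exprn_ile1.
have s12 : `|s1 ^+ 2| <= 1 by rewrite normrX exprn_ile1.
have g1 : `|2 * s1 * m1 * y| <= 4 * `|y|.
  by rewrite normrM ler_wpM2r// -mulrA normrM (@ger0_norm _ 2)//; lra.
have g2 : `|(m1 ^+ 2 + 2 * s1 * m2) * y ^+ 2| <= 10 * `|y| ^+ 2.
  rewrite normrM normrX ler_wpM2r ?exprn_ge0//.
  apply: le_trans (ler_normD _ _) _.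
  have : `|2 * s1 * m2| <= 6 by rewrite -mulrA normrM (@ger0_norm _ 2)//; lra.
  lra.
apply: le_trans (ler_normB _ _) _.
have := ler_normB (M ^+ 2 - s1 ^+ 2) (2 * s1 * m1 * y).
have := ler_normB (M ^+ 2) (s1 ^+ 2).
lra.
Qed.

End Taylor.
End SingleSiteTaylor.

(** * The decoupled system *)

Section RadialWalk.
Context {R : realType}.
Implicit Types (f g : R -> R) (r x c a : R).

Lemma walk_cst k r c x : iter k (walk_step r) (cst c) x = c.
Proof.
elim: k x => [//|k IH] x; rewrite iterS /walk_step !IH; by field.
Qed.

Lemma walk_lin k r a f g x : iter k (walk_step r) (a *: f + g) x =
  a * iter k (walk_step r) f x + iter k (walk_step r) g x.
Proof.
elim: k x => [//|k IH] x; rewrite !iterS /walk_step !IH; by field.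
Qed.

Lemma walk_le k r f g x : (forall x, f x <= g x) ->
  iter k (walk_step r) f x <= iter k (walk_step r) g x.
Proof.
move=> fg; elim: k x => [//|k IH] x; rewrite !iterS /walk_step.
by rewrite ler_pM2r ?invr_gt0// lerD.
Qed.

Lemma walk_affine k r a c f x : iter k (walk_step r) (fun y => a * f y + c) x =
  a * iter k (walk_step r) f x + c.
Proof. by rewrite -[in RHS](walk_cst k r c x) -walk_lin. Qed.

End RadialWalk.

Section Decoupled.
Context {R : realType} {d : measure_display} {T : measurableType d}.
Context (P : probability T R) (sigma : nat -> {RV P >-> R}).
Hypotheses (sigma_iid : iid sigma) (sigma_bounded : forall i w, -1 <= sigma i w <= 1).
Notation N := (@bounded_measurable R d T).
Notation N2 := (@bounded_measurable R _ (T * T)%type).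
Let A : fun_algebra N := bounded_measurable_algebra.
Let A2 : fun_algebra N2 := bounded_measurable_algebra.
Let mm := pmean_is_mean P.
Let mm2 := pmean2_is_mean P.

Let s (i : nat) : T -> R := sigma i.

Lemma spin_norm_le i w : `|sigma i w| <= 1.
Proof. by rewrite ler_norml. Qed.

Lemma bounded_measurable_spin i : N (sigma i).
Proof. by split; [exact: measurable_funP|exists 1 => w; exact: spin_norm_le]. Qed.

Let Ns i : N (s i) := bounded_measurable_spin i.
Let hs i w : `|s i w| <= 1 := spin_norm_le i w.

Lemma pmean_iid i j (f : R -> R) (C : R) : measurable_fun setT f ->
  (forall x, `|x| <= 1 -> `|f x| <= C) ->
  pmean P (fun w => f (sigma i w)) = pmean P (fun w => f (sigma j w)).
Proof.
move=> mf fC.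
have If k : P.-integrable setT ((EFin \o f) \o sigma k).
  apply: bounded_measurable_integrable; split; first exact: measurableT_comp.
  by exists C => w; apply: fC; exact: spin_norm_le.
have mfE : measurable_fun setT (EFin \o f) by exact/measurable_EFinP.
rewrite !pmeanE /Rintegral; congr fine.
rewrite -[LHS](integral_distribution mfE (If i)) -[RHS](integral_distribution mfE (If j)).
by apply: eq_measure_integral => B mB _; exact: sigma_iid.2.
Qed.

Lemma pmean_spin_prod (f : nat -> R -> R) (C : nat -> R) n :
  (forall i, measurable_fun setT (f i)) ->
  (forall i x, `|x| <= 1 -> `|f i x| <= C i) ->
  pmean P (\prod_(i <- iota 0 n) (fun w => f i (s i w))) =
  \prod_(i <- iota 0 n) pmean P (fun w => f i (s 0%N w)).
Proof.
move=> mf fC.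
rewrite (pmean_prod sigma_iid.1 (C := C)) ?iota_uniq//; last first.
  by move=> i w; apply: fC; exact: spin_norm_le.
by apply: eq_bigr => i _; exact: (pmean_iid i 0 (mf i) (fC i)).
Qed.

(** One field per site and a common quadratic term: this class is stable under decoupled steps, the
    signs moving y and the drift moving v. *)
Definition field_potential n (y : nat -> R) (v : R) : T -> R :=
  \sum_(i <- iota 0 n) site_potential (s i) (y i) v.

Lemma bounded_measurable_field n y v : N (field_potential n y v).
Proof. by apply: (fun_sum A) => i; exact: bounded_measurable_site. Qed.

Lemma expR_fsum I (r : seq I) (F : I -> T -> R) :
  expR \o (\sum_(i <- r) F i) = \prod_(i <- r) (expR \o F i).
Proof.
elim: r => [|i r IH]; first by rewrite !big_nil; apply/funext => w /=; rewrite expR0.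
by rewrite !big_cons -IH; apply/funext => w; rewrite /= expRD.
Qed.

Let site_fun (u v x : R) := expR (u * x + v * x ^+ 2).

Let measurable_site_fun u v : measurable_fun setT (site_fun u v).
Proof.
apply: measurableT_comp => //; apply: measurable_funD => //; exact: measurable_funM.
Qed.

Let site_fun_le u v x : `|x| <= 1 -> `|site_fun u v x| <= expR (`|u| + `|v|).
Proof.
move=> x1; rewrite ger0_norm ?expR_ge0// ler_expR.
apply: le_trans (ler_norm _) _; apply: le_trans (ler_normD _ _) _.
apply: lerD; first by rewrite normrM ler_piMr.
by rewrite normrM normrX ler_piMr// exprn_ile1.
Qed.

Lemma free_energy_field n y v : free_energy (pmean P) (field_potential n y v) =
  \sum_(i <- iota 0 n) site_energy P (s 0%N) (y i) v.
Proof.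
rewrite /free_energy /field_potential expR_fsum.
rewrite (pmean_spin_prod (f := fun i => site_fun (y i) v)
  (C := fun i => expR (`|y i| + `|v|))); last 2 first.
- by move=> i; exact: measurable_site_fun.
- by move=> i x; exact: site_fun_le.
elim: (iota 0 n) => [|i l IH]; first by rewrite !big_nil ln1.
have p0 j : 0 < pmean P (fun w => site_fun (y j) v (s 0%N w)).
  exact: (mean_expR_gt0 A mm (bounded_measurable_site (Ns 0%N) (y j) v)).
rewrite !big_cons lnM ?posrE ?p0//; first by rewrite IH.
by apply: prodr_gt0 => j _; exact: p0.
Qed.

Section RsWalk.
Context (n : nat) (t q r : R).
Hypotheses (t0 : 0 <= t) (q0 : 0 <= q).
Let c := r * Num.sqrt (2 * q * t).

Definition bump (y : nat -> R) k z : nat -> R := fun i => if i == k then y i + z else y i.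

Lemma field_potential_bump y v k z : k \in iota 0 n ->
  field_potential n (bump y k z) v = field_potential n y v + z *: s k.
Proof.
move=> kn; have u := iota_uniq 0 n.
rewrite /field_potential !(bigD1_seq k kn u)/=.
have -> : \sum_(i <- iota 0 n | i != k) site_potential (s i) (bump y k z i) v =
    \sum_(i <- iota 0 n | i != k) site_potential (s i) (y i) v.
  by apply: eq_bigr => i ik; rewrite /bump (negbTE ik).
by rewrite /bump eqxx site_potentialD addrAC.
Qed.

Lemma rs_bump y v k e : k \in iota 0 n ->
  field_potential n y v + e *: (r *: rs_feature s t q k) =
  field_potential n (bump y k (e * c)) v.
Proof. by move=> kn; rewrite field_potential_bump// /rs_feature !scalerA /c mulrA. Qed.

Lemma avg_bump Phi y v k : k \in iota 0 n ->
  avg (r *: rs_feature s t q k) Phi (field_potential n y v) =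
  (Phi (field_potential n (bump y k c) v) + Phi (field_potential n (bump y k (- c)) v)) / 2.
Proof.
move=> kn; rewrite /avg; have h1 := rs_bump y v 1 kn; have h2 := rs_bump y v (- 1) kn.
by rewrite scale1r mul1r in h1; rewrite scaleN1r mulN1r in h2; rewrite h1 h2.
Qed.

(** The sign at site k moves only y k, so additivity over the sites is preserved; the sites of l,
    already visited, have made one step of their own walk. *)
Lemma avgs_field_sum (l : seq nat) Phi v (u : R -> R) :
  uniq l -> {subset l <= iota 0 n} ->
  (forall y, Phi (field_potential n y v) = \sum_(i <- iota 0 n) u (y i)) ->
  forall y, avgs l (fun i => r *: rs_feature s t q i) Phi (field_potential n y v) =
    \sum_(i <- iota 0 n) (if i \in l then walk_step c u else u) (y i).
Proof.
move=> + + h; elim: l => [|k l IH]; first by move=> _ _ y; rewrite /= h.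
move=> /= /andP[kl ul] sub y.
have kn : k \in iota 0 n by apply: sub; rewrite mem_head.
have subl : {subset l <= iota 0 n} by move=> i il; apply: sub; rewrite inE il orbT.
rewrite avg_bump// !IH// !(bigD1_seq k kn (iota_uniq 0 n))/= (negbTE kl) mem_head.
rewrite {1 3}/bump eqxx.
set S1 := \sum_(i <- _ | _) _; set S2 := \sum_(i <- _ | _) _; set S3 := \sum_(i <- _ | _) _.
have -> : S1 = S3.
  by apply: eq_bigr => i ik; rewrite /bump (negbTE ik) inE (negbTE ik).
have -> : S2 = S3.
  by apply: eq_bigr => i ik; rewrite /bump (negbTE ik) inE (negbTE ik).
by rewrite /walk_step; field.
Qed.

Lemma avgs_field_prod (l : seq nat) Phi v (u : R -> R) :
  uniq l -> {subset l <= iota 0 n} ->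
  (forall y, Phi (field_potential n y v) = \prod_(i <- iota 0 n) u (y i)) ->
  forall y, avgs l (fun i => r *: rs_feature s t q i) Phi (field_potential n y v) =
    \prod_(i <- iota 0 n) (if i \in l then walk_step c u else u) (y i).
Proof.
move=> + + h; elim: l => [|k l IH]; first by move=> _ _ y; rewrite /= h.
move=> /= /andP[kl ul] sub y.
have kn : k \in iota 0 n by apply: sub; rewrite mem_head.
have subl : {subset l <= iota 0 n} by move=> i il; apply: sub; rewrite inE il orbT.
rewrite avg_bump// !IH// !(bigD1_seq k kn (iota_uniq 0 n))/= (negbTE kl) mem_head.
rewrite {1 3}/bump eqxx.
set S1 := \prod_(i <- _ | _) _; set S2 := \prod_(i <- _ | _) _; set S3 := \prod_(i <- _ | _) _.
have -> : S1 = S3.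
  by apply: eq_bigr => i ik; rewrite /bump (negbTE ik) inE (negbTE ik).
have -> : S2 = S3.
  by apply: eq_bigr => i ik; rewrite /bump (negbTE ik) inE (negbTE ik).
by rewrite /walk_step; field.
Qed.

Lemma field_potential_drift y v :
  field_potential n y v + r ^+ 2 *: drift (iota 0 n) (rs_feature s t q) =
  field_potential n y (v - r ^+ 2 * (q * t)).
Proof.
rewrite /drift -scaleNr scalerA scaler_sumr /field_potential -big_split.
apply: eq_bigr => i _ /=; apply/funext => w.
have -> : q * t = Num.sqrt (2 * q * t) ^+ 2 / 2.
  by rewrite sqr_sqrtr ?mulr_ge0//; field.
by rewrite /site_potential /rs_feature !fctE/= /GRing.scale/=; field.
Qed.

(** After k steps the drift has lowered v by k r^2 q t. When k r^2 = 1 and v starts at 0 this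
    produces the second argument of [phi] in the limiting energy. *)
Lemma rs_block_field_sum Phi (u : R -> R -> R) k :
  (forall y v, Phi (field_potential n y v) = \sum_(i <- iota 0 n) u v (y i)) ->
  forall y v, iter k (rs_block s n t q r) Phi (field_potential n y v) =
    \sum_(i <- iota 0 n) iter k (walk_step c) (u (v - k%:R * (r ^+ 2 * (q * t)))) (y i).
Proof.
move=> h; elim: k => [|k IH] y v; first by rewrite /= h mul0r subr0.
rewrite iterS {1}/rs_block /block /shift /= field_potential_drift.
rewrite (avgs_field_sum _ _ (fun y => IH y _)) ?iota_uniq//.
by apply: eq_big_seq => i ->; rewrite -natr1 mulrDl mul1r opprD addrA addrAC.
Qed.

Lemma rs_block_field_prod Phi (u : R -> R -> R) k :
  (forall y v, Phi (field_potential n y v) = \prod_(i <- iota 0 n) u v (y i)) ->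
  forall y v, iter k (rs_block s n t q r) Phi (field_potential n y v) =
    \prod_(i <- iota 0 n) iter k (walk_step c) (u (v - k%:R * (r ^+ 2 * (q * t)))) (y i).
Proof.
move=> h; elim: k => [|k IH] y v; first by rewrite /= h mul0r subr0.
rewrite iterS {1}/rs_block /block /shift /= field_potential_drift.
rewrite (avgs_field_prod _ _ (fun y => IH y _)) ?iota_uniq//.
by apply: eq_big_seq => i ->; rewrite -natr1 mulrDl mul1r opprD addrA addrAC.
Qed.

Lemma rs_block_free_energy k y v :
  iter k (rs_block s n t q r) (free_energy (pmean P)) (field_potential n y v) =
  \sum_(i <- iota 0 n)
    iter k (walk_step c) (site_energy P (s 0%N) ^~ (v - k%:R * (r ^+ 2 * (q * t)))) (y i).
Proof.
by rewrite (rs_block_field_sum (u := fun v y => site_energy P (s 0%N) y v))// => y' v';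
  exact: free_energy_field.
Qed.

End RsWalk.
End Decoupled.

(** * The coupled energy of the decoupled system *)

Section StageZero.
Context {R : realType} {d : measure_display} {T : measurableType d}.
Context (P : probability T R) (sigma : nat -> {RV P >-> R}).
Hypotheses (sigma_iid : iid sigma) (sigma_bounded : forall i w, -1 <= sigma i w <= 1).
Notation N := (@bounded_measurable R d T).
Notation N2 := (@bounded_measurable R _ (T * T)%type).
Let A : fun_algebra N := bounded_measurable_algebra.
Let A2 : fun_algebra N2 := bounded_measurable_algebra.
Let mm := pmean_is_mean P.
Let mm2 := pmean2_is_mean P.
Let s (i : nat) : T -> R := sigma i.
Let Ns i : N (s i) := bounded_measurable_spin sigma_bounded i.
Let hs i w : `|s i w| <= 1 := spin_norm_le sigma_bounded i w.

Section Tilt.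
Context (n : nat) (q lam z : R).
Hypothesis n0 : (0 < n)%N.

Let pair_exponent (l x x' : R) := l * (2 * z * (x * x' - q) - z ^+ 2).

Let site_exponent (l y v x x' : R) :=
  pair_exponent l x x' + (y * x + v * x ^+ 2) + (y * x' + v * x' ^+ 2).

Let measurable_site_exponent d1 (T1 : measurableType d1) l y v (f g : T1 -> R) :
  measurable_fun setT f -> measurable_fun setT g ->
  measurable_fun setT (fun p => expR (site_exponent l y v (f p) (g p))).
Proof.
move=> mf mg; apply: measurableT_comp => //.
have m2 (h : T1 -> R) : measurable_fun setT h ->
    measurable_fun setT (fun p => y * h p + v * h p ^+ 2).
  move=> mh; apply: measurable_funD; apply: measurable_funM => //.
  exact: measurable_funX.
apply: measurable_funD; last exact: m2.
apply: measurable_funD; last exact: m2.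
apply: measurable_funM => //; apply: measurable_funB => //.
apply: measurable_funM => //; apply: measurable_funB => //; exact: measurable_funM.
Qed.

Let site_bound (l y v : R) : R := expR (`|l| * (2 * `|z| * (1 + `|q|) + `|z| ^+ 2) + (`|y| + `|v|) + (`|y| + `|v|)).

Let site_exponent_le l y v x x' : `|x| <= 1 -> `|x'| <= 1 ->
  `|expR (site_exponent l y v x x')| <= site_bound l y v.
Proof.
move=> hx hx'; rewrite ger0_norm ?expR_ge0// ler_expR.
have h (u : R) : `|u| <= 1 -> `|y * u + v * u ^+ 2| <= `|y| + `|v|.
  move=> hu; apply: le_trans (ler_normD _ _) _; apply: lerD.
    by rewrite normrM ler_piMr.
  by rewrite normrM normrX ler_piMr// exprn_ile1.
apply: le_trans (ler_norm _) _; apply: le_trans (ler_normD _ _) _.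
apply: lerD (h _ hx'); apply: le_trans (ler_normD _ _) _.
apply: lerD (h _ hx); rewrite normrM ler_wpM2l//.
apply: le_trans (ler_normB _ _) _; rewrite normrX lerD2r.
rewrite !normrM (@ger0_norm _ 2)// ler_wpM2l ?mulr_ge0//.
apply: le_trans (ler_normB _ _) _; rewrite lerD2r normrM.
by rewrite mulr_ile1.
Qed.

Lemma fct_prod_apply I (r : seq I) (F : I -> T -> R) w :
  (\prod_(i <- r) F i) w = \prod_(i <- r) F i w.
Proof.
elim: r => [|i r IH]; first by rewrite !big_nil.
by rewrite !big_cons fctE IH.
Qed.

Let pair_mean l y v : R :=
  pmean2 P (fun p => expR (site_exponent l y v (s 0%N p.1) (s 0%N p.2))).

(** Independence of the sites is used once per replica: with the first replica frozen the inner
    expectation becomes a product of functions [g i] of its spins, and the outer expectation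
    factorizes in the same way. *)
Let tilt_numerator l y v :
  pmean2 P (fun p => \prod_(i <- iota 0 n) expR (site_exponent l (y i) v (s i p.1) (s i p.2)))
  = \prod_(i <- iota 0 n) pair_mean l (y i) v.
Proof.
pose g i x := pmean P (fun w' => expR (site_exponent l (y i) v x (s 0%N w'))).
have inner w : pmean P (fun w' => \prod_(i <- iota 0 n)
    expR (site_exponent l (y i) v (s i w) (s i w'))) = \prod_(i <- iota 0 n) g i (s i w).
  have := @pmean_spin_prod _ _ _ P sigma sigma_iid sigma_bounded
    (fun i x' => expR (site_exponent l (y i) v (s i w) x')) (fun i => site_bound l (y i) v) n.
  move=> <-.
  - congr pmean; apply/funext => w'; rewrite fct_prod_apply.
    by apply: eq_bigr.
  - by move=> i; exact: measurable_site_exponent.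
  - by move=> i x hx; exact: site_exponent_le.
have mg i : measurable_fun setT (g i).
  apply: measurableT_comp => //; rewrite unlock.
  apply: (@measurable_fun_fubini_tonelli_F _ _ (measurableTypeR R) T R P
    (fun p => (expR (site_exponent l (y i) v p.1 (s 0%N p.2)))%:E)).
    apply/measurable_EFinP; apply: measurable_site_exponent => //.
    by apply: measurableT_comp => //; have [] := Ns 0%N.
  by move=> p; rewrite lee_fin expR_ge0.
have gb i x : `|x| <= 1 -> `|g i x| <= site_bound l (y i) v.
  move=> hx; apply: (mean_norm_le A mm) => [|w]; last exact: site_exponent_le.
  split; last by exists (site_bound l (y i) v) => w; exact: site_exponent_le.
  by apply: measurable_site_exponent => //; have [] := Ns 0%N.
have := @pmean_spin_prod _ _ _ P sigma sigma_iid sigma_bounded g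
  (fun i => site_bound l (y i) v) n mg gb.
rewrite /pmean2 => <-; congr pmean; apply/funext => w /=.
by rewrite inner fct_prod_apply.
Qed.

(* [2 z x - z^2 <= x^2] with equality at [z = x]: summing over a grid of [z] linearizes the
   square in [coupled_energy], after which the sites decouple. *)
Definition tilt : T * T -> R :=
  fun p => expR (lam * n%:R * (2 * z * (pair_overlap s n p - q) - z ^+ 2)).

Definition site_tilt : T * T -> R :=
  fun p => expR (lam * (2 * z * (s 0%N p.1 * s 0%N p.2 - q) - z ^+ 2)).

Definition tilt_ratio (y v : R) : R :=
  gibbs (pmean2 P) (lift (site_potential (s 0%N) y v)) site_tilt.

Lemma gibbs_tilt_field y v :
  gibbs (pmean2 P) (lift (field_potential sigma n y v)) tilt =
  \prod_(i <- iota 0 n) tilt_ratio (y i) v.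
Proof.
have nR : n%:R != 0 :> R by rewrite pnatr_eq0 -lt0n.
(* At l = 0 the tilt is 1, so the same product formula also gives the normalization. *)
have den y' : pmean2 P (expR \o lift (site_potential (s 0%N) y' v)) = pair_mean 0 y' v.
  congr pmean2; apply/funext => p.
  by rewrite /site_exponent /pair_exponent mul0r add0r.
have num y' : pmean2 P (site_tilt * (expR \o lift (site_potential (s 0%N) y' v))) =
    pair_mean lam y' v.
  congr pmean2; apply/funext => p.
  by rewrite /site_tilt fctE /= -expRD /site_exponent addrA.
under eq_bigr do rewrite /tilt_ratio /gibbs num den.
rewrite prodf_div -!tilt_numerator /gibbs.
have fld p : lift (field_potential sigma n y v) p = \sum_(i <- iota 0 n)
    (site_potential (s i) (y i) v p.1 + site_potential (s i) (y i) v p.2).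
  by rewrite /field_potential lift_sum fct_sumE.
congr (pmean2 P _ / pmean2 P _); apply/funext => p.
  rewrite fctE /tilt/= -expRD fld -expR_sum; congr expR.
  rewrite /pair_overlap.
  transitivity (\sum_(i <- iota 0 n) pair_exponent lam (s i p.1) (s i p.2) +
      \sum_(i <- iota 0 n) (site_potential (s i) (y i) v p.1 + site_potential (s i) (y i) v p.2)).
    congr (_ + _); rewrite /pair_exponent -mulr_sumr sumrB -mulr_sumr sumrB.
    have hc (a : R) : \sum_(i <- iota 0 n) a = n%:R * a.
      by rewrite big_const_seq count_predT size_iota iter_addr_0 mulr_natl.
    rewrite !hc.
    set S := \sum_(i <- _) _; field; exact: nR.
  rewrite -big_split; apply: eq_bigr => i _ /=.
  by rewrite /site_exponent addrA.
rewrite /= fld -expR_sum; congr expR; apply: eq_bigr => i _.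
by rewrite /site_exponent /pair_exponent mul0r add0r.
Qed.

Lemma bounded_measurable_tilt : N2 tilt.
Proof.
have Np : N2 (pair_overlap s n).
  have -> : pair_overlap s n = n%:R^-1 *: cov (iota 0 n) s by [].
  by apply: (fun_scale A2); exact: bounded_measurable_cov.
have -> : tilt = expR \o ((lam * n%:R) *:
    ((2 * z) *: (pair_overlap s n - cst q) - cst (z ^+ 2))) by [].
by nice A2.
Qed.

Hypotheses (lam0 : 0 <= lam <= 64^-1) (z2 : `|z| <= 2) (q01 : 0 <= q <= 1).

Lemma tilt_ratio_ge0 y v : 0 <= tilt_ratio y v.
Proof.
have NG := bounded_measurable_lift (bounded_measurable_site (Ns 0%N) y v).
apply: (mean_ge A2 (gibbs_is_mean A2 mm2 NG)) => [|p]; last exact: expR_ge0.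
have N1 := bounded_measurable_fst (Ns 0%N); have N2' := bounded_measurable_snd (Ns 0%N).
have -> : site_tilt = expR \o (lam *: ((2 * z) *:
    ((fun p => s 0%N p.1) * (fun p => s 0%N p.2) - cst q) - cst (z ^+ 2))) by [].
by nice A2.
Qed.

(** The exponent a is at most 4 lam |z| <= 1, so exp a <= 1 + a + 4 a^2, whence 64 = 4 * 4^2. The
    two replicas are independent, so the linear term sees the squared magnetization. *)
Lemma tilt_ratio_le y v : tilt_ratio y v <= expR (- (lam * z ^+ 2)) *
  (1 + 2 * lam * z * (magnetization P (s 0%N) y v ^+ 2 - q) + 64 * lam ^+ 2 * z ^+ 2).
Proof.
have NG := bounded_measurable_lift (bounded_measurable_site (Ns 0%N) y v).
have mmu := gibbs_is_mean A2 mm2 NG.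
have N1 := bounded_measurable_fst (Ns 0%N); have N2' := bounded_measurable_snd (Ns 0%N).
pose a : T * T -> R := (2 * lam * z) *:
  ((fun p => s 0%N p.1) * (fun p => s 0%N p.2) - cst q).
have Na : N2 a by rewrite /a; nice A2.
have /andP[l0 l1] := lam0; have /andP[q0 q1] := q01.
have ha p : `|a p| <= 4 * lam * `|z|.
  rewrite /a !fctE/= /GRing.scale/= !normrM (@ger0_norm _ 2)// (ger0_norm l0).
  have -> : 4 * lam * `|z| = 2 * lam * `|z| * 2 by ring.
  rewrite ler_wpM2l ?mulr_ge0//; apply: le_trans (ler_normB _ _) _.
  rewrite (ger0_norm q0) normrM.
  have : `|s 0%N p.1| * `|s 0%N p.2| <= 1 by rewrite mulr_ile1.
  lra.
have ha1 p : `|a p| <= 1.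
  apply: le_trans (ha p) _.
  have : lam * `|z| <= 64^-1 * 2 by apply: ler_pM.
  lra.
have e1 : site_tilt = expR (- (lam * z ^+ 2)) *: (expR \o a).
  apply/funext => p; rewrite /site_tilt /a !fctE/= /GRing.scale/= -expRD; congr expR; ring.
have NEa : N2 (expR \o a) by nice A2.
rewrite /tilt_ratio e1 (meanZ A2 mmu)// ler_wpM2l ?expR_ge0//.
have -> : 1 + 2 * lam * z * (magnetization P (s 0%N) y v ^+ 2 - q) + 64 * lam ^+ 2 * z ^+ 2 =
    gibbs (pmean2 P) (lift (site_potential (s 0%N) y v)) (cst (1 + 64 * lam ^+ 2 * z ^+ 2) + a).
  rewrite (meanD mmu)//; last exact: (fun_cst A2).
  rewrite (mean_cst A2 mmu) /a (meanZ A2 mmu); last by nice A2.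
  rewrite (meanB A2 mmu); [|by nice A2|by nice A2].
  rewrite (mean_cst A2 mmu) (gibbs_lift P (bounded_measurable_site (Ns 0%N) y v) (Ns 0%N) (Ns 0%N)).
  rewrite -/(magnetization P (s 0%N) y v); ring.
apply: (mean_le mmu) => //; first by nice A2.
move=> p; rewrite !fctE/=.
have := expR_taylor2 (a p).
have h2 : `|a p| ^+ 2 * expR `|a p| <= 16 * lam ^+ 2 * `|z| ^+ 2 * 4.
  apply: ler_pM; rewrite ?exprn_ge0 ?expR_ge0//.
    have -> : 16 * lam ^+ 2 * `|z| ^+ 2 = (4 * lam * `|z|) ^+ 2 by ring.
    by rewrite lerXn2r ?nnegrE ?mulr_ge0.
  by apply: le_trans expR1_le4; rewrite ler_expR.
move=> h1; have := le_trans h1 h2; rewrite real_normK ?num_real// ler_norml => /andP[_].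
lra.
Qed.

End Tilt.

Lemma grid_near (M : nat) (x : R) : (0 < M)%N -> `|x| <= 2 ->
  exists2 j, j \in iota 0 (4 * M + 1) & `|x - (j%:R / M%:R - 2)| <= M%:R^-1.
Proof.
move=> M0 x2; have MR : 0 < M%:R :> R by rewrite ltr0n.
have h0 : 0 <= (x + 2) * M%:R.
  by rewrite mulr_ge0 ?ler0n//; move: x2; rewrite ler_norml; lra.
set k := Num.floor ((x + 2) * M%:R).
have k0 : (0 <= k)%R by rewrite /k floor_ge0.
have k1 : (k <= (4 * M)%:Z)%R.
  rewrite -(ler_int R); apply: le_trans (floor_le _) _.
  rewrite -[(4 * M)%:Z%:~R]/((4 * M)%:R) natrM ler_wpM2r ?ler0n//.
  by move: x2; rewrite ler_norml; lra.
have kR : (absz k)%:R = k%:~R :> R by rewrite natr_absz ger0_norm.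
exists (absz k); first by rewrite mem_iota; lia.
have l1 := floor_le ((x + 2) * M%:R); have l2 := floorD1_gt ((x + 2) * M%:R).
rewrite -/k intrD in l1 l2; rewrite kR.
have -> : x - (k%:~R / M%:R - 2) = ((x + 2) * M%:R - k%:~R) / M%:R.
  by field; rewrite gt_eqF.
rewrite normrM normfV (gtr0_norm MR) ler_piMl ?invr_ge0 ?ler0n//.
by rewrite ger0_norm ?subr_ge0//; lra.
Qed.

(** The tangent line to the concave logarithm at c. Being affine in y, it passes through a Markov
    operator, and it costs nothing when the average of y is at most c. *)
Lemma ln_le_affine (y c : R) : 0 < y -> 0 < c -> ln y <= ln c + (y / c - 1).
Proof.
move=> y0 c0; have yc : 0 < y / c by rewrite divr_gt0.
have : ln (y / c) <= y / c - 1.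
  by rewrite -ler_expR lnK ?posrE//; have := expR_ge1Dx (y / c - 1); rewrite addrCA subrr addr0.
by rewrite ln_div ?posrE//; lra.
Qed.

Section Bound.
Context (n M : nat) (t q h r : R) (K : nat).
Hypotheses (n0 : (0 < n)%N) (M0 : (0 < M)%N) (t0 : 0 <= t) (t1 : 3 * t <= 64^-1).
Hypotheses (q01 : 0 <= q <= 1) (rK : K%:R * r ^+ 2 = 1).
Let nR : 0 < n%:R :> R. Proof. by rewrite ltr0n. Qed.
Let MR : 0 < M%:R :> R. Proof. by rewrite ltr0n. Qed.
Let q0 : 0 <= q. Proof. by case/andP: q01. Qed.
Let c := r * Num.sqrt (2 * q * t).
Let lam := 3 * t.
Let lam0 : 0 <= lam <= 64^-1. Proof. by rewrite mulr_ge0. Qed.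
Let G0 := field_potential sigma n (fun=> h) 0.

Definition walk_magnetization : R :=
  iter K (walk_step c) (fun y => magnetization P (s 0%N) y (- (q * t)) ^+ 2) h.

Let gap := `|walk_magnetization - q|.
Let grid j : R := j%:R / M%:R - 2.

Let grid_le j : j \in iota 0 (4 * M + 1) -> `|grid j| <= 2.
Proof.
rewrite mem_iota add0n => /andP[_ jM].
have h1 : j%:R / M%:R <= 4 :> R.
  by rewrite ler_pdivrMr// -natrM ler_nat; lia.
have h0 : 0 <= j%:R / M%:R :> R by rewrite divr_ge0.
by rewrite /grid ler_norml; lra.
Qed.

(** The upper bound is affine in the squared magnetization, so the walk can be applied to it
    directly. It equals 1 when the walk average of the squared magnetization is exactly q, and this
    is where the fixed point equation matters. *)
Let walk_tilt j : j \in iota 0 (4 * M + 1) ->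
  0 <= iter K (walk_step c) (tilt_ratio q lam (grid j) ^~ (- (q * t))) h <=
  expR (4 * lam * gap).
Proof.
move=> jM; have z2 := grid_le jM; set z := grid j in z2 *.
have /andP[l0 l1] := lam0.
apply/andP; split.
  rewrite -[leLHS](walk_cst K c 0 h); apply: walk_le => y; exact: tilt_ratio_ge0.
pose e := expR (- (lam * z ^+ 2)).
pose a := e * (2 * lam * z); pose b := e * (1 - 2 * lam * z * q + 64 * lam ^+ 2 * z ^+ 2).
apply: (@le_trans _ _ (a * walk_magnetization + b)).
  rewrite -walk_affine; apply: walk_le => y.
  apply: le_trans (tilt_ratio_le _ _ _ _ _) _ => //.
  by rewrite /a /b -/e le_eqVlt; apply/orP; left; apply/eqP; ring.
have -> : a * walk_magnetization + b = e *
    (1 + (2 * lam * z * (walk_magnetization - q) + 64 * lam ^+ 2 * z ^+ 2)).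
  by rewrite /a /b; ring.
apply: le_trans (ler_wpM2l (expR_ge0 _) (expR_ge1Dx _)) _.
rewrite -expRD ler_expR.
(* Here the temperature has to be high: for lam <= 1/64 the second-order term is absorbed by the
   Gaussian factor exp(- lam z^2). *)
have l64 : 64 * lam ^+ 2 * z ^+ 2 <= lam * z ^+ 2.
  have -> : 64 * lam ^+ 2 * z ^+ 2 = (64 * lam) * (lam * z ^+ 2) by ring.
  apply: ler_piMl; first by apply: mulr_ge0 (sqr_ge0 _).
  by move: l1; lra.
have : 2 * lam * z * (walk_magnetization - q) <= 4 * lam * gap.
  apply: le_trans (ler_norm _) _; rewrite -/gap normrM ler_wpM2r//.
  rewrite normrM (ger0_norm (x := 2 * lam)) ?mulr_ge0//.
  have -> : 4 * lam = 2 * lam * 2 by ring.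
  by rewrite ler_wpM2l ?mulr_ge0.
lra.
Qed.

Let Psi j G := gibbs (pmean2 P) (lift G) (tilt n q lam (grid j)).

(** Deviations lie in [-2, 2], and the grid point nearest to the deviation loses at most 1/M^2 in
    the square; the other terms of the sum are nonnegative. *)
Let coupled_le G : N G ->
  coupled_energy P s n q lam G - 2 * free_energy (pmean P) G <=
  lam * n%:R / M%:R ^+ 2 + ln (\sum_(j <- iota 0 (4 * M + 1)) Psi j G)
  /\ 0 < \sum_(j <- iota 0 (4 * M + 1)) Psi j G.
Proof.
move=> NG; have NlG := bounded_measurable_lift NG.
have mmu := gibbs_is_mean A2 mm2 NlG.
have /andP[l0 l1] := lam0.
have Nd := bounded_measurable_overlap_dev n q Ns.
have Nt j := bounded_measurable_tilt n q lam (grid j).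
have NE := fun_exp A2 (fun_scale A2 (lam * n%:R) Nd).
have -> : 2 * free_energy (pmean P) G = free_energy (pmean2 P) (lift G).
  rewrite /free_energy.
  have -> : expR \o lift G = fun z => (expR \o G) z.1 * (expR \o G) z.2.
    by apply/funext => z; rewrite /= /lift expRD.
  have NEG := fun_exp A NG.
  rewrite (pmean2_prod P NEG NEG).
  by rewrite lnM ?posrE ?(mean_expR_gt0 A mm)//; ring.
rewrite /coupled_energy (free_energyD A2 mm2)//; last by nice A2.
set mu := gibbs (pmean2 P) (lift G) in mmu *.
have e0 : expR (lam * n%:R / M%:R ^+ 2) > 0 by exact: expR_gt0.
have hp : mu (expR \o ((lam * n%:R) *: overlap_dev s n q)) <=
    expR (lam * n%:R / M%:R ^+ 2) * \sum_(j <- iota 0 (4 * M + 1)) Psi j G.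
  have -> : \sum_(j <- iota 0 (4 * M + 1)) Psi j G =
      mu (\sum_(j <- iota 0 (4 * M + 1)) tilt n q lam (grid j)).
    by rewrite (mean_sum A2 mmu).
  have NS : N2 (\sum_(j <- iota 0 (4 * M + 1)) tilt n q lam (grid j)) by exact: (fun_sum A2).
  rewrite -(meanZ A2 mmu)//; apply: (mean_le mmu) => //; first exact: (fun_scale A2).
  move=> p; rewrite !fctE/= /GRing.scale/= /overlap_dev.
  set x := pair_overlap s n p - q.
  have x2 : `|x| <= 2.
    have /andP[_ q1] := q01.
    apply: le_trans (ler_normB _ _) _; rewrite (ger0_norm q0).
    suff : `|pair_overlap s n p| <= 1 by lra.
    rewrite /pair_overlap normrM normfV (gtr0_norm nR) mulrC ler_pdivrMr// mul1r.
    apply: le_trans (ler_norm_sum _ _ _) _.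
    apply: (@le_trans _ _ (\sum_(i <- iota 0 n) 1)).
      by apply: ler_sum => i _; rewrite normrM mulr_ile1.
    by rewrite big_const_seq count_predT size_iota iter_addr_0.
  have [j jM xj] := grid_near M0 x2; rewrite -/(grid j) in xj.
  rewrite fct_sumE (bigD1_seq j jM (iota_uniq _ _))/=.
  apply: (@le_trans _ _ (expR (lam * n%:R / M%:R ^+ 2) * tilt n q lam (grid j) p)).
    rewrite /tilt -/x -expRD ler_expR -mulrDr ler_wpM2l ?mulr_ge0//.
    have : (x - grid j) ^+ 2 <= (M%:R ^+ 2)^-1.
      rewrite -real_normK ?num_real// -exprVn lerXn2r ?nnegrE ?invr_ge0//.
    by have -> : (x - grid j) ^+ 2 = x ^+ 2 - (2 * grid j * x - grid j ^+ 2); [ring|lra].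
  rewrite ler_wpM2l ?expR_ge0// lerDl; apply: sumr_ge0 => i _; exact: expR_ge0.
have mp : 0 < mu (expR \o ((lam * n%:R) *: overlap_dev s n q)).
  by apply: (mean_expR_gt0 A2 mmu); exact: (fun_scale A2).
have Sp : 0 < \sum_(j <- iota 0 (4 * M + 1)) Psi j G.
  by have := lt_le_trans mp hp; rewrite pmulr_rgt0.
split=> //; rewrite -[X in X + _]expRK -lnM ?posrE//.
by rewrite ler_ln ?posrE// mulr_gt0.
Qed.

(** All sites start in the same field h, so each term of the grid sum is the n-th power of one site
    average, bounded by [walk_tilt]. The three terms are the mesh of the grid, its size, and the
    error of the walk in the fixed point equation. *)
Lemma stage0_bound :
  iter K (rs_block s n t q r)
    (fun G => coupled_energy P s n q (3 * t) G - 2 * free_energy (pmean P) G) G0 <=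
  3 * t * n%:R / M%:R ^+ 2 + ln (4 * M + 1)%:R + 12 * t * n%:R * gap.
Proof.
have mk : markov N (iter K (rs_block s n t q r)).
  apply: markov_iter; apply: markov_scaled_block => i; exact: bounded_measurable_rs.
have NG0 : N G0 by exact: bounded_measurable_field.
pose S G := \sum_(j <- iota 0 (4 * M + 1)) Psi j G.
pose c0 := (4 * M + 1)%:R * expR (4 * lam * gap) ^+ n.
have c00 : 0 < c0 by rewrite mulr_gt0 ?exprn_gt0 ?expR_gt0// ltr0n addn1.
have QS : iter K (rs_block s n t q r) S G0 <= c0.
  have QP j : iter K (rs_block s n t q r) (Psi j) G0 =
      iter K (walk_step c) (tilt_ratio q lam (grid j) ^~ (- (q * t))) h ^+ n.
    rewrite /G0 (rs_block_field_prod r t0 q0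
      (u := fun v y => tilt_ratio q lam (grid j) y v)); last first.
      by move=> y v; exact: gibbs_tilt_field.
    rewrite big_const_seq count_predT size_iota.
    have -> : 0 - K%:R * (r ^+ 2 * (q * t)) = - (q * t) by rewrite mulrA rK mul1r sub0r.
    exact: iter_mulr_1.
  have QSE : iter K (rs_block s n t q r) S G0 =
      \sum_(j <- iota 0 (4 * M + 1)) iter K (rs_block s n t q r) (Psi j) G0.
    rewrite /S; elim: (iota _ _) => [|j l IH].
      rewrite big_nil -[RHS](markov_cst mk 0 G0); congr (iter _ _ _ _).
      by apply/funext => G; rewrite big_nil.
    rewrite big_cons -IH -(markovD _ _ _ mk); congr (iter _ _ _ _).
    by apply/funext => G; rewrite big_cons.
  rewrite QSE; apply: (@le_trans _ _ (\sum_(j <- iota 0 (4 * M + 1)) expR (4 * lam * gap) ^+ n)).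
    rewrite big_seq [leRHS]big_seq; apply: ler_sum => j jM; rewrite QP.
    have /andP[w0 w1] := walk_tilt jM.
    by rewrite lerXn2r ?nnegrE ?expR_ge0.
  by rewrite big_const_seq count_predT size_iota iter_addr_0 /c0 [leRHS]mulr_natl.
have h1 : forall G, N G -> coupled_energy P s n q lam G - 2 * free_energy (pmean P) G <=
    c0^-1 * S G + (lam * n%:R / M%:R ^+ 2 + ln c0 - 1).
  move=> G NG; have [hG S0] := coupled_le NG.
  have := ln_le_affine S0 c00; rewrite -/(S G) in hG *; lra.
have := markov_le mk h1 NG0.
rewrite (markov_lin mk) (markov_cst mk) => h2.
have h3 : c0^-1 * iter K (rs_block s n t q r) S G0 <= 1 by rewrite mulrC ler_pdivrMr// mul1r.
have lc0 : ln c0 = ln (4 * M + 1)%:R + 12 * t * n%:R * gap.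
  rewrite lnM ?posrE ?exprn_gt0 ?expR_gt0 ?ltr0n ?addn1//.
  by rewrite -expRM_natl expRK /lam; congr (_ + _); ring.
by move: h2; rewrite lc0 /lam; lra.
Qed.

End Bound.
End StageZero.

(** * From Gaussian disorder to random signs *)

Section MeanOnAllFunctions.
Context {R : realType} (Av : (R -> R) -> R) (avm : is_mean setT Av).
Implicit Types f g : R -> R.

(** The functions in [setT] are unbounded and form no [fun_algebra], so the elementary facts are
    derived again from [is_mean]. *)
Lemma all_mean_cst c : Av (cst c) = c.
Proof.
have := mean_lin avm (c - 1) (I : setT (cst 1)) (I : setT (cst 1)).
rewrite (mean_cst1 avm) mulr1 subrK => E; rewrite -[RHS]E; congr Av.
by apply/funext => w; rewrite !fctE/= /GRing.scale/= mulr1 subrK.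
Qed.

Lemma all_mean_lin a f g : Av (a *: f + g) = a * Av f + Av g.
Proof. exact: (mean_lin avm). Qed.

Lemma all_mean_half f g : Av (fun y => (f y + g y) / 2) = (Av f + Av g) / 2.
Proof.
have -> : (fun y => (f y + g y) / 2) = 2^-1 *: f + (2^-1 *: g + cst 0).
  by apply/funext => y; rewrite !fctE/= /GRing.scale/=; field.
by rewrite !all_mean_lin all_mean_cst; field.
Qed.

Lemma all_mean_taylor f (f1 f2 C : R) :
  (forall y, `|f y - f 0 - f1 * y - f2 * y ^+ 2| <= C * `|y| ^+ 3) ->
  `|Av f - (f 0 + f1 * Av id + f2 * Av (fun y => y ^+ 2))| <= C * Av (fun y => `|y| ^+ 3).
Proof.
move=> h; pose p := f1 *: (id : R -> R) + (f2 *: (fun y : R => y ^+ 2) + cst (f 0)).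
have pE : Av p = f 0 + f1 * Av id + f2 * Av (fun y => y ^+ 2).
  by rewrite /p !all_mean_lin all_mean_cst; ring.
have le1 (a : R) : (forall y, a * (f y - p y) <= C * `|y| ^+ 3) ->
    a * (Av f - Av p) <= C * Av (fun y : R => `|y| ^+ 3).
  move=> le; have /(mean_le avm I I) : forall y, (a *: f + (- a *: p + cst 0)) y <=
      (C *: (fun y : R => `|y| ^+ 3) + cst 0) y.
    by move=> y; have := le y; rewrite !fctE/= /GRing.scale/=; lra.
  by rewrite !all_mean_lin !all_mean_cst; lra.
have hp y : `|f y - p y| <= C * `|y| ^+ 3.
  have := h y; congr (`|_| <= _); rewrite /p !fctE/= /GRing.scale/=; ring.
rewrite -pE ler_norml; apply/andP; split.
  by have := le1 (-1); rewrite !mulN1r => /(_ _)/wrap[y|]; [have := hp y; rewrite ler_norml mulN1r; lra|lra].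
by have := le1 1; rewrite !mul1r => /(_ _)/wrap[y|]; [have := hp y; rewrite ler_norml mul1r; lra|lra].
Qed.

End MeanOnAllFunctions.

Section WalkMoments.
Context {R : realType} (r : R).

Lemma walk_is_mean k x : is_mean setT (fun f => iter k (walk_step r) f x).
Proof.
split=> [a f g _ _|f g _ _ fg|]; [exact: walk_lin|exact: walk_le|exact: walk_cst].
Qed.

Lemma walk_id k x : iter k (walk_step r) id x = x.
Proof. by elim: k x => [//|k IH] x; rewrite iterS /walk_step !IH; field. Qed.

Lemma walk_sqr k x : iter k (walk_step r) (fun y => y ^+ 2) x = x ^+ 2 + k%:R * r ^+ 2.
Proof.
elim: k x => [|k IH] x; first by rewrite mul0r addr0.
by rewrite iterS /walk_step !IH -natr1; field.
Qed.

Lemma walk_pow4 k x : iter k (walk_step r) (fun y => y ^+ 4) x <=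
  x ^+ 4 + 6 * (k%:R * r ^+ 2) * x ^+ 2 + 3 * (k%:R * r ^+ 2) ^+ 2.
Proof.
elim: k x => [|k IH] x; first by rewrite mul0r expr0n/= !mulr0 mul0r !addr0.
rewrite iterS /walk_step -(natr1 k).
have := IH (x + r); have := IH (x - r).
have k0 : 0 <= k%:R :> R by []. have r0 := sqr_ge0 r.
set K := k%:R in k0 *.
have : 0 <= r ^+ 4 by rewrite (exprM r 2 2) sqr_ge0.
have -> : (K + 1) * r ^+ 2 = K * r ^+ 2 + r ^+ 2 by ring.
rewrite ler_pdivrMr//; lra.
Qed.

(** From |y|^3 <= (y^4 + y^2)/2; at unit variance the fourth moment is at most 3, which gives (3 +
    1)/2 = 2. *)
Lemma walk_norm3 k : k%:R * r ^+ 2 = 1 -> iter k (walk_step r) (fun y => `|y| ^+ 3) 0 <= 2.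
Proof.
move=> kr.
apply: (@le_trans _ _ (iter k (walk_step r) (2^-1 *: (fun y => y ^+ 4) +
    (2^-1 *: (fun y => y ^+ 2) + cst 0)) 0)).
  apply: walk_le => y; rewrite !fctE/= /GRing.scale/= addr0.
  have -> : y ^+ 4 = `|y| ^+ 2 * `|y| ^+ 2.
    by rewrite -exprD -[RHS]normrX ger0_norm// (exprM y 2 2) sqr_ge0.
  rewrite -(real_normK (num_real y)); have := normr_ge0 y.
  move: `|y| => z z0; have := sqr_ge0 (z * (z - 1)).
  by rewrite (exprS z 2); nra.
rewrite !walk_lin walk_cst walk_sqr kr.
have := walk_pow4 k 0; rewrite kr !expr0n/= !mulr0 expr1n mulr1; lra.
Qed.

End WalkMoments.

(** * Exchanging the couplings one at a time *)

Section Replacement.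
Context {R : realType} {d : measure_display} {T : measurableType d}.
Context (P : probability T R).
Notation N := (@bounded_measurable R d T).
Let A : fun_algebra N := bounded_measurable_algebra.
Let mm := pmean_is_mean P.
Let L := free_energy (pmean P).

Lemma conv_markov Av X : is_mean setT Av -> N X -> markov N (conv Av X).
Proof.
move=> avm NX; split=> [a Phi Psi G|Phi Psi h G NG|c G].
- exact: (all_mean_lin avm).
- apply: (mean_le avm) => // y; apply: h.
  by apply: (fun_add A) => //; exact: (fun_scale A).
- exact: (all_mean_cst avm).
Qed.

Lemma commuting_conv_avg Av X X' : is_mean setT Av ->
  commuting (conv Av X) (avg X' : ((T -> R) -> R) -> (T -> R) -> R).
Proof.
move=> avm; rewrite /commuting => Phi; apply/funext => G; rewrite /= /conv /avg.
rewrite -(all_mean_half avm); congr Av.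
by apply/funext => y; rewrite (addrAC G X') (addrAC G (- X')).
Qed.

Lemma iter_avg_walk K X (r : R) Phi (G : T -> R) y :
  iter K (avg (r *: X)) Phi (G + y *: X) =
  iter K (walk_step r) (fun y => Phi (G + y *: X)) y.
Proof.
elim: K y => [//|K IH] y; rewrite (iterS K (avg _)) (iterS K (walk_step r)) /walk_step -(IH (y + r)) -(IH (y - r)).
by rewrite [LHS]/avg -!addrA -scalerBl -scalerDl.
Qed.

(** Along one feature the energy is a function of a real coefficient with a cubic Taylor bound, and
    the walk has moments 0 and 1 and a third absolute moment at most 2. Only the discrepancies of Av
    in the first two moments and the cubic remainders are left. *)
Lemma conv_walk_near Av X (b r e1 e2 c3 : R) K G : is_mean setT Av -> N X ->
  (forall w, `|X w| <= b) -> 0 <= b -> K%:R * r ^+ 2 = 1 ->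
  `|Av id| <= e1 -> `|Av (fun y => y ^+ 2) - 1| <= e2 -> Av (fun y => `|y| ^+ 3) <= c3 ->
  N G ->
  `|conv Av X L G - iter K (avg (r *: X)) L G| <=
    b * e1 + b ^+ 2 * e2 + 200 * b ^+ 3 * (c3 + 2).
Proof.
move=> avm NX hX b0 rK h1 h2 h3 NG.
pose f y := L (G + y *: X).
have mmu := gibbs_is_mean A mm NG; set mu := gibbs (pmean P) G in mmu.
pose f1 := mu X; pose f2 := (mu (X ^+ 2) - mu X ^+ 2) / 2.
have hX2 w : 0 <= (X ^+ 2) w <= b ^+ 2.
  by rewrite fctE sqr_ge0/= -real_normK ?num_real// lerXn2r ?nnegrE.
have f1b : `|f1| <= b by exact: (mean_norm_le A mmu).
have f2b : `|f2| <= b ^+ 2.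
  have a1 : 0 <= mu (X ^+ 2) <= b ^+ 2.
    have NX2 : N (X ^+ 2) by nice A.
    by rewrite (mean_ge A mmu) ?(mean_ub A mmu)// => w; have /andP[] := hX2 w.
  have a2 : 0 <= mu X ^+ 2 <= b ^+ 2.
    by rewrite sqr_ge0/= -real_normK ?num_real// lerXn2r ?nnegrE.
  by rewrite ler_norml /f2; lra.
have tay y : `|f y - f 0 - f1 * y - f2 * y ^+ 2| <= 200 * b ^+ 3 * `|y| ^+ 3.
  have NyX : N (y *: X) by nice A.
  have hy w : `|(y *: X) w| <= b * `|y|.
    by rewrite fctE normrM mulrC ler_wpM2r.
  have := free_energy_expansion A mm NG NyX hy.
  rewrite exprMn mulrA; apply: le_trans; rewrite le_eqVlt; apply/orP; left; apply/eqP.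
  congr Num.norm; rewrite /f scale0r addr0 /cumulant2 -/mu (meanZ A mmu)//.
  have -> : (y *: X) ^+ 2 = y ^+ 2 *: X ^+ 2.
    by apply/funext => w; rewrite !fctE/= /GRing.scale/= exprMn.
  rewrite (meanZ A mmu); last by nice A.
  by rewrite /f1 /f2 /L; field.
have t1 := all_mean_taylor avm tay.
have t2 := all_mean_taylor (walk_is_mean r K 0) tay.
have e : iter K (avg (r *: X)) L G = iter K (walk_step r) f 0.
  by rewrite -(iter_avg_walk K X r L G 0) scale0r addr0.
rewrite e -[conv Av X L G]/(Av f).
move: t2; rewrite walk_id walk_sqr rK expr0n/= add0r mulr0 addr0 mulr1 => t2.
have b3 : 0 <= 200 * b ^+ 3 by rewrite mulr_ge0 ?exprn_ge0.
have w3 := walk_norm3 rK.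
have g1 : 200 * b ^+ 3 * Av (fun y => `|y| ^+ 3) <= 200 * b ^+ 3 * c3 by rewrite ler_wpM2l.
have g2 : 200 * b ^+ 3 * iter K (walk_step r) (fun y => `|y| ^+ 3) 0 <= 200 * b ^+ 3 * 2.
  by rewrite ler_wpM2l.
have g3 : `|f1 * Av id| <= b * e1 by rewrite normrM; apply: ler_pM.
have g4 : `|f2 * (Av (fun y => y ^+ 2) - 1)| <= b ^+ 2 * e2 by rewrite normrM; apply: ler_pM.
rewrite [_ * (c3 + 2)]mulrDr.
move: t1 t2 g3 g4; rewrite mulrBr mulr1 !ler_norml.
lra.
Qed.

(** In each hybrid the exchanged coupling is commuted next to [L], where the one-coupling estimate
    holds; the operators around it are Markov and do not amplify the error. *)
Lemma convs_walk_near (I : eqType) (s : seq I) (Av : I -> (R -> R) -> R) (F : I -> T -> R) K (r e : R) :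
  (forall i, is_mean setT (Av i)) -> (forall i, N (F i)) ->
  (forall i G, i \in s -> N G -> `|conv (Av i) (F i) L G - iter K (avg (r *: F i)) L G| <= e) ->
  forall G, N G -> `|convs s Av F L G -
    foldr (fun i Q => iter K (avg (r *: F i)) \o Q) id s L G| <= (size s)%:R * e.
Proof.
move=> avm NF; elim: s => [|i s IH] h G NG; first by rewrite /= subrr normr0 mul0r.
have {}IH := IH (fun j G js => h j G (mem_behead (s := i :: s) js)).
rewrite [size _]/= -natr1 mulrDl mul1r /=.
have mkc := conv_markov (avm i) (NF i).
have NrF j : N (r *: F j) by exact: (fun_scale A).
have mks : markov N (foldr (fun i Q => iter K (avg (r *: F i)) \o Q) id s).
  elim: (s) => [|j l mkl]; first exact: markov_id.
  apply: markov_comp => //; apply: markov_iter; exact: (markov_avg A).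
have cc : commuting (conv (Av i) (F i)) (foldr (fun i Q => iter K (avg (r *: F i)) \o Q) id s).
  by apply: commuting_foldr => j; apply: commuting_iter; exact: commuting_conv_avg.
have cs : commuting (iter K (avg (r *: F i)))
    (foldr (fun i Q => iter K (avg (r *: F i)) \o Q) id s).
  apply: commuting_foldr => j; apply: commuting_iter; apply: commuting_sym.
  by apply: commuting_iter; exact: commuting_avg.
have d1 := markov_near mkc IH NG.
have d2 := markov_near mks (fun G => h i G (mem_head i s)) NG.
rewrite cs; rewrite -cc in d2.
move: d1 d2; rewrite !ler_norml; lra.
Qed.

(** By commutation K mixed steps regroup into K signs per feature, and the K drifts of size r^2 add
    up to V. *)
Lemma iter_block I (s : seq I) (F : I -> T -> R) V K (r : R) Phi G :
  K%:R * r ^+ 2 = 1 ->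
  iter K (block s (fun i => r *: F i) (r ^+ 2 *: V)) Phi G =
  foldr (fun i Q => iter K (avg (r *: F i)) \o Q) id s Phi (G + V).
Proof.
move=> rK; rewrite /block iter_comp; last first.
  apply: commuting_foldr => i; apply: commuting_sym; exact: commuting_avg_shift.
have -> : iter K (shift (r ^+ 2 *: V)) = shift V.
  apply/funext => Psi; apply/funext => H.
  suff -> : forall k, iter k (shift (r ^+ 2 *: V)) Psi = shift ((k%:R * r ^+ 2) *: V) Psi.
    by rewrite rK scale1r.
  elim=> [|k IH]; first by rewrite mul0r scale0r; apply/funext => H'; rewrite /shift addr0.
  rewrite iterS IH; apply/funext => H'; rewrite /shift -addrA -scalerDl -natr1.
  by congr (Psi (_ + _ *: _)); ring.
rewrite /= /shift.
suff -> : iter K (avgs s (fun i => r *: F i)) =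
    foldr (fun i Q => iter K (avg (r *: F i)) \o Q) id s by [].
elim: s => [|i s IH].
  by apply/funext => Psi; rewrite /=; elim: K {rK} => //= k ->.
rewrite -[avgs (i :: s) _]/(avg (r *: F i) \o avgs s (fun i => r *: F i)) iter_comp ?IH//.
by apply: commuting_foldr => j; exact: commuting_avg.
Qed.

End Replacement.

Lemma le_of_invn_bound {R : realType} (x y c : R) :
  (forall M, (0 < M)%N -> x <= y + c / M%:R) -> x <= y.
Proof.
move=> h; rewrite -subr_le0; set z := x - y.
have : Num.max z 0 = 0.
  apply: (@eq_of_invn_bound _ _ _ `|c|) => M M0; have := h M M0.
  have cM : c / M%:R <= `|c| / M%:R by rewrite ler_wpM2r ?invr_ge0// ler_norm.
  have cM0 : 0 <= `|c| / M%:R by rewrite divr_ge0.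
  rewrite subr0 => xy; rewrite ger0_norm ?le_max ?lexx ?orbT//.
  by rewrite ge_max cM0 andbT /z; lra.
by move=> <-; rewrite le_max lexx.
Qed.

Section GaussianFamily.
Context {R : realType} {d : measure_display} {T : measurableType d}.
Context (P : probability T R) (X : {RV P >-> R}).
Hypothesis X_law : has_law X (normal_prob 0 1).
Notation gm := (@gaussian_mean R).

Definition integrable_rv : set (T -> R) := [set f : T -> R | P.-integrable setT (EFin \o f)].

Lemma integrable_is_mean : is_mean integrable_rv (pmean P).
Proof.
split=> [a f g Nf Ng|f g Nf Ng fg|].
- rewrite !pmeanE RintegralD//; first by rewrite RintegralZl.
  exact: (integrableZl measurableT a Nf).
- by rewrite !pmeanE le_Rintegral.
- by rewrite /pmean expectation_cst.
Qed.

Lemma integrable_rv_cst c : integrable_rv (cst c).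
Proof. exact: finite_measure_integrable_cst. Qed.

Lemma integrable_rv_lin a f g :
  integrable_rv f -> integrable_rv g -> integrable_rv (a *: f + g).
Proof.
move=> Nf Ng; rewrite /integrable_rv /=.
exact: (integrableD measurableT (integrableZl measurableT a Nf) Ng).
Qed.

(* [normal_prob] lives on [measurableTypeR R], whose display differs from the one
   of the codomain [R] of random variables; [borel_id] mediates between them. *)
Definition borel_id : measurableTypeR R -> R := id.

Let measurable_borel_id : measurable_fun setT borel_id.
Proof. by move=> _ Y mY; rewrite setTI. Qed.

HB.instance Definition _ := isMeasurableFun.Build _ _ _ _ borel_id measurable_borel_id.

Lemma gaussian_rv_integrable f : subexponential f -> integrable_rv (f \o X).
Proof.
move=> Nf; have /integrableP[_ fi] := subexponential_integrable Nf.
have mf : measurable_fun setT f by case: Nf.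
have mfa : measurable_fun setT (fun x => `|(f x)%:E|)%E.
  by apply: measurableT_comp => //; exact/measurable_EFinP.
apply/integrableP; split.
  by apply/measurable_EFinP; exact: measurableT_comp.
move: fi; congr (_ < _)%E.
rewrite -[RHS](@ge0_integral_distribution _ _ _ _ _ P X _ mfa)//.
rewrite -[LHS](@ge0_integral_distribution _ _ _ _ _ (normal_prob 0 1) borel_id _ mfa)//.
by apply: eq_measure_integral => B mB _; rewrite [RHS]X_law.
Qed.

Lemma pmean_gaussian_rv f : subexponential f -> pmean P (f \o X) = gm f.
Proof.
move=> Nf; have mf : measurable_fun setT f by case: Nf.
rewrite pmeanE gaussian_meanE /Rintegral; congr fine.
have mfE : measurable_fun setT (EFin \o f) by exact/measurable_EFinP.
rewrite -[LHS](integral_distribution mfE (gaussian_rv_integrable Nf)).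
rewrite -[RHS](@integral_distribution _ _ _ _ _ (normal_prob 0 1) borel_id _ mfE); last first.
  exact: subexponential_integrable.
by apply: eq_measure_integral => B mB _; rewrite [LHS]X_law.
Qed.

End GaussianFamily.

Section DiscretizedGaussian.
Context {R : realType}.
Notation gm := (@gaussian_mean R).
Implicit Types x : R.

(** One Gaussian-integrable polynomial that dominates the rounding errors of the coupling and of its
    square, as well as the cube of the rounded coupling. *)
Definition majorant x : R := (1 + x ^+ 2) ^+ 3.

Definition majorant_mean : R := gm majorant.

Lemma subexponential_majorant : subexponential majorant.
Proof.
have -> : majorant = 3 *: (fun x => x ^+ 2) + (3 *: (fun x => x ^+ 4) +
    ((fun x => x ^+ 6) + cst 1)).
  by apply/funext => x; rewrite /majorant !fctE/= /GRing.scale/=; ring.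
do 3 (apply: subexponentialD; first by try apply: subexponentialZ; exact: subexponentialX).
exact: subexponential_cst.
Qed.

Lemma majorant_ge1 x : 1 <= 1 + x ^+ 2.
Proof. by rewrite lerDl sqr_ge0. Qed.

Lemma majorant_ge x : 1 + x ^+ 2 <= majorant x.
Proof.
have h := majorant_ge1 x; rewrite /majorant (exprS _ 2) ler_peMr ?(le_trans ler01)//.
by rewrite exprn_ege1.
Qed.

Lemma majorant_ge_sqr x : (1 + x ^+ 2) ^+ 2 <= majorant x.
Proof.
have h := majorant_ge1 x; rewrite /majorant (exprS _ 2) ler_peMl// exprn_ge0//.
by rewrite (le_trans ler01).
Qed.

Lemma majorant_mean_ge0 : 0 <= majorant_mean.
Proof.
rewrite -(gaussian_mean_cst (0 : R)); apply: (mean_le (@gaussian_mean_is_mean R)).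
- exact: subexponential_cst.
- exact: subexponential_majorant.
- by move=> x; apply: le_trans (majorant_ge x); rewrite (le_trans ler01)// majorant_ge1.
Qed.

Lemma disc_near_majorant M x : (0 < M)%N -> `|disc M x - x| <= majorant x / M%:R.
Proof.
move=> M0; rewrite distrC; apply: le_trans (disc_near x M0) _.
by rewrite ler_wpM2r ?invr_ge0// majorant_ge.
Qed.

Lemma disc_norm_le M x : (0 < M)%N -> `|disc M x| <= 2 * (1 + x ^+ 2).
Proof.
move=> M0; have h := disc_near x M0.
have h1 : (1 + x ^+ 2) / M%:R <= 1 + x ^+ 2.
  by rewrite ler_piMr ?(le_trans ler01 (majorant_ge1 x))// invf_le1 ?ltr0n ?ler1n.
have h2 : `|x| <= 1 + x ^+ 2.
  by have := sqr_ge0 (`|x| - 1); have := normr_ge0 x; have := real_normK (num_real x); nra.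
move: h1 h2 h; rewrite !ler_norml; lra.
Qed.

Lemma disc_sqr_near M x : (0 < M)%N ->
  `|disc M x ^+ 2 - x ^+ 2| <= 3 * majorant x / M%:R.
Proof.
move=> M0; rewrite subr_sqr normrM.
have h2 : `|x| <= 1 + x ^+ 2.
  by have := sqr_ge0 (`|x| - 1); have := normr_ge0 x; have := real_normK (num_real x); nra.
have h3 : `|disc M x + x| <= 3 * (1 + x ^+ 2).
  apply: le_trans (ler_normD _ _) _; have := disc_norm_le x M0; lra.
have h4 := disc_near x M0; rewrite distrC in h4.
apply: (@le_trans _ _ ((1 + x ^+ 2) / M%:R * (3 * (1 + x ^+ 2)))).
  by apply: ler_pM.
have -> : (1 + x ^+ 2) / M%:R * (3 * (1 + x ^+ 2)) = 3 * (1 + x ^+ 2) ^+ 2 / M%:R by ring.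
by rewrite ler_wpM2r ?invr_ge0// ler_wpM2l// majorant_ge_sqr.
Qed.

Lemma disc_cube_le M x : (0 < M)%N -> `|disc M x| ^+ 3 <= 8 * majorant x.
Proof.
move=> M0; have -> : 8 * majorant x = (2 * (1 + x ^+ 2)) ^+ 3 by rewrite /majorant; ring.
rewrite lerXn2r ?nnegrE ?disc_norm_le// mulr_ge0//.
exact: le_trans ler01 (majorant_ge1 x).
Qed.

Lemma subexponential_disc (f : R -> R) M C : (0 < M)%N -> measurable_fun setT f ->
  (forall x, `|f (disc M x)| <= C * majorant x) -> subexponential (f \o disc M).
Proof.
move=> M0 mf hf; apply: (subexponential_le _ (subexponentialZ C subexponential_majorant)).
  by apply: measurableT_comp => //; exact: measurable_disc.
by move=> x; exact: hf.
Qed.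

Let subexponential_discX k M : (k <= 3)%N -> (0 < M)%N ->
  subexponential ((fun y : R => `|y| ^+ k) \o disc M).
Proof.
move=> k3 M0; apply: (@subexponential_disc _ M 8) => //.
  by apply: measurable_funX; exact: normr_measurable.
move=> x; rewrite ger0_norm ?exprn_ge0//.
apply: (@le_trans _ _ ((2 * (1 + x ^+ 2)) ^+ k)).
  rewrite lerXn2r ?nnegrE ?disc_norm_le// mulr_ge0//.
  exact: le_trans ler01 (majorant_ge1 x).
have -> : 8 * majorant x = (2 * (1 + x ^+ 2)) ^+ 3 by rewrite /majorant; ring.
apply: ler_weXn2l => //; have := majorant_ge1 x; lra.
Qed.

Lemma gaussian_disc_cube M : (0 < M)%N ->
  gm ((fun y : R => `|y| ^+ 3) \o disc M) <= 8 * majorant_mean.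
Proof.
move=> M0; rewrite /majorant_mean -gaussian_meanZ; last exact: subexponential_majorant.
apply: (mean_le gaussian_mean_is_mean); first exact: subexponential_discX.
  by apply: subexponentialZ; exact: subexponential_majorant.
by move=> x; exact: disc_cube_le.
Qed.

Lemma subexponential_disc_cube M : (0 < M)%N ->
  subexponential ((fun y : R => `|y| ^+ 3) \o disc M).
Proof. exact: subexponential_discX. Qed.

Lemma subexponential_disc_id M : (0 < M)%N -> subexponential (@disc R M).
Proof.
move=> M0; apply: (subexponential_le _ (subexponential_discX (k := 1) isT M0)) => //.
exact: measurable_disc.
Qed.

Lemma subexponential_disc_sqr M : (0 < M)%N ->
  subexponential ((fun y : R => y ^+ 2) \o disc M).
Proof.
move=> M0; apply: (subexponential_le _ (subexponential_discX (k := 2) isT M0)) => //.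
  exact: (measurable_funX 2 (@measurable_disc R M)).
by move=> x; rewrite /= normrX.
Qed.

Let near_mean (f g : R -> R) c : subexponential f -> subexponential g ->
  (forall x, `|f x - g x| <= c * majorant x) -> `|gm f - gm g| <= c * majorant_mean.
Proof.
move=> Nf Ng h; rewrite /majorant_mean -gaussian_meanZ; last exact: subexponential_majorant.
apply: gaussian_mean_near => //.
by apply: subexponentialZ; exact: subexponential_majorant.
Qed.

Lemma gaussian_disc_id M : (0 < M)%N -> `|gm (@disc R M)| <= majorant_mean / M%:R.
Proof.
move=> M0; have := @near_mean (@disc R M) id M%:R^-1 (subexponential_disc_id M0)
  (subexponentialX 1).
rewrite (@gaussian_moments R).1 subr0 mulrC; apply=> x.
by rewrite mulrC; exact: disc_near_majorant.
Qed.

Lemma gaussian_disc_sqr M : (0 < M)%N ->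
  `|gm ((fun y : R => y ^+ 2) \o disc M) - 1| <= 3 * majorant_mean / M%:R.
Proof.
move=> M0; have := @near_mean _ _ (3 / M%:R) (subexponential_disc_sqr M0) (subexponentialX 2).
rewrite (@gaussian_moments R).2 mulrAC; apply=> x.
by rewrite mulrAC; exact: disc_sqr_near.
Qed.

End DiscretizedGaussian.

Section DisorderSwap.
Context {R : realType} {d : measure_display} {T : measurableType d} (P : probability T R).
Context {d' : measure_display} {T' : measurableType d'} (Pg : probability T' R).
Context (I : choiceType) (X : I -> {RV Pg >-> R}) (D : set I).
Hypotheses (indep : mutually_independent D X)
  (X_law : forall i, D i -> has_law (X i) (normal_prob 0 1)).
Notation N := (@bounded_measurable R d T).
Let A : fun_algebra N := bounded_measurable_algebra.
Let mm := pmean_is_mean P.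
Let L := free_energy (pmean P).
Let mmg := integrable_is_mean Pg.
Context (s : seq I) (F : I -> T -> R) (b : R) (G : T -> R).
Hypotheses (us : uniq s) (sD : forall i, i \in s -> D i).
Hypotheses (NF : forall i, N (F i)) (b0 : 0 <= b) (hF : forall i w, `|F i w| <= b).
Hypothesis NG : N G.

Definition disordered_energy (w : T') : R := L (G + \sum_(i <- s) X i w *: F i).

Definition disc_energy M (w : T') : R := L (G + \sum_(i <- s) disc M (X i w) *: F i).

Definition total_majorant (w : T') : R := \sum_(i <- s) majorant (X i w).

Lemma disordered_energy_near M w : (0 < M)%N ->
  `|disordered_energy w - disc_energy M w| <= b / M%:R * total_majorant w.
Proof.
move=> M0; rewrite /disordered_energy /disc_energy.
have -> : G + \sum_(i <- s) X i w *: F i = (G + \sum_(i <- s) disc M (X i w) *: F i) +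
    \sum_(i <- s) (X i w - disc M (X i w)) *: F i.
  rewrite -addrA -big_split/=; congr (_ + _); apply: eq_bigr => i _.
  by rewrite -scalerDl [disc _ _ + _]addrC subrK.
apply: (free_energy_lip A mm).
- apply: (fun_add A) => //; apply: (fun_sum A) => i; exact: (fun_scale A).
- by apply: (fun_sum A) => i; exact: (fun_scale A).
move=> z; rewrite fct_sumE; apply: le_trans (ler_norm_sum _ _ _) _.
rewrite /total_majorant mulr_sumr; apply: ler_sum => i _.
rewrite fctE normrM mulrAC mulrC -mulrA; apply: ler_pM => //.
by rewrite distrC; exact: disc_near_majorant.
Qed.

Lemma bounded_disc_energy M : @bounded_measurable R d' T' (disc_energy M).
Proof. by have [] := pmean_functional_convs indep F L M G us sD. Qed.

Lemma pmean_disc_energy M : pmean Pg (disc_energy M) = convs s (disc_mean X M) F L G.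
Proof. by have [] := pmean_functional_convs indep F L M G us sD. Qed.

Lemma pmean_total_majorant : integrable_rv Pg total_majorant /\
  pmean Pg total_majorant = (size s)%:R * majorant_mean.
Proof.
rewrite (_ : total_majorant = \sum_(i <- s) (majorant \o X i)); last first.
  by apply/funext => w; rewrite fct_sumE.
elim: s sD => [|i l IH] lD.
  rewrite big_nil mul0r; split; first exact: integrable_rv_cst.
  by rewrite /pmean expectation_cst.
have [Nl El] := IH (fun j jl => lD j (mem_behead (s := i :: l) jl)).
have Xi := X_law (lD i (mem_head i l)).
have Ni := gaussian_rv_integrable Xi subexponential_majorant.
rewrite big_cons -(scale1r (majorant \o X i)); split; first exact: integrable_rv_lin.
rewrite (mean_lin mmg)// El (pmean_gaussian_rv Xi subexponential_majorant).
by rewrite mul1r -natr1 mulrDl mul1r addrC.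
Qed.

(** Measurability in the disorder is inherited from the discretized energies, which converge
    pointwise. *)
Lemma measurable_disordered_energy : measurable_fun setT disordered_energy.
Proof.
apply: (@measurable_fun_cvg _ _ _ _ (fun M => disc_energy M.+1)) => [M|w _].
  by case: (bounded_disc_energy M.+1).
apply/cvgrPdist_le => e e0; pose c := b * total_majorant w / e.
exists (Num.bound `|c|) => //= M hM.
apply: le_trans (disordered_energy_near w (ltn0Sn M)) _.
rewrite mulrAC ler_pdivrMr// [leRHS]mulrC -ler_pdivrMr// -/c.
apply: le_trans (ler_norm _) (le_trans (ltW (archi_boundP (normr_ge0 _))) _).
by rewrite ler_nat leqW.
Qed.

Lemma integrable_disordered_energy : integrable_rv Pg disordered_energy.
Proof.
have [K hK] := (bounded_disc_energy 1).2.
have NE : integrable_rv Pg (b *: total_majorant + cst K).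
  by apply: integrable_rv_lin; [case: pmean_total_majorant|exact: integrable_rv_cst].
apply: le_integrable NE => //.
  by apply/measurable_EFinP; exact: measurable_disordered_energy.
move=> w _; rewrite lee_fin !fctE/= /GRing.scale/=; apply: le_trans (ler_norm _).
have := disordered_energy_near w (ltn0Sn 0); rewrite divr1.
have := hK w; rewrite !ler_norml; lra.
Qed.

Lemma pmean_disordered_near M : (0 < M)%N ->
  `|pmean Pg disordered_energy - pmean Pg (disc_energy M)| <=
  b / M%:R * ((size s)%:R * majorant_mean).
Proof.
move=> M0; have [Nt <-] := pmean_total_majorant.
have Nd := integrable_disordered_energy.
have Nc := bounded_measurable_integrable Pg (bounded_disc_energy M).
have N0 := integrable_rv_cst Pg (0 : R).
have c0 : pmean Pg (cst 0) = 0 by rewrite /pmean expectation_cst.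
have h1 c : c = 1 \/ c = -1 -> c * (pmean Pg disordered_energy - pmean Pg (disc_energy M)) <=
    b / M%:R * pmean Pg total_majorant.
  move=> c1; have : pmean Pg (c *: disordered_energy + (- c *: disc_energy M + cst 0)) <=
      pmean Pg ((b / M%:R) *: total_majorant + cst 0).
    apply: (mean_le mmg); try by do ?apply: integrable_rv_lin.
    move=> w; rewrite !fctE/= /GRing.scale/=.
    by have := disordered_energy_near w M0; rewrite ler_norml; case: c1 => ->; lra.
  rewrite !(mean_lin mmg)//; last exact: integrable_rv_lin.
  by rewrite c0; lra.
have := h1 1 (or_introl erefl); have := h1 (-1) (or_intror erefl).
rewrite ler_norml mul1r mulN1r; lra.
Qed.

(** The rounding errors in the energy, the mean and the variance vanish as M grows, while the bound
    on the third moment does not depend on M; so only the cubic mismatch stays. *)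
Lemma disorder_swap K (r : R) : K%:R * r ^+ 2 = 1 ->
  `|pmean Pg disordered_energy -
    foldr (fun i Q => iter K (avg (r *: F i)) \o Q) id s L G| <=
  (size s)%:R * (200 * b ^+ 3 * (8 * majorant_mean + 2)).
Proof.
move=> rK; apply: (@le_of_invn_bound _ _ _
  (b * ((size s)%:R * majorant_mean) +
   (size s)%:R * (b * majorant_mean + b ^+ 2 * (3 * majorant_mean)))) => M M0.
have h1 := pmean_disordered_near M0; rewrite pmean_disc_energy in h1.
have h2 := @convs_walk_near R d T P I s (disc_mean X M) F K r
  (b * (majorant_mean / M%:R) + b ^+ 2 * (3 * majorant_mean / M%:R) +
   200 * b ^+ 3 * (8 * majorant_mean + 2)) (disc_mean_is_mean X M) NF.
have h3 i H : i \in s -> N H ->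
    `|conv (disc_mean X M i) (F i) L H - iter K (avg (r *: F i)) L H| <=
    b * (majorant_mean / M%:R) + b ^+ 2 * (3 * majorant_mean / M%:R) +
    200 * b ^+ 3 * (8 * majorant_mean + 2).
  move=> si NH; have Xi := X_law (sD si).
  apply: conv_walk_near => //; first exact: disc_mean_is_mean.
  - have := @gaussian_disc_id R M M0.
    by rewrite -(pmean_gaussian_rv Xi (subexponential_disc_id M0)).
  - have := @gaussian_disc_sqr R M M0.
    by rewrite -(pmean_gaussian_rv Xi (subexponential_disc_sqr M0)).
  - have := @gaussian_disc_cube R M M0.
    by rewrite -(pmean_gaussian_rv Xi (subexponential_disc_cube M0)).
have {}h2 := h2 h3 G NG.
move: (ler_distD (convs s (disc_mean X M) F L G) (pmean Pg disordered_energy)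
  (foldr (fun i Q => iter K (avg (r *: F i)) \o Q) id s L G)) => h4.
apply: le_trans h4 (le_trans (lerD h1 h2) _).
by rewrite le_eqVlt; apply/orP; left; apply/eqP; ring.
Qed.

End DisorderSwap.

(** * The SK partition function in terms of features *)

Section SKFreeEnergy.
Context {R : realType} {d : measure_display} {T : measurableType d}.
Context (P : probability T R) (sigma : nat -> {RV P >-> R}).
Context {d' : measure_display} {T' : measurableType d'} (Pg : probability T' R).
Context (g : nat -> nat -> {RV Pg >-> R}) (h t : R) (n : nat).
Hypotheses (sigma_bounded : forall i w, -1 <= sigma i w <= 1).
Hypotheses (g_gaussian : gaussian_disorder g) (n0 : (0 < n)%N) (t0 : 0 <= t).
Let s (i : nat) : T -> R := sigma i.
Let L := free_energy (pmean P).
Let G0 := field_potential sigma n (fun=> h) 0.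
Let X (p : nat * nat) : {RV Pg >-> R} := g p.1 p.2.

Lemma sum_ord_iota (f : nat -> R) : \sum_(i < n) f i = \sum_(i <- iota 0 n) f i.
Proof. by rewrite -(big_mkord xpredT f) /index_iota subn0. Qed.

Lemma pairs_sum (a : nat -> nat -> R) : \sum_(p <- pairs n) a p.1 p.2 =
  \sum_(i < n) \sum_(j < n | (i < j)%N) a i j + \sum_(i < n) a i i.
Proof.
rewrite big_filter big_mkcond big_allpairs/= -big_split/=.
rewrite -(sum_ord_iota (fun i => \sum_(j <- iota 0 n) if (i <= j)%N then a i j else 0)).
apply: eq_bigr => i _; rewrite -(sum_ord_iota (fun j => if (i <= j)%N then a i j else 0)).
rewrite -big_mkcond (bigD1 i)//= addrC; congr (_ + _); apply: eq_bigl => j.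
by rewrite ltn_neqAle andbC eq_sym.
Qed.

Lemma overlapE w : overlap (fun i : 'I_n => sigma i w) (fun i : 'I_n => sigma i w) =
  pair_overlap s n (w, w).
Proof. by rewrite /overlap (sum_ord_iota (fun i => sigma i w * sigma i w)). Qed.

Lemma sqrt_sk_coef p : Num.sqrt (t * pair_mult p / n%:R) =
  Num.sqrt t * (if p.1 == p.2 then (Num.sqrt n%:R)^-1 else Num.sqrt (2 / n%:R)).
Proof.
rewrite /pair_mult -mulrA sqrtrM//; case: ifP => _ //.
by rewrite mul1r sqrtrV.
Qed.

Lemma hamiltonianE (a : nat -> nat -> R) w :
  Num.sqrt t * hamiltonian a (fun i : 'I_n => sigma i w) =
  \sum_(p <- pairs n) a p.1 p.2 * sk_feature s n t p w.
Proof.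
rewrite (pairs_sum (fun i j => a i j * sk_feature s n t (i, j) w)) /hamiltonian.
rewrite mulrDr !mulr_sumr; congr (_ + _).
  apply: eq_bigr => i _; rewrite !mulr_sumr; apply: eq_bigr => j ij.
  rewrite /sk_feature sqrt_sk_coef/= (ltn_eqF ij) !fctE/= /GRing.scale/=. rewrite /s; ring.
apply: eq_bigr => i _.
rewrite /sk_feature sqrt_sk_coef/= eqxx !fctE/= /GRing.scale/= /s; ring.
Qed.

(** On the diagonal [cov_sk] says that half the sum of the squared features is (t/2) n times the
    squared self-overlap: the correction in the partition function is precisely the drift. *)
Lemma sk_potentialE (a : nat -> nat -> R) w :
  Num.sqrt t * hamiltonian a (fun i : 'I_n => sigma i w) + h * \sum_(i < n) sigma i w
    - t / 2 * n%:R * overlap (fun i : 'I_n => sigma i w) (fun i : 'I_n => sigma i w) ^+ 2 =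
  (G0 + drift (pairs n) (sk_feature s n t) +
    \sum_(p <- pairs n) a p.1 p.2 *: sk_feature s n t p) w.
Proof.
have nR : 0 < n%:R :> R by rewrite ltr0n.
rewrite hamiltonianE overlapE !fctE fct_sumE /G0 /field_potential fct_sumE.
have -> : drift (pairs n) (sk_feature s n t) w = - (t / 2 * n%:R * pair_overlap s n (w, w) ^+ 2).
  have := cov_sk s n0 t0 (w, w); rewrite /cov /drift => E.
  rewrite !fctE fct_sumE/= /GRing.scale/=.
  have -> : \sum_(i <- pairs n) (sk_feature s n t i ^+ 2) w =
      \sum_(i <- pairs n) sk_feature s n t i w * sk_feature s n t i w.
    by apply: eq_bigr => p _; rewrite fctE expr2.
  by rewrite E; ring.
have -> : h * \sum_(i < n) sigma i w =
    \sum_(i <- iota 0 n) site_potential (sigma i) h 0 w.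
  rewrite (sum_ord_iota (fun i => sigma i w)) mulr_sumr; apply: eq_bigr => i _.
  by rewrite /site_potential !fctE/= /GRing.scale/= mul0r addr0.
have -> : \sum_(i <- pairs n) (a i.1 i.2 *: sk_feature s n t i) w =
    \sum_(p <- pairs n) a p.1 p.2 * sk_feature s n t p w by [].
ring.
Qed.

Lemma mean_free_energyE : n%:R * mean_free_energy sigma h g n t =
  pmean Pg (disordered_energy P X (pairs n) (sk_feature s n t)
    (G0 + drift (pairs n) (sk_feature s n t))).
Proof.
have nN : n%:R != 0 :> R by rewrite pnatr_eq0 -lt0n.
rewrite /mean_free_energy mulrA divff// mul1r; congr (fine (expectation _ _)).
apply/funext => w; rewrite /disordered_energy /free_energy /partition_function /pmean.
congr (ln (fine (expectation _ _))); apply/funext => z /=.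
by congr expR; exact: sk_potentialE.
Qed.

Lemma size_pairs_le : (size (pairs n) <= n * n)%N.
Proof.
by rewrite size_filter (leq_trans (count_size _ _))// size_allpairs size_iota.
Qed.

(* The bound is O(sqrt n) and does not depend on [K]. *)
Lemma sk_free_energy_near K (r : R) : K%:R * r ^+ 2 = 1 ->
  `|n%:R * mean_free_energy sigma h g n t - iter K (sk_block s n t r) L G0| <=
  (n * n)%:R * (200 * Num.sqrt (t * 2 / n%:R) ^+ 3 * (8 * majorant_mean + 2)).
Proof.
move=> rK; rewrite mean_free_energyE /sk_block iter_block//.
have hs i w : `|s i w| <= 1 by exact: spin_norm_le.
have Ns i : bounded_measurable (s i) by exact: bounded_measurable_spin.
have NF p := bounded_measurable_sk n t Ns p.
have b0 := sqrtr_ge0 (t * 2 / n%:R).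
have [gi gl] := g_gaussian.
have mm0 := @majorant_mean_ge0 R.
apply: le_trans (_ : (size (pairs n))%:R * _ <= _); last first.
  apply: ler_wpM2r; last by rewrite ler_nat size_pairs_le.
  by rewrite !mulr_ge0 ?exprn_ge0 ?addr_ge0 ?mulr_ge0.
apply: (@disorder_swap _ _ _ P _ _ Pg _ X _ gi) => //.
- by move=> p /= ij; exact: gl.
- by rewrite filter_uniq// allpairs_uniq ?iota_uniq// => -[? ?] [? ?].
- by move=> p; rewrite mem_filter => /andP[].
- by move=> p w; exact: sk_feature_norm_le.
- apply: (fun_add bounded_measurable_algebra); first exact: bounded_measurable_field.
  exact: bounded_measurable_drift.
Qed.

End SKFreeEnergy.

(** * The replica symmetric equation and the limit *)

(** Only the squares K = M^2 are used, for which the root is an integer. *)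
Lemma le_of_invsqrt_bound {R : realType} (x y C : R) :
  (forall K, (0 < K)%N -> x <= y + (Num.sqrt K%:R)^-1 * C) -> x <= y.
Proof.
move=> h; apply: (@le_of_invn_bound _ _ _ C) => M M0.
have := h (M * M)%N; rewrite muln_gt0 M0 => /(_ isT).
by rewrite natrM -expr2 sqrtr_sqr ger0_norm// mulrC.
Qed.

(** M is chosen first, from C, and the threshold for n afterwards, from B M. *)
Lemma cvg_of_two_scale_bound {R : realType} (u : nat -> R) (l C : R) (B : nat -> R) :
  (forall n M, (0 < n)%N -> (0 < M)%N -> `|u n - l| <= C / M%:R + B M / n%:R) ->
  u n @[n --> \oo] --> l.
Proof.
move=> h; apply/cvgrPdist_le => e e0.
pose M := (Num.bound (`|C| / (e / 2))).+1; pose n0 := (Num.bound (`|B M| / (e / 2))).+1.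
have bnd c k : (Num.bound (`|c| / (e / 2)) < k)%N -> c / k%:R <= e / 2.
  move=> ck; have k0 : 0 < k%:R :> R by rewrite ltr0n (leq_trans _ ck).
  have e2 : 0 < e / 2 by rewrite divr_gt0.
  rewrite ler_pdivrMr// [leRHS]mulrC -ler_pdivrMr//.
  apply: (@le_trans _ _ (`|c| / (e / 2))).
    by apply: ler_wpM2r; [rewrite invr_ge0 ltW|exact: ler_norm].
  apply: le_trans (ltW (archi_boundP _)) _; first by rewrite divr_ge0// ltW.
  by rewrite ler_nat ltnW.
exists n0 => //= n nn; rewrite distrC.
have n1 : (0 < n)%N by apply: leq_trans nn.
apply: le_trans (h n M n1 (ltn0Sn _)) _.
have := bnd C M (ltnSn _); have := bnd (B M) n nn; lra.
Qed.

Lemma pmean_symmetric {R : realType} {d : measure_display} {T : measurableType d}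
    (P : probability T R) (X : {RV P >-> R}) : symmetric_rv X ->
  (forall w, `|X w| <= 1) -> pmean P X = 0.
Proof.
move=> symX hX.
have NX : bounded_measurable X by split; [exact: measurable_funP|exists 1].
pose Y : {mfun T >-> R} := - (X : {mfun T >-> R}).
have NY : bounded_measurable Y.
  by split; [exact: measurable_funP|exists 1 => w; rewrite [Y w]/(- X w) normrN].
have mi : measurable_fun setT (EFin : R -> \bar R) by [].
have E : pmean P X = pmean P Y.
  rewrite !pmeanE /Rintegral; congr fine.
  rewrite -[LHS](integral_distribution mi (bounded_measurable_integrable P NX)).
  rewrite -[RHS](@integral_distribution _ _ _ _ _ P Y _ mi (bounded_measurable_integrable P NY)).
  by apply: eq_measure_integral => B mB _; exact: symX.
have EY : pmean P Y = - pmean P X.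
  rewrite -mulN1r -(meanZ bounded_measurable_algebra (pmean_is_mean P))//.
  by congr pmean; apply/funext => w; rewrite !fctE/= /GRing.scale/= mulN1r.
lra.
Qed.

Section ReplicaSymmetric.
Context {R : realType} {d : measure_display} {T : measurableType d}.
Context (P : probability T R) (sigma : nat -> {RV P >-> R}) (h : R).
Hypotheses (sigma_iid : iid sigma) (sigma_sym : forall i, symmetric_rv (sigma i)).
Hypotheses (sigma_bounded : forall i w, -1 <= sigma i w <= 1).
Notation gm := (@gaussian_mean R).
Let s (i : nat) : T -> R := sigma i.
Let hs i w : `|s i w| <= 1 := spin_norm_le sigma_bounded i w.
Let Ns i : bounded_measurable (s i) := bounded_measurable_spin sigma_bounded i.
Let L := free_energy (pmean P).
Let mag2 v y := magnetization P (s 0%N) y v ^+ 2.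

Lemma phiE u v : phi sigma u v = site_energy P (s 0%N) u v.
Proof. by []. Qed.

Lemma qlinE x : qlin sigma h x = heat (Num.sqrt x) (mag2 (- x / 2)) h.
Proof.
rewrite /qlin /heat; congr gaussian_mean; apply/funext => g.
rewrite (mulrC (Num.sqrt x) g) /mag2.
by rewrite -(derive1_site_energy P (Ns 0%N) (hs 0%N) (h + g * Num.sqrt x) (- x / 2)).
Qed.

Lemma replica_symmetric_energyE t q : replica_symmetric_energy sigma h t q =
  t / 2 * q ^+ 2 + heat (Num.sqrt (2 * q * t)) (site_energy P (s 0%N) ^~ (- (q * t))) h.
Proof.
rewrite /replica_symmetric_energy /heat; congr (_ + gaussian_mean _).
by apply/funext => g; rewrite phiE (mulrC g).
Qed.

Let mag2_lip v x y : `|mag2 v x - mag2 v y| <= 64 * `|x - y|.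
Proof.
have := magnetization_sqr_lipschitz P (Ns 0%N) (hs 0%N) x y v v.
by rewrite subrr normr0 addr0.
Qed.

Let mag2_01 v x : 0 <= mag2 v x <= 1.
Proof.
rewrite sqr_ge0 /mag2 -real_normK ?num_real// exprn_ile1//.
exact: magnetization_norm_le.
Qed.

Lemma qlin01 x : 0 <= qlin sigma h x <= 1.
Proof.
have N1 := subexponential_lipschitz (mag2_lip (- x / 2)) h (Num.sqrt x).
rewrite qlinE /heat -{1}(gaussian_mean_cst (0 : R)) -{3}(gaussian_mean_cst (1 : R)).
by apply/andP; split; apply: (mean_le (@gaussian_mean_is_mean R)) => //;
  do ?[exact: subexponential_cst]; move=> y; have /andP[] := mag2_01 (- x / 2) (h + Num.sqrt x * y).
Qed.

Lemma qlin_near x y : `|qlin sigma h x - qlin sigma h y| <=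
  64 * (`|Num.sqrt x - Num.sqrt y| * gm (fun g => `|g| ^+ 1) + `|x - y| / 2).
Proof.
have N1 := subexponential_lipschitz (mag2_lip (- x / 2)) h (Num.sqrt x).
have N2 := subexponential_lipschitz (mag2_lip (- y / 2)) h (Num.sqrt y).
have N3 := @subexponential_normX R 1.
rewrite !qlinE /heat.
pose b := (64 * `|Num.sqrt x - Num.sqrt y|) *: (fun g : R => `|g| ^+ 1) + cst (32 * `|x - y|).
have Nb : subexponential b.
  by apply: subexponentialD; [exact: subexponentialZ|exact: subexponential_cst].
have -> : 64 * (`|Num.sqrt x - Num.sqrt y| * gm (fun g => `|g| ^+ 1) + `|x - y| / 2) = gm b.
  rewrite /b gaussian_meanD; [|exact: subexponentialZ|exact: subexponential_cst].
  by rewrite gaussian_meanZ// gaussian_mean_cst; field.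
apply: gaussian_mean_near => // g.
apply: le_trans (magnetization_sqr_lipschitz P (Ns 0%N) (hs 0%N) _ _ _ _) _.
rewrite /b !fctE/= /GRing.scale/= expr1.
have -> : h + Num.sqrt x * g - (h + Num.sqrt y * g) = (Num.sqrt x - Num.sqrt y) * g by ring.
have -> : - x / 2 - - y / 2 = - ((x - y) / 2) by ring.
rewrite normrN !normrM (@ger0_norm _ 2^-1)//; lra.
Qed.

Lemma qlin_continuous : continuous (qlin sigma h).
Proof.
move=> x; apply/cvgrPdist_le => e e0.
pose b y := 64 * (`|Num.sqrt x - Num.sqrt y| * gm (fun g => `|g| ^+ 1) + `|x - y| / 2).
have b0 : b y @[y --> x] --> (0 : R).
  have -> : (0 : R) = b x by rewrite /b !subrr normr0 !mul0r addr0 mulr0.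
  apply: cvgM; first exact: cvg_cst.
  apply: cvgD; (apply: cvgM; last exact: cvg_cst); apply: cvg_norm.
    by apply: cvgB; [exact: cvg_cst|exact: sqrt_continuous].
  by apply: cvgB; [exact: cvg_cst|exact: cvg_id].
have /cvgrPdist_le /(_ e e0) := b0.
apply: filterS => y; rewrite sub0r normrN => hb.
apply: le_trans (qlin_near x y) _; exact: le_trans (ler_norm _) hb.
Qed.

(** As [qlin] takes values in [0, 1], the continuous function q - [qlin](2 q t) changes sign on
    [0, 1]. *)
Lemma qlin_fixed_point t : exists q, 0 <= q /\ qlin sigma h (2 * q * t) = q.
Proof.
pose F q := q - qlin sigma h (2 * q * t).
have cF : continuous F.
  move=> q; apply: cvgB; first exact: cvg_id.
  apply: continuous_cvg; first exact: qlin_continuous.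
  apply: cvgM; last exact: cvg_cst.
  by apply: cvgM; [exact: cvg_cst|exact: cvg_id].
have /andP[a0 _] := qlin01 (2 * 0 * t); have /andP[_ b1] := qlin01 (2 * 1 * t).
have [] := @IVT R F 0 1 0 ler01 _ _.
- exact: continuous_subspaceT.
- by rewrite ge_min le_max /F sub0r oppr_le0 a0 subr_ge0 b1 orbT.
move=> q; rewrite in_itv/= => /andP[q0 q1] /eqP; rewrite subr_eq0 => /eqP qE.
by exists q.
Qed.

Lemma qlin_fixed_point_le1 t q : qlin sigma h (2 * q * t) = q -> 0 <= q <= 1.
Proof. by move=> <-; exact: qlin01. Qed.

Section FixedPoint.
Context (t q : R).
Hypotheses (t0 : 0 <= t) (t1 : 3 * t <= 64^-1) (qE : qlin sigma h (2 * q * t) = q).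
Let q01 : 0 <= q <= 1 := qlin_fixed_point_le1 qE.
Let c := Num.sqrt (2 * q * t).
Let c0 : 0 <= c := sqrtr_ge0 _.
Let q0 : 0 <= q. Proof. by case/andP: q01. Qed.

Let mag2E : heat c (mag2 (- (q * t))) h = q.
Proof.
have E : - (q * t) = - (2 * q * t) / 2 by field.
by rewrite E -qlinE.
Qed.

Let rK K : (0 < K)%N -> K%:R * (Num.sqrt K%:R)^-1 ^+ 2 = 1 :> R.
Proof.
move=> K0; rewrite exprVn sqr_sqrtr// divff// pnatr_eq0 -lt0n//.
Qed.

(** K steps of size r c have total width c, and K r^3 = r turns the sum of the errors into one of
    order r. *)
Lemma scaled_walk_heat (f a b : R -> R) (C1 C : R) K : (0 < K)%N ->
  (forall x y, `|f x - f y| <= C1 * `|x - y|) -> (forall x, 0 <= f x) -> 0 <= C ->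
  (forall x y, `|f (x + y) - f x - a x * y - b x * y ^+ 2| <= C * `|y| ^+ 3) ->
  `|iter K (walk_step ((Num.sqrt K%:R)^-1 * c)) f h - heat c f h| <=
  (Num.sqrt K%:R)^-1 * (C * (abs_moment3 + 1) * c ^+ 3).
Proof.
move=> K0 lip f0 C0 tay; set r := (Num.sqrt K%:R)^-1.
have Kr := rK K0; rewrite -/r in Kr.
have sK : Num.sqrt K%:R != 0 :> R by rewrite sqrtr_eq0 -ltNge ltr0n.
have r0 : 0 <= r * c by rewrite mulr_ge0// invr_ge0 sqrtr_ge0.
have := walk_heat lip f0 C0 tay K h r0.
have -> : Num.sqrt K%:R * (r * c) = c by rewrite mulrA /r divff// mul1r.
move/le_trans; apply.
have -> : K%:R * (C * (abs_moment3 + 1) * (r * c) ^+ 3) =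
    K%:R * r ^+ 2 * (r * (C * (abs_moment3 + 1) * c ^+ 3)) by ring.
by rewrite Kr mul1r.
Qed.

Lemma walk_magnetization_near K : (0 < K)%N ->
  `|walk_magnetization sigma t q h (Num.sqrt K%:R)^-1 K - q| <=
  (Num.sqrt K%:R)^-1 * (1100 * (abs_moment3 + 1) * c ^+ 3).
Proof.
move=> K0; have f0 x : 0 <= mag2 (- (q * t)) x by case/andP: (mag2_01 (- (q * t)) x).
have := scaled_walk_heat K0 (mag2_lip (- (q * t))) f0 (ler0n R 1100)
  (fun x y => magnetization_sqr_taylor P (Ns 0%N) (hs 0%N) x (- (q * t)) y).
by rewrite mag2E.
Qed.

Let rs_site := heat c (site_energy P (s 0%N) ^~ (- (q * t))) h.

Lemma walk_site_energy_near K : (0 < K)%N ->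
  `|iter K (walk_step ((Num.sqrt K%:R)^-1 * c)) (site_energy P (s 0%N) ^~ (- (q * t))) h
    - rs_site| <= (Num.sqrt K%:R)^-1 * (200 * (abs_moment3 + 1) * c ^+ 3).
Proof.
move=> K0; set f := site_energy P (s 0%N) ^~ (- (q * t)).
have lip x y : `|f x - f y| <= 1 * `|x - y|.
  have := site_energy_lipschitz P (Ns 0%N) (hs 0%N) x y (- (q * t)) (- (q * t)).
  by rewrite subrr normr0 addr0 mul1r.
(* The energy is raised by a constant to become nonnegative; the constant passes unchanged through
   the walk and the heat operator and drops out of the difference. *)
pose e := `|- (q * t)|; pose fe y := 1 * f y + e.
have N1 := subexponential_lipschitz lip h c.
have he : heat c fe h = rs_site + e.
  have -> : heat c fe h = gm (1 *: (fun g => f (h + c * g)) + cst e) by [].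
  rewrite gaussian_meanD ?gaussian_meanZ ?mul1r ?gaussian_mean_cst//; [exact: subexponentialZ|].
  exact: subexponential_cst.
have lipe x y : `|fe x - fe y| <= 1 * `|x - y|.
  by have := lip x y; congr (`|_| <= _); rewrite /fe; ring.
have fe0 x : 0 <= fe x.
  have := site_energy_ge (Ns 0%N) (hs 0%N) (pmean_symmetric (sigma_sym 0%N) (hs 0%N)) x (- (q * t)).
  by rewrite /fe mul1r -/e -[site_energy _ _ _ _]/(f x); lra.
have tay x y : `|fe (x + y) - fe x - magnetization P (s 0%N) x (- (q * t)) * y -
    (gibbs (pmean P) (site_potential (s 0%N) x (- (q * t))) (s 0%N ^+ 2)
     - magnetization P (s 0%N) x (- (q * t)) ^+ 2) / 2 * y ^+ 2| <= 200 * `|y| ^+ 3.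
  have := site_energy_taylor P (Ns 0%N) (hs 0%N) x y (- (q * t)).
  by congr (`|_| <= _); rewrite /fe /f; ring.
have := scaled_walk_heat K0 lipe fe0 (ler0n R 200) tay.
by rewrite he walk_affine mul1r; congr (`|_| <= _); ring.
Qed.

End FixedPoint.

End ReplicaSymmetric.

Section HighTemperature.
Context {R : realType} {d : measure_display} {T : measurableType d}.
Context (P : probability T R) (sigma : nat -> {RV P >-> R}) (h : R).
Hypotheses (sigma_iid : iid sigma) (sigma_sym : forall i, symmetric_rv (sigma i)).
Hypotheses (sigma_bounded : forall i w, -1 <= sigma i w <= 1).
Let s (i : nat) : T -> R := sigma i.
Let hs i w : `|s i w| <= 1 := spin_norm_le sigma_bounded i w.
Let Ns i : bounded_measurable (s i) := bounded_measurable_spin sigma_bounded i.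
Let L := free_energy (pmean P).
Let G0 n := field_potential sigma n (fun=> h) 0.
Let NG0 n : bounded_measurable (G0 n) := bounded_measurable_field sigma_bounded n _ _.
Context (t : R).
Hypotheses (t0 : 0 <= t) (t1 : 3 * t <= 64^-1).

Let B n M : R := 3 * t * n%:R / M%:R ^+ 2 + ln (4 * M + 1)%:R.

(** Everything that vanishes with K is collected in r C, where C may depend on n; what remains is
    [B], which is small compared with n once n and then M are large. *)
Lemma sk_block_bound q n : qlin sigma h (2 * q * t) = q -> (0 < n)%N ->
  exists C : R, forall K M, (0 < K)%N -> (0 < M)%N -> let r := (Num.sqrt K%:R)^-1 in
  `|iter K (sk_block s n t r) L (G0 n) - n%:R * replica_symmetric_energy sigma h t q|
     <= B n M + r * C /\
  t * n%:R * iter K (sk_block s n t r) (gibbs_dev P s n q) (G0 n) <= B n M + r * C.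
Proof.
move=> qE n0; have q01 := qlin_fixed_point_le1 sigma_bounded qE.
have /andP[q0 _] := q01.
have [C1 [C10 H]] := sk_interpolation P Ns hs n0 t0 q0.
pose c := Num.sqrt (2 * q * t).
pose D := (abs_moment3 + 1) * c ^+ 3.
have D0 : 0 <= D by rewrite mulr_ge0 ?exprn_ge0 ?sqrtr_ge0 ?addr_ge0 ?abs_moment3_ge0.
exists (C1 + 12 * t * n%:R * (1100 * D) + n%:R * (200 * D)) => K M K0 M0 /=.
set r := _^-1; have r0 : 0 <= r by rewrite invr_ge0 sqrtr_ge0.
have Kr : K%:R * r ^+ 2 = 1.
  by rewrite exprVn sqr_sqrtr// divff// pnatr_eq0 -lt0n.
have [_ h1 h2] := H K (G0 n) K0 (NG0 n).
have h3 := stage0_bound sigma_iid sigma_bounded h n0 M0 t0 t1 q01 Kr.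
have h4 := walk_magnetization_near sigma_bounded qE K0.
have h5 := walk_site_energy_near h sigma_sym sigma_bounded t q K0.
rewrite -/r in h1 h2 h3 h4 h5.
have n0R : 0 <= n%:R :> R by [].
have e : iter K (rs_block s n t q r) L (G0 n) = n%:R *
    iter K (walk_step (r * c)) (site_energy P (s 0%N) ^~ (- (q * t))) h.
  rewrite (rs_block_free_energy sigma_iid sigma_bounded)//.
  have -> : 0 - K%:R * (r ^+ 2 * (q * t)) = - (q * t) by rewrite mulrA Kr mul1r sub0r.
  by rewrite big_const_seq count_predT size_iota iter_addr_0 (mulr_natl _ n).
have g1 : 12 * t * n%:R * `|walk_magnetization sigma t q h r K - q| <=
    r * (12 * t * n%:R * (1100 * D)).
  rewrite mulrCA; apply: ler_wpM2l; first by rewrite !mulr_ge0.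
  by rewrite /D mulrA.
have g2 : n%:R * `|iter K (walk_step (r * c)) (site_energy P (s 0%N) ^~ (- (q * t))) h
    - heat c (site_energy P (s 0%N) ^~ (- (q * t))) h| <= r * (n%:R * (200 * D)).
  by rewrite mulrCA; apply: ler_wpM2l => //; rewrite /D mulrA.
have g3 : 0 <= r * (n%:R * (200 * D)) by exact: mulr_ge0 r0 (mulr_ge0 n0R (mulr_ge0 (ler0n R 200) D0)).
rewrite -[X in X * `|_|](ger0_norm n0R) -normrM mulrBr -e in g2.
rewrite replica_symmetric_energyE -/c /B; split.
  set z := heat _ _ _ in g2 *; set a := iter K (sk_block _ _ _ _) _ _ in h1 *.
  move: h1 g2; rewrite !ler_norml.
  have -> : n%:R * (t / 2 * q ^+ 2 + z) = t * n%:R * q ^+ 2 / 2 + n%:R * z by ring.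
  rewrite !(mulrDr r); move: h3 g1 g3; lra.
apply: le_trans h2 _; rewrite !(mulrDr r); move: h3 g1 g3; lra.
Qed.

(** Pointwise (x - q)^2 + (x - q')^2 >= (q - q')^2/2, so a single overlap cannot be close to both
    values. *)
Lemma gibbs_dev_ge q q' n H : (0 < n)%N -> bounded_measurable H ->
  (q - q') ^+ 2 / 2 <= gibbs_dev P s n q H + gibbs_dev P s n q' H.
Proof.
move=> n0 NH; pose A2 := @bounded_measurable_algebra R _ (T * T)%type.
have mmu := gibbs_is_mean A2 (pmean2_is_mean P) (bounded_measurable_lift NH).
have N1 := bounded_measurable_overlap_dev n q Ns.
have N2 := bounded_measurable_overlap_dev n q' Ns.
rewrite /gibbs_dev -(meanD mmu)//.
apply: (mean_ge A2 mmu); first exact: (fun_add A2).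
move=> z; rewrite fctE /overlap_dev; set x := pair_overlap _ _ _.
have := sqr_ge0 ((x - q) + (x - q')); lra.
Qed.

(** The operator [sk_block] is the same for both solutions, so their two deviation bounds can be
    added along the same path and contradict [gibbs_dev_ge] unless q = q'. *)
Lemma fixed_point_unique q q' : qlin sigma h (2 * q * t) = q ->
  qlin sigma h (2 * q' * t) = q' -> q = q'.
Proof.
(* At t = 0 both solutions equal [qlin] at 0; the overlap argument needs t > 0, since its bounds
   carry the factor t. *)
move=> qE qE'; move: t0; rewrite le0r => /predU1P[t00|tp].
  by rewrite -qE -qE' t00 !mulr0.
have key n M : (0 < n)%N -> (0 < M)%N ->
    t * ((q - q') ^+ 2 / 2) <= 6 * t / M%:R ^+ 2 + (2 * ln (4 * M + 1)%:R) / n%:R.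
  move=> n0 M0; have nR : 0 < n%:R :> R by rewrite ltr0n.
  have [C H] := sk_block_bound qE n0; have [C' H'] := sk_block_bound qE' n0.
  suff : t * n%:R * ((q - q') ^+ 2 / 2) <= 2 * B n M.
    have -> : 2 * B n M = n%:R * (6 * t / M%:R ^+ 2 + 2 * ln (4 * M + 1)%:R / n%:R).
      by rewrite /B; field; rewrite !pnatr_eq0 -!lt0n M0 n0.
    by rewrite mulrAC mulrC (ler_pM2l nR).
  apply: (@le_of_invsqrt_bound _ _ _ (C + C')) => K K0.
  have [_ h1] := H K M K0 M0; have [_ h2] := H' K M K0 M0.
  have mk : markov bounded_measurable (iter K (sk_block s n t (Num.sqrt K%:R)^-1)).
    apply: markov_iter; apply: markov_scaled_block => p; exact: bounded_measurable_sk.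
  have h3 := markov_ge_cst mk (c := (q - q') ^+ 2 / 2)
    (Phi := fun H => gibbs_dev P s n q H + gibbs_dev P s n q' H) (fun H NH => gibbs_dev_ge q q' n0 NH) (NG0 n).
  have tn : 0 <= t * n%:R by rewrite mulr_ge0.
  have h4 : t * n%:R * ((q - q') ^+ 2 / 2) <= t * n%:R *
      (iter K (sk_block s n t (Num.sqrt K%:R)^-1) (gibbs_dev P s n q) (G0 n) +
       iter K (sk_block s n t (Num.sqrt K%:R)^-1) (gibbs_dev P s n q') (G0 n)).
    by rewrite ler_wpM2l// -(markovD _ _ _ mk).
  rewrite mulrDr in h4; apply: le_trans h4 (le_trans (lerD h1 h2) _).
  by rewrite le_eqVlt; apply/orP; left; apply/eqP; move: (B n M) => b; ring.
have : (q - q') ^+ 2 / 2 <= 0.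
  rewrite -(pmulr_rle0 _ tp).
  apply: (@le_of_invn_bound _ _ _ (6 * t)) => M M0; rewrite add0r.
  have := @le_of_invn_bound _ _ _ _ (fun n n0 => key n M n0 M0).
  move/le_trans; apply; rewrite ler_wpM2l ?mulr_ge0// lef_pV2 ?posrE ?exprn_gt0 ?ltr0n//.
  by rewrite ler_eXnr// ler1n.
rewrite pmulr_lle0 ?invr_gt0// => q2.
have : (q - q') ^+ 2 == 0 by rewrite eq_le sqr_ge0 q2.
by rewrite sqrf_eq0 subr_eq0 => /eqP.
Qed.

Context {d' : measure_display} {T' : measurableType d'} (Pg : probability T' R).
Context (g : nat -> nat -> {RV Pg >-> R}).
Hypothesis g_gaussian : gaussian_disorder g.

(** With y^2 = 2 t/n the replacement error n^2 * 200 y^3 (8 [majorant_mean] + 2) becomes n D y,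
    whence 400. *)
Let D : R := 400 * (8 * majorant_mean + 2) * t.

Let D0 : 0 <= D.
Proof.
exact: mulr_ge0 (mulr_ge0 (ler0n R 400) (addr_ge0 (mulr_ge0 (ler0n R 8) majorant_mean_ge0)
  (ler0n R 2))) t0.
Qed.

(** The error D y of order 1/sqrt n is split by y <= 1/M + M y^2, which brings it to the two-scale
    form with 1/M and 1/n. *)
Lemma mean_free_energy_near q n M : qlin sigma h (2 * q * t) = q ->
  (0 < n)%N -> (0 < M)%N ->
  `|mean_free_energy sigma h g n t - replica_symmetric_energy sigma h t q| <=
  (D + 3 * t) / M%:R + (2 * t * D * M%:R + ln (4 * M + 1)%:R) / n%:R.
Proof.
move=> qE n0 M0; have nR : 0 < n%:R :> R by rewrite ltr0n.
have MR : 0 < M%:R :> R by rewrite ltr0n.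
have [C H] := sk_block_bound qE n0.
set u := mean_free_energy _ _ _ _ _; set v := replica_symmetric_energy _ _ _ _.
pose y := Num.sqrt (t * 2 / n%:R).
have y0 : 0 <= y := sqrtr_ge0 _.
have y2 : y ^+ 2 = t * 2 / n%:R by rewrite sqr_sqrtr// divr_ge0 ?mulr_ge0// ltW.
have h1 : `|n%:R * u - n%:R * v| <= n%:R * (D * y) + B n M.
  apply: (@le_of_invsqrt_bound _ _ _ C) => K K0.
  have [h1 _] := H K M K0 M0.
  have Kr : K%:R * (Num.sqrt K%:R)^-1 ^+ 2 = 1 :> R.
    by rewrite exprVn sqr_sqrtr// divff// pnatr_eq0 -lt0n.
  have h2 := sk_free_energy_near h sigma_bounded g_gaussian n0 t0 Kr.
  have e : (n * n)%:R * (200 * y ^+ 3 * (8 * majorant_mean + 2)) = n%:R * (D * y) :> R.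
    by rewrite natrM (exprS y 2) y2 /D; field; rewrite gt_eqF.
  rewrite e in h2; rewrite -addrA.
  apply: le_trans (ler_distD _ _ _) _; exact: lerD h2 h1.
have h2 : y <= M%:R^-1 + M%:R * y ^+ 2.
  have : 0 <= M%:R^-1 * ((1 - M%:R * y) ^+ 2 + M%:R * y).
    by rewrite mulr_ge0 ?invr_ge0 ?addr_ge0 ?sqr_ge0 ?mulr_ge0// ltW.
  have -> : M%:R^-1 * ((1 - M%:R * y) ^+ 2 + M%:R * y) = M%:R^-1 + M%:R * y ^+ 2 - y.
    by field; rewrite gt_eqF.
  by rewrite subr_ge0.
have h3 : 3 * t / M%:R ^+ 2 <= 3 * t / M%:R.
  rewrite ler_wpM2l ?mulr_ge0// lef_pV2 ?posrE ?exprn_gt0//.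
  by rewrite ler_eXnr// ler1n.
rewrite -(ler_pM2l nR) -[X in X * `|_|](gtr0_norm nR) -normrM mulrBr.
apply: le_trans h1 _; rewrite /B.
have -> : n%:R * ((D + 3 * t) / M%:R + (2 * t * D * M%:R + ln (4 * M + 1)%:R) / n%:R) =
    n%:R * (D * (M%:R^-1 + M%:R * y ^+ 2)) + n%:R * (3 * t / M%:R) + ln (4 * M + 1)%:R.
  by rewrite y2; field; rewrite !gt_eqF.
rewrite addrA; apply: lerD => //; apply: lerD.
  exact: ler_wpM2l (ltW nR) _ _ (ler_wpM2l D0 h2).
have -> : 3 * t * n%:R / M%:R ^+ 2 = n%:R * (3 * t / M%:R ^+ 2) by ring.
exact: ler_wpM2l (ltW nR) _ _ h3.
Qed.

Lemma mean_free_energy_cvg q : qlin sigma h (2 * q * t) = q ->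
  mean_free_energy sigma h g n t @[n --> \oo] --> replica_symmetric_energy sigma h t q.
Proof.
move=> qE; apply: (@cvg_of_two_scale_bound _ _ _ (D + 3 * t)
  (fun M => 2 * t * D * M%:R + ln (4 * M + 1)%:R)) => n M n0 M0.
exact: mean_free_energy_near.
Qed.

End HighTemperature.

Theorem theorem1 (R : realType)
    (d : measure_display) (T : measurableType d) (P : probability T R)
    (sigma : nat -> {RV P >-> R})
    (d' : measure_display) (T' : measurableType d') (Pg : probability T' R)
    (g : nat -> nat -> {RV Pg >-> R})
    (h : R)
    (h_ge0 : 0 <= h)
    (sigma_iid : iid sigma)
    (sigma_sym : forall i, symmetric_rv (sigma i))
    (sigma_bounded : forall i w, -1 <= sigma i w <= 1)
    (g_gaussian : gaussian_disorder g) :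
  exists tc : R, 0 < tc /\
    forall t : R, 0 <= t <= tc ->
      (exists! q : R, 0 <= q /\ qlin sigma h (2 * q * t) = q) /\
      (forall q : R, 0 <= q -> qlin sigma h (2 * q * t) = q ->
         mean_free_energy sigma h g n t @[n --> \oo]
           --> replica_symmetric_energy sigma h t q).
Proof.
(* 192 = 3 * 64, so that the initial coupling 3t stays below 1/64. *)
exists 192^-1; split=> [|t /andP[t0 tc]]; first by rewrite invr_gt0.
have t1 : 3 * t <= 64^-1 by lra.
split=> [|q _ qE]; last exact: (mean_free_energy_cvg sigma_iid sigma_sym sigma_bounded t0 t1 g_gaussian qE).
have [q [q0 qE]] := qlin_fixed_point h sigma_bounded t.
exists q; split=> // q' [_ qE'].
exact: (fixed_point_unique sigma_iid sigma_sym sigma_bounded t0 t1 qE qE').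
Qed.
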